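(* Let $t>0$ and $a,b\ge 0$, and let $\rho=\{\rho_s\}_{0\le s\le t}$ be a three-dimensional Bessel bridge from $a$ to $b$ over $[0,t]$, with time reversal $\mathring{\rho}$. Then the three-dimensional process $$\left(\overline{\mathcal{M}}_{b-a}(\mathring{\rho}-b)(s)+a,\ \overline{\mathcal{P}}(\mathring{\rho})(s)+b,\ \mathring{\rho}_s\right),\quad 0\le s\le t,$$ has the same law as $$\left(\rho_s,\ \overline{\mathcal{P}}(\rho)(s)+a,\ \overline{\mathcal{M}}_{a-b}(\rho-a)(s)+b\right),\quad 0\le s\le t.$$
   Context: Fix $t>0$. For $\phi\in C([0,t];\mathbb{R})$ (real-valued continuous functions on $[0,t]$), the time reversal is $\mathring{\phi}_s:=\phi_{t-s}$, $0\le s\le t$. For $x\in\mathbb{R}$, the map $\overline{\mathcal{M}}_x:C([0,t];\mathbb{R})\to C([0,t];\mathbb{R})$ is $$\overline{\mathcal{M}}_x(\phi)(s):=\phi_s-\frac{\phi_t-x}{2}+\left|\frac{\phi_t-x}{2}+\min_{0\le u\le s}\phi_u-\min_{s\le u\le t}\phi_u\right|-\Bigl|\min_{0\le u\le s}\phi_u-\min_{s\le u\le t}\phi_u\Bigr|,\quad 0\le s\le t.$$ Also $\overline{\mathcal{P}}(\phi)(s):=\phi_s-2\min_{0\le u\le s}\phi_u$. For a constant $k$, $\phi-k$ denotes the function $s\mapsto\phi_s-k$. A three-dimensional Bessel bridge from $a\ge0$ to $b\ge0$ over $[0,t]$ is the nonnegative continuous process on $[0,t]$ starting at $a$ and ending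 at $b$ (a three-dimensional Bessel process started at $a$ conditioned to be at $b$ at time $t$) whose finite-dimensional laws at times $0<s_1<\dots<s_n<t$ are $$\frac{q_{s_1}(a,x_1)q_{s_2-s_1}(x_1,x_2)\cdots q_{t-s_n}(x_n,b)}{q_t(a,b)}\prod_{i=1}^n x_i^2\,dx_i$$ on $(0,\infty)^n$, where $q_r(x,y)=\frac{1}{xy\sqrt{2\pi r}}\left(e^{-(x-y)^2/(2r)}-e^{-(x+y)^2/(2r)}\right)$ for $x,y>0$, extended continuously to $x,y\ge0$. Equality of laws is as $C([0,t];\mathbb{R}^3)$-valued random variables. *)

(* Defs.v *)
From HB Require Import structures.
From mathcomp Require Import all_boot all_order all_algebra.
From mathcomp Require Import all_classical all_reals all_analysis.
From mathcomp Require Import ring lra.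
Set Implicit Arguments.
Unset Strict Implicit.
Unset Printing Implicit Defensive.
Import Order.TTheory GRing.Theory Num.Theory.
Import numFieldTopology.Exports numFieldNormedType.Exports.
Local Open Scope classical_set_scope.
Local Open Scope ring_scope.

Section time_interval.
Context {R : realType} (t : {posnum R}).

Definition timeI : set R := `[0, t%:num]%classic.

Lemma timeI_start : 0 \in timeI.
Proof. by rewrite mem_set// /timeI/= in_itv/= lexx/=. Qed.

Lemma timeI_end : t%:num \in timeI.
Proof. by rewrite mem_set// /timeI/= in_itv/= lexx andbT. Qed.

Lemma timeI_rev (s : timeI) : t%:num - \val s \in timeI.
Proof.
have := valP s; rewrite !inE /timeI/= !in_itv/= => /andP[s0 st].
by rewrite subr_ge0 st/= lerBlDr lerDl.
Qed.

Definition time_start : timeI := exist _ 0 timeI_start.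
Definition time_end : timeI := exist _ t%:num timeI_end.
Definition time_rev (s : timeI) : timeI := exist _ (t%:num - \val s) (timeI_rev s).

Lemma time_rev_continuous : continuous time_rev.
Proof.
apply: continuous_comp_initial => s.
apply: (@continuousB _ _ _ (cst t%:num) (set_val : timeI -> R)).
  exact: cst_continuous.
exact: initial_continuous.
Qed.

Lemma timeI_compact : compact [set: timeI].
Proof.
have clampI (x : R) : Num.max 0 (Num.min x t%:num) \in timeI.
  rewrite mem_set// /timeI/= in_itv/= le_max lexx/=.
  by rewrite ge_max ge_min lexx orbT ge0.
pose clamp (x : R) : timeI :=
    exist (fun x => x \in timeI) _ (clampI x).
have clampc : continuous clamp.
  apply: continuous_comp_initial => x /=.
  apply: (@continuous_max _ _ (cst 0) (id \min cst t%:num)).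
    exact: cst_continuous.
  by apply: (@continuous_min _ _ id (cst t%:num)) => //; exact: cst_continuous.
have -> : [set: timeI] = clamp @` `[0, t%:num]%classic.
  apply/seteqP; split => // s _; exists (\val s).
    by have := valP s; rewrite inE.
  apply/val_inj => /=.
  have := valP s; rewrite inE /timeI/= in_itv/= => /andP[s0 st].
  by rewrite (min_idPl st) (max_idPr s0).
apply: continuous_compact; last exact: segment_compact.
exact: continuous_subspaceT.
Qed.

End time_interval.

Section cpath.
Context {R : realType} (t : {posnum R}) (V : normedModType R).

(* C([0, t]; V) with the topology of uniform convergence (see cpath_ballE) and
   its Borel sigma-algebra. *)
Definition cpath := continuousType (timeI t) V.

Definition cpath_fun (f : cpath) : timeI t -> V := f.

HB.instance Definition _ := Choice.on cpath.
HB.instance Definition _ := isPointed.Build cpath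
  (@mkcts (timeI t) V (cst 0) (@cst_continuous _ _ 0)).
HB.instance Definition _ := PseudoMetric.copy cpath
  (initial_topology (cpath_fun : cpath -> arrow_uniform_type (timeI t) V)).
HB.instance Definition _ :=
  Measurable.copy cpath (g_sigma_algebraType (@open cpath)).

Lemma cpath_ballE (f g : cpath) (e : R) :
  ball f e g <-> forall s, `|f s - g s| < e.
Proof.
split=> h.
  by move=> s; have := h s; rewrite -ball_normE.
by move=> s; have := h s; rewrite -ball_normE.
Qed.

End cpath.

Section path_maps.
Context {R : realType} {t : {posnum R}}.
Implicit Types (phi psi chi : cpath t R) (s u : timeI t).

Definition trev phi : cpath t R :=
  mkcts (fun s => continuous_comp (@time_rev_continuous R t s) (@cts_fun _ _ phi _)).

Lemma addc_continuous phi (k : R) : continuous (fun s => phi s + k).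
Proof.
move=> s; apply: (@continuousD _ _ _ (phi : timeI t -> R)).
  exact: cts_fun.
exact: cst_continuous.
Qed.

Definition addc phi (k : R) : cpath t R := mkcts (@addc_continuous phi k).

Definition path3 phi psi chi : timeI t -> R * R * R :=
  fun s => (phi s, psi s, chi s).

Lemma path3_continuous phi psi chi : continuous (path3 phi psi chi).
Proof.
move=> s; have [cphi cpsi cchi] : [/\ phi u @[u --> s] --> phi s,
    psi u @[u --> s] --> psi s & chi u @[u --> s] --> chi s].
  by split; exact: cts_fun.
exact: cvg_pair (cvg_pair cphi cpsi) cchi.
Qed.

Definition cpath3 phi psi chi : cpath t (R * R * R)%type :=
  mkcts (@path3_continuous phi psi chi).

Definition past s : set (timeI t) := [set u | \val u <= \val s].
Definition future s : set (timeI t) := [set u | \val s <= \val u].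

(* The infimum is a minimum on closed nonempty sets, see minover_attained. *)
Definition minover (A : set (timeI t)) phi : R := inf (phi @` A).

Lemma cpath_has_lbound phi (A : set (timeI t)) : has_lbound (phi @` A).
Proof.
have [|||c _ hc] := @compact_EVT_min (timeI t) R phi setT.
- by exists (time_start t).
- exact: timeI_compact.
- apply: continuous_subspaceT; exact: cts_fun.
by exists (phi c) => _ [u _ <-]; apply: hc; rewrite inE.
Qed.

Lemma minover_le phi (A : set (timeI t)) u : A u -> minover A phi <= phi u.
Proof. by move=> Au; apply: ge_inf; [exact: cpath_has_lbound|exists u]. Qed.

Lemma le_minover phi (A : set (timeI t)) (m : R) : A !=set0 ->
  (forall u, A u -> m <= phi u) -> m <= minover A phi.
Proof.
by move=> [u Au] h; apply: lb_le_inf => [|_ [v Av <-]]; [exists (phi u), u|exact: h].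
Qed.

Lemma minover_attained phi (A : set (timeI t)) : A !=set0 -> closed A ->
  exists2 u, A u & minover A phi = phi u.
Proof.
move=> A0 cA; have [||c Ac hc] := @compact_EVT_min (timeI t) R phi A A0.
- exact: (subclosed_compact cA (@timeI_compact R t) (@subsetT _ A)).
- apply: continuous_subspaceT; exact: cts_fun.
exists c; first exact/set_mem.
apply/eqP; rewrite eq_le minover_le//=; last exact/set_mem.
by apply: le_minover => // u Au; apply: hc; exact/mem_set.
Qed.

Lemma val_timeI_continuous : continuous (fun u : timeI t => \val u : R).
Proof. exact: (@initial_continuous _ _ (set_val : timeI t -> R)). Qed.

Lemma closed_past s : closed (past s).
Proof.
apply: (@preimage_closed _ _ (fun u : timeI t => \val u : R) [set x | x <= \val s]).
  by move=> x _; exact: val_timeI_continuous.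
exact: closed_le.
Qed.

Lemma closed_future s : closed (future s).
Proof.
apply: (@preimage_closed _ _ (fun u : timeI t => \val u : R) [set x | x >= \val s]).
  by move=> x _; exact: val_timeI_continuous.
exact: closed_ge.
Qed.

Lemma minover_continuous phi (A : timeI t -> set (timeI t)) :
  (forall s, A s s) ->
  (forall s s' u, A s u -> A s' u \/
    (`|\val s - \val u| <= `|\val s - \val s'|) &&
    (`|\val s' - \val u| <= `|\val s - \val s'|)) ->
  continuous (fun s => minover (A s) phi).
Proof.
move=> As AA s.
apply/(@cvgrPdist_le _ _ _ (nbhs s) (nbhs_filter s)) => e e0.
have e2 : 0 < e / 2 by rewrite divr_gt0.
have /(@cvgrPdist_le _ _ _ (nbhs s) (nbhs_filter s))/(_ _ e2)/nbhs_ballP[d /= d0 hd] := @cts_fun _ _ phi s.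
apply/nbhs_ballP; exists d => //= s' ss'.
have sh u : `|\val s - \val u| <= `|\val s - \val s'| -> `|phi s - phi u| <= e / 2.
  by move=> h; apply: hd; exact: le_lt_trans ss'.
have := sh s' (lexx _); rewrite ler_distl => /andP[hs1 hs2].
have ms : minover (A s) phi <= phi s by exact: minover_le.
have ms' : minover (A s') phi <= phi s' by exact: minover_le.
rewrite ler_distl; apply/andP; split.
  apply: le_minover; first by exists s.
  move=> u /(AA _ s')[/(minover_le phi) h|/andP[/sh + _]]; first lra.
  by rewrite ler_distl => /andP[]; lra.
rewrite -lerBlDr; apply: le_minover; first by exists s'.
move=> u /(AA _ s)[/(minover_le phi) h|/andP[_]]; first lra.
rewrite [X in _ <= X]distrC => /sh.
by rewrite ler_distl => /andP[]; lra.
Qed.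

Lemma past_min_continuous phi : continuous (fun s => minover (past s) phi).
Proof.
apply: minover_continuous => [s|s s' u]; rewrite /past/= //.
have [us'|s'u] := leP (\val u) (\val s'); first by left.
move=> us; right; rewrite (distrC (\val s')).
rewrite !ger0_norm ?subr_ge0 ?(ltW s'u) ?(le_trans (ltW s'u) us)//.
move: us s'u => /=; set x := sval s; set y := sval s'; set z := sval u.
by move=> us s'u; apply/andP; split; lra.
Qed.

Lemma future_min_continuous phi : continuous (fun s => minover (future s) phi).
Proof.
apply: minover_continuous => [s|s s' u]; rewrite /future/= //.
have [us'|s'u] := leP (\val s') (\val u); first by left.
move=> us; right; rewrite !(distrC (\val s)).
rewrite !ger0_norm ?subr_ge0 ?(ltW s'u) ?(le_trans us (ltW s'u))//.
move: us s'u => /=; set x := sval s; set y := sval s'; set z := sval u.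
by move=> us s'u; apply/andP; split; lra.
Qed.

Definition Mbar_fun (x : R) phi : timeI t -> R := fun s =>
  phi s - (phi (time_end t) - x) / 2
  + `|(phi (time_end t) - x) / 2
      + minover (past s) phi - minover (future s) phi|
  - `|minover (past s) phi - minover (future s) phi|.

Lemma Mbar_continuous (x : R) phi : continuous (Mbar_fun x phi).
Proof.
move=> s; have cphi : phi u @[u --> s] --> phi s by exact: cts_fun.
have := @past_min_continuous phi s; have := @future_min_continuous phi s.
move=> cf cp; have FF : Filter (nbhs s) := nbhs_filter s.
apply: (@cvgB _ _ _ (nbhs s)).
  apply: (@cvgD _ _ _ (nbhs s)); first by apply: cvgB => //; exact: cvg_cst.
  apply: cvg_norm; apply: (@cvgB _ _ _ (nbhs s)) => //.
  by apply: cvgD => //; exact: cvg_cst.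
by apply: cvg_norm; exact: cvgB.
Qed.

Definition Mbar (x : R) phi : cpath t R := mkcts (@Mbar_continuous x phi).

Definition Pbar_fun phi : timeI t -> R :=
  fun s => phi s - 2 * minover (past s) phi.

Lemma Pbar_continuous phi : continuous (Pbar_fun phi).
Proof.
move=> s; have cphi : phi u @[u --> s] --> phi s by exact: cts_fun.
have cp := @past_min_continuous phi s; have FF : Filter (nbhs s) := nbhs_filter s.
apply: (@cvgB _ _ _ (nbhs s)) => //.
by apply: (@cvgM _ _ (nbhs s)) => //; exact: cvg_cst.
Qed.

Definition Pbar phi : cpath t R := mkcts (@Pbar_continuous phi).

End path_maps.

Section bessel_kernel.
Context {R : realType}.
Implicit Types r x y : R.

(* For x * y != 0 this is the usual formula; on the axes it is the value of
   the continuous extension, see bessel_kernel_continuous. *)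
Definition bessel_kernel r x y : R :=
  if x * y == 0 then
    2 / (r * Num.sqrt (2 * pi * r)) * expR (- (x ^+ 2 + y ^+ 2) / (2 * r))
  else
    1 / (x * y * Num.sqrt (2 * pi * r)) *
    (expR (- (x - y) ^+ 2 / (2 * r)) - expR (- (x + y) ^+ 2 / (2 * r))).

Let h (z : R) : R := if z == 0 then 2 else (expR z - expR (- z)) / z.

Let h_continuous : continuous h.
Proof.
move=> z; have [->|z0] := eqVneq z 0; last first.
  have : {for z, continuous (fun u : R => (expR u - expR (- u)) / u)}.
    apply: cvgM; last exact: cvgV.
    apply: cvgB; first exact: continuous_expR.
    by apply: (@continuous_comp _ _ _ -%R expR);
      [exact: opp_continuous|exact: continuous_expR].
  rewrite /continuous_at [h z]ifF; last exact/negbTE.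
  apply: cvg_trans; apply: near_eq_cvg; near=> u; rewrite /h ifF//.
  by apply/negbTE; near: u; exact: (open_nbhs_nbhs (conj (@open_neq R 0) z0)).
have [dr dv] : is_derive (0 : R) 1 (fun u : R => expR u - expR (- u)) 2.
  by apply: is_derive_eq; rewrite oppr0 expR0; ring.
apply/continuous_withinNx; rewrite /= {2}/h eqxx -dv.
apply: cvg_trans dr; apply: near_eq_cvg; near=> u.
have u0 : u != 0 by near: u; exact: nbhs_dnbhs_neq.
rewrite /h (negbTE u0) /= addr0 oppr0 subrr subr0 scaler1.
by rewrite [_ *: _]mulrC.
Unshelve. all: by end_near. Qed.

Lemma bessel_kernel_continuous r : 0 < r ->
  continuous (fun p : R * R => bessel_kernel r p.1 p.2).
Proof.
move=> r0.
have -> : (fun p : R * R => bessel_kernel r p.1 p.2) = (fun p =>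
    1 / (r * Num.sqrt (2 * pi * r)) *
    expR (- (p.1 ^+ 2 + p.2 ^+ 2) / (2 * r)) * h (p.1 * p.2 / r)).
  apply/funext => -[x y] /=; rewrite /bessel_kernel /h.
  have sr0 : Num.sqrt (2 * pi * r) != 0.
    by rewrite gt_eqF// sqrtr_gt0 !mulr_gt0// pi_gt0.
  rewrite [x * y / r == 0]mulf_eq0 invr_eq0 (gt_eqF r0) orbF.
  have [_|xy0] := eqVneq (x * y) 0; first by field; rewrite sr0 gt_eqF.
  have -> : - (x - y) ^+ 2 / (2 * r) =
      - (x ^+ 2 + y ^+ 2) / (2 * r) + x * y / r by field; rewrite gt_eqF.
  have -> : - (x + y) ^+ 2 / (2 * r) =
      - (x ^+ 2 + y ^+ 2) / (2 * r) + - (x * y / r) by field; rewrite gt_eqF.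
  rewrite !expRD; field; rewrite sr0 (gt_eqF r0)/=.
  by move: xy0; rewrite mulf_eq0 negb_or andbT => /andP[-> ->].
move=> p; have cfst : (fun q : R * R => q.1) u @[u --> p] --> p.1 by exact: cvg_fst.
have csnd : (fun q : R * R => q.2) u @[u --> p] --> p.2 by exact: cvg_snd.
apply: cvgM.
  apply: cvgM; first exact: cvg_cst.
  apply: continuous_cvg; first exact: continuous_expR.
  apply: cvgM; last exact: cvg_cst.
  apply: (@cvgN _ _ _ (nbhs p)).
  by apply: (@cvgD _ _ _ (nbhs p)); apply: (@cvgM _ _ (nbhs p)).
apply: (@continuous_cvg _ _ _ (nbhs p)); first exact: h_continuous.
by apply: cvgM; [exact: cvgM|exact: cvg_cst].
Qed.

End bessel_kernel.

Section bessel_bridge.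
Context {R : realType}.

(* Integral of a nonnegative f over ]0, +oo[^n with respect to the
   n-dimensional Lebesgue measure, written as an iterated integral (Tonelli). *)
Fixpoint iter_integral n : (n.-tuple R -> \bar R) -> \bar R :=
  if n is n'.+1 then fun f =>
    (\int[lebesgue_measure]_(x in `]0%R, +oo[)
      iter_integral (fun y : n'.-tuple R => f [tuple of x :: y]))%E
  else fun f => f [tuple].

(* The sequences are padded with the two endpoints (0, a) and (t, b). *)
Definition bridge_density (t a b : R) n (s x : n.-tuple R) : R :=
  let s' := 0 :: rcons s t in
  let x' := a :: rcons x b in
  (\prod_(i < n.+1) bessel_kernel (s'`_i.+1 - s'`_i) x'`_i x'`_i.+1) /
  bessel_kernel t a b * \prod_(i < n) tnth x i ^+ 2.

Context {t : {posnum R}} {d : measure_display} {T : measurableType d}.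

Definition bessel3_bridge (a b : R) (P : probability T R)
    (rho : {RV P >-> cpath t R}) : Prop :=
  [/\ {ae P, forall w, rho w (time_start t) = a},
      {ae P, forall w, rho w (time_end t) = b},
      {ae P, forall w, forall s : timeI t, 0 <= rho w s} &
      forall (n : nat) (s : n.-tuple (timeI t)) (A : set (n.-tuple R)),
        let s' := [tuple \val (tnth s i) | i < n] in
        sorted <%R (0 :: rcons s' t%:num) -> measurable A ->
        P [set w | A [tuple rho w (tnth s i) | i < n]] =
        iter_integral (fun x => (\1_A x * bridge_density t%:num a b s' x)%:E)].

Definition same_law d' (U : measurableType d') (P : probability T R)
    (X Y : T -> U) : Prop :=
  [/\ measurable_fun setT X, measurable_fun setT Y &
      forall A, measurable A -> P (X @^-1` A) = P (Y @^-1` A)].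

End bessel_bridge.

(* Main.v *)
Require Import Defs.
From mathcomp Require Import all_boot all_order all_algebra.
From mathcomp Require Import all_classical all_reals all_analysis.
From mathcomp Require Import measurable_realfun ring lra.
Set Implicit Arguments.
Unset Strict Implicit.
Unset Printing Implicit Defensive.
Import Order.TTheory GRing.Theory Num.Theory.
Import numFieldTopology.Exports numFieldNormedType.Exports.
Local Open Scope classical_set_scope.
Local Open Scope ring_scope.

(** Discretise the bridge on a grid of mesh [r].  Between consecutive values
    [x], [y] insert an auxiliary valley [v] with weight [2 u / r * gauss u],
    [u = x + y - 2 v] (the minimum of a Brownian bridge from [x] to [y]).
    Integrating it over [0 < v < min x y] gives [x * y * q_r(x, y)], so the law
    of the bridge on the grid is an integral over positive zigzags, weighted by
    kernels at their two free endpoints [al] and [be].  Given the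
    Pitman transform of a zigzag, with final height [z], the starting point [al]
    and the global minimum [c] are distributed according to Lebesgue measure on
    [0 < c < min al be], where [be = z + 2 c - al] (intertwining).  This
    measure is symmetric in [al] and [be], and exchanging them turns
    [(X, Pbar X, Mbar X)] into its mirror image: this is the theorem for
    zigzags.  When the mesh tends to 0 the valleys become close to the smaller
    neighbouring peak, because a depth [e] costs a factor [expR (- 2 e^2 / r)]
    while there are only [t / r] of them, and the identity passes to the limit
    for bounded Lipschitz functionals of the paths, which determine the law. *)

(** * Measurability and Lebesgue integrals *)

(** The endpoints [al] and [be] are the values one mesh after the start and one mesh before the end;
    [a] and [b] enter only through the weights [end_kernel]. This allows [a = 0] or [b = 0], where
    no positive zigzag could start or end, and supplies the Lebesgue measure in [al] that the
    exchange needs. Exchanging [al] and [be] turns the weight of a bridge from [a] to [b] into that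
    of a bridge from [b] to [a]; time reversal of paths serves to produce a bridge of the second
    kind, the density being symmetric. The intertwining rests on one fact: the transform preserves
    the depth [x + y - 2 * v] of each move, hence its weight, whatever the nonnegative measurable
    [g]. The Gaussian is needed only to identify the mass of a move and to bound deep valleys.
    Valleys are not functions of the bridge, so the zigzag identity cannot be read on grid values.
    Rows computed from the peaks alone, through [skeleton], replace the true ones, up to a multiple
    of [e] plus the expected number of valleys deeper than [e]. Integrals live in [\bar R]; masses
    are known to be finite because the bridge law normalises them. *)

Section measurability.
Context {R : realType} {d : measure_display} {H : measurableType d}.
Context {d1 d2 d3 d4 : measure_display} {T1 : measurableType d1}
  {T2 : measurableType d2} {T3 : measurableType d3} {T4 : measurableType d4}.

Lemma measurable_fun2 (f : T1 -> T2 -> T3) (a : H -> T1) (b : H -> T2) :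
  measurable_fun setT (fun p => f p.1 p.2) ->
  measurable_fun setT a -> measurable_fun setT b ->
  measurable_fun setT (fun h => f (a h) (b h)).
Proof.
move=> mf ma mb.
exact: (measurableT_comp mf (measurable_fun_pair ma mb)).
Qed.

Lemma measurable_fun3 (f : T1 -> T2 -> T3 -> T4)
    (a : H -> T1) (b : H -> T2) (c : H -> T3) :
  measurable_fun setT (fun p => f p.1.1 p.1.2 p.2) ->
  measurable_fun setT a -> measurable_fun setT b -> measurable_fun setT c ->
  measurable_fun setT (fun h => f (a h) (b h) (c h)).
Proof.
move=> mf ma mb mc.
exact: (measurableT_comp mf
  (measurable_fun_pair (measurable_fun_pair ma mb) mc)).
Qed.

Lemma measurable_integral (f : H -> R -> \bar R) :
  measurable_fun setT (fun p => f p.1 p.2) -> (forall h x, 0 <= f h x)%E ->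
  measurable_fun setT (fun h => \int[lebesgue_measure]_x f h x)%E.
Proof.
move=> mf f0.
exact: (@measurable_fun_fubini_tonelli_F _ _ H (measurableTypeR R) R
  lebesgue_measure (fun p => f p.1 p.2)).
Qed.

End measurability.

Section lebesgue_invariance.
Context {R : realType}.
Notation mu := (@lebesgue_measure R).
Local Open Scope ereal_scope.

Lemma exchange_integral (f : R -> R -> \bar R) :
  measurable_fun setT (fun p => f p.1 p.2) -> (forall x y, 0 <= f x y) ->
  \int[mu]_x \int[mu]_y f x y = \int[mu]_y \int[mu]_x f x y.
Proof.
move=> mf f0.
exact: (@fubini_tonelli _ _ (measurableTypeR R) (measurableTypeR R) R mu mu
  (fun p => f p.1 p.2)).
Qed.

Lemma integral_shift (f : R -> \bar R) (c : R) :
  measurable_fun setT f -> (forall x, 0 <= f x) ->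
  \int[mu]_x f (x + c)%R = \int[mu]_x f x.
Proof.
move=> mf f0.
pose phi : measurableTypeR R -> measurableTypeR R := fun x : R => (x + c)%R.
have mphi : measurable_fun setT phi.
  exact: (@measurable_funD _ R R setT id (cst c)).
have := @ge0_integral_pushforward _ _ _ (measurableTypeR R) R phi mphi mu setT f measurableT mf
  (fun y _ => f0 y).
rewrite preimage_setT => <-.
apply: eq_measure_integral => //= A mA _.
(* Uniqueness of Lebesgue measure reduces the invariance to half-open intervals. *)
apply/esym/lebesgue_measure_unique => //= _ [[a b]] _ <-.
rewrite /pushforward.
have -> : phi @^-1` `]a, b]%classic = `](a - c)%R, (b - c)%R]%classic.
  apply/seteqP; split=> x /=; rewrite /phi !in_itv/= => /andP[? ?];
  by apply/andP; split; lra.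
rewrite !lebesgue_measure_itv/= !lte_fin ltrD2r; case: ifP => // _.
by rewrite -!EFinD; congr EFin; ring.
Qed.

Lemma integral_reflect (f : R -> \bar R) (c : R) :
  measurable_fun setT f -> (forall x, 0 <= f x) ->
  \int[mu]_x f (c - x)%R = \int[mu]_x f x.
Proof.
move=> mf f0.
have mN : measurable_fun setT (-%R : measurableTypeR R -> measurableTypeR R) by exact: measurable_funN.
transitivity (\int[mu]_x f (x + c)%R); last exact: integral_shift.
have mfc : measurable_fun setT (fun x : R => f (x + c)%R).
  by apply: (measurableT_comp mf); exact: measurable_funD.
have := @ge0_integral_pushforward _ _ _ (measurableTypeR R) R _ mN mu setT (fun x => f (x + c)%R)
  measurableT mfc (fun y _ => f0 _).
rewrite preimage_setT => h.
rewrite [RHS](eq_measure_integral (pushforward mu (-%R : measurableTypeR R -> measurableTypeR R))).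
  rewrite [RHS]h; apply: eq_integral => x _ /=; congr f; exact: addrC.
by move=> A mA _; exact/esym/lebesgue_measureN.
Qed.

End lebesgue_invariance.

Section lebesgue_wrappers.
Context {R : realType}.
Notation mu := (@lebesgue_measure R).
Implicit Types f g : R -> \bar R.
Local Open Scope ereal_scope.

Lemma eq_lebesgue f g : f =1 g -> \int[mu]_x f x = \int[mu]_x g x.
Proof. by move=> fg; apply: eq_integral => x _; exact: fg. Qed.

Lemma lebesgue_ge0 f : (forall x, 0 <= f x) -> 0 <= \int[mu]_x f x.
Proof. by move=> f0; apply: integral_ge0 => x _; exact: f0. Qed.

Lemma lebesgueD f g : measurable_fun setT f -> (forall x, 0 <= f x) ->
  measurable_fun setT g -> (forall x, 0 <= g x) ->
  \int[mu]_x (f x + g x) = \int[mu]_x f x + \int[mu]_x g x.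
Proof.
move=> mf f0 mg g0.
exact: (@ge0_integralD _ (measurableTypeR R) R mu setT measurableT f g
  (fun x _ => f0 x) mf (fun x _ => g0 x) mg).
Qed.

Lemma lebesgueZ f (k : R) : measurable_fun setT f -> (forall x, 0 <= f x) ->
  (0 <= k)%R -> \int[mu]_x (k%:E * f x) = k%:E * \int[mu]_x f x.
Proof.
move=> mf f0 k0.
exact: (@ge0_integralZl_EFin _ (measurableTypeR R) R mu setT measurableT f
  (fun x _ => f0 x) mf k).
Qed.

Lemma le_lebesgue f g : measurable_fun setT f -> (forall x, 0 <= f x) ->
  measurable_fun setT g -> (forall x, f x <= g x) ->
  \int[mu]_x f x <= \int[mu]_x g x.
Proof.
move=> mf f0 mg fg.
exact: (@ge0_le_integral _ (measurableTypeR R) R mu setT measurableT f g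
  (fun x _ => f0 x) mf mg (fun x _ => fg x)).
Qed.

End lebesgue_wrappers.

Ltac measurability :=
  repeat match goal with
  | H : measurable_fun _ ?f |- measurable_fun _ ?f => exact: H
  | |- measurable_fun _ (fun h => h) => exact: measurable_id
  | |- measurable_fun _ (fun _ => ?c) => exact: (measurable_cst c)
  | |- measurable_fun _ (fun h => EFin (@?a h)) => apply/measurable_EFinP
  | |- measurable_fun _ (fun h => (@?a h * @?b h)%E) => apply: emeasurable_funM
  | |- measurable_fun _ (fun h => (@?a h + @?b h)%E) => apply: emeasurable_funD
  | |- measurable_fun _ (fun h => (@?a h + @?b h)%R) => apply: measurable_funD
  | |- measurable_fun _ (fun h => (@?a h * @?b h)%R) => apply: measurable_funM
  | |- measurable_fun _ (fun h => (- @?a h)%R) =>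
      apply: (measurableT_comp (oppr_measurable (D := setT)))
  | |- measurable_fun _ (fun h => Num.min (@?a h) (@?b h)) =>
      apply: measurable_minr
  | |- measurable_fun _ (fun h => Num.max (@?a h) (@?b h)) =>
      apply: measurable_maxr
  | |- measurable_fun _ (fun h => @?a h && @?b h) => apply: measurable_and
  | |- measurable_fun _ (fun h => @?a h < @?b h) => apply: measurable_fun_ltr
  | |- measurable_fun _ (fun h => @?a h <= @?b h) => apply: measurable_fun_ler
  | |- measurable_fun _ (Num.min ?c) =>
      apply: (@measurable_minr _ _ _ setT (cst c) id)
  | |- measurable_fun _ (Num.max ?c) =>
      apply: (@measurable_maxr _ _ _ setT (cst c) id)
  | |- measurable_fun _ (+%R ?c) =>
      apply: (@measurable_funD _ _ _ setT (cst c) id)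
  | |- measurable_fun _ ( *%R ?c) =>
      apply: (@measurable_funM _ _ _ setT (cst c) id)
  | |- measurable_fun _ (cst _) => exact: measurable_cst
  | |- measurable_fun _ id => exact: measurable_id
  | |- measurable_fun _ -%R => exact: oppr_measurable
  | |- measurable_fun _ fst => exact: measurable_fst
  | |- measurable_fun _ snd => exact: measurable_snd
  | |- measurable_fun _ (fun h => (@?a h, @?b h)) =>
      apply: measurable_fun_pair
  | |- measurable_fun _ (fun h => fst h) => exact: measurable_fst
  | |- measurable_fun _ (fun h => snd h) => exact: measurable_snd
  | |- measurable_fun _ (fun h => fst (@?a h)) =>
      apply: (measurableT_comp measurable_fst)
  | |- measurable_fun _ (fun h => snd (@?a h)) =>
      apply: (measurableT_comp measurable_snd)
  | |- measurable_fun _ ?f =>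
      match f with context [if _ then _ else _] => apply: measurable_fun_ifT end
  end.

Lemma congr_adde {R : realType} (a b c d : \bar R) :
  a = b -> c = d -> (a + c = b + d)%E.
Proof. by move=> -> ->. Qed.

(** * Zigzags and the Pitman transform *)

Section zigzag.
Context {R : realType} (g : R -> R).
Hypothesis g0 : forall u, 0 <= g u.
Hypothesis mg : measurable_fun setT g.
Notation mu := (@lebesgue_measure R).

(* Weight of the move from the peak [x] down to the valley [v], up to the peak [y]. *)
Definition zig (x y v : R) : R :=
  if [&& 0 < v, v < x & v < y] then g (x + y - 2 * v) else 0.

(* The minima [m] of the zigzags from [al] to [z + 2 * m - al] whose Pitman
   transform ends at [z]. *)
Definition fiber (al z m : R) : R :=
  if [&& 0 < m, al - z < m & m < al] then 1 else 0.

Lemma zig_ge0 x y v : 0 <= zig x y v.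
Proof. by rewrite /zig; case: ifP. Qed.

Lemma fiber_ge0 al z m : 0 <= fiber al z m.
Proof. by rewrite /fiber; case: ifP. Qed.

Lemma measurable_zig d (H : measurableType d) (a b c : H -> R) :
  measurable_fun setT a -> measurable_fun setT b -> measurable_fun setT c ->
  measurable_fun setT (fun h => zig (a h) (b h) (c h)).
Proof.
move=> ma mb mc; rewrite /zig; measurability.
apply: (measurableT_comp mg); measurability.
Qed.

Lemma measurable_fiber d (H : measurableType d) (a b c : H -> R) :
  measurable_fun setT a -> measurable_fun setT b -> measurable_fun setT c ->
  measurable_fun setT (fun h => fiber (a h) (b h) (c h)).
Proof. by move=> ma mb mc; rewrite /fiber; measurability. Qed.

(** If [m <= v] the running minimum is unchanged, which gives [T1]; if [v < m] the valley is the new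
    minimum, which gives [T2], where the transformed valley [al - m] records the drop. In both cases
    the move has the same depth before and after the transform, hence the same weight [g]. *)
Lemma zig_fiber_split (al z m x v : R) (F : R -> R -> R -> \bar R) :
  let T1 (m n y : R) := (((if [&& 0 < m, m < al, n < z, n < y & al - m <= n]
    then g (z + y - 2 * n) else 0)%:E) * F m n y)%E in
  let T2 (m n y : R) := (((if [&& 0 < m, m < al - n, 0 < n, n < z & al - m < y]
    then g (z + y - 2 * n) else 0)%:E) * F m n y)%E in
  ((fiber al z m)%:E * ((zig (z + 2 * m - al)%R x v)%:E *
      F (Num.min m v) (Num.max m v - 2 * m + al)%R (x - 2 * Num.min m v + al)%R) =
    T1 m (v + (al - 2 * m))%R (x + (al - 2 * m))%R +
    T2 v (al - m)%R (x + (al - 2 * v))%R)%E.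
Proof.
move=> T1 T2; rewrite /T1 /T2 /fiber /zig.
have [mv|vm] := leP m v.
  rewrite (_ : v - 2 * m + al = v + (al - 2 * m))%R; last by ring.
  rewrite (_ : x - 2 * m + al = x + (al - 2 * m))%R; last by ring.
  rewrite (_ : (v < al - (al - m)) = false); last by apply/negbTE; rewrite -leNgt; lra.
  rewrite !(andbF, andFb) mul0e adde0 muleA -EFinM; congr (_%:E * _)%E.
  rewrite (_ : z + (x + (al - 2 * m)) - 2 * (v + (al - 2 * m)) =
    z + 2 * m - al + x - 2 * v)%R; last by ring.
  case: ifPn => [/and3P[h1 h2 h3]|h].
    rewrite mul1r; congr (if _ then _ else _).
    by apply/and3P/and5P => -[*]; split; lra.
  rewrite mul0r; case: ifP => // /and5P[h1 h2 h3 h4 h5].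
  by move/negP: h; case; apply/and3P; split; lra.
rewrite [X in _ = (X%:E * _ + _)%E](_ : _ = 0); last first.
  by case: ifP => // /and5P[*]; lra.
rewrite mul0e add0e (_ : m - 2 * m + al = al - m)%R; last by ring.
rewrite (_ : x - 2 * v + al = x + (al - 2 * v))%R; last by ring.
rewrite muleA -EFinM; congr (_%:E * _)%E.
rewrite (_ : z + (x + (al - 2 * v)) - 2 * (al - m) =
    z + 2 * m - al + x - 2 * v)%R; last by ring.
case: ifPn => [/and3P[h1 h2 h3]|h].
  rewrite mul1r; congr (if _ then _ else _).
  by apply/and3P/and5P => -[*]; split; lra.
rewrite mul0r; case: ifP => // /and5P[h1 h2 h3 h4 h5].
by move/negP: h; case; apply/and3P; split; lra.
Qed.

(** The same two cases, read from the transform with [m] the updated minimum: [al - m <= n] when the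
    move did not lower it, [n < al - m] when it did, [al - n] being then the previous minimum. *)
Lemma fiber_zig_split (al z m n y : R) (F : R -> R -> R -> \bar R) :
  let T1 (m n y : R) := (((if [&& 0 < m, m < al, n < z, n < y & al - m <= n]
    then g (z + y - 2 * n) else 0)%:E) * F m n y)%E in
  let T2 (m n y : R) := (((if [&& 0 < m, m < al - n, 0 < n, n < z & al - m < y]
    then g (z + y - 2 * n) else 0)%:E) * F m n y)%E in
  ((zig z y n)%:E * ((fiber al y m)%:E * F m n y) = T1 m n y + T2 m n y)%E.
Proof.
move=> T1 T2; rewrite /T1 /T2 /fiber /zig.
rewrite muleA -EFinM.
have [mv|vm] := leP (al - m) n.
  rewrite (_ : (m < al - n) = (al - m > n)); last by apply/idP/idP; lra.
  rewrite [X in _ = (_ + X%:E * _)%E](_ : _ = 0); last first.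
    by case: ifP => // /and5P[*]; lra.
  rewrite mul0e adde0; congr (_%:E * _)%E.
  case: ifPn => [/and3P[h1 h2 h3]|h]; last first.
    rewrite mul0r; case: ifP => // /and5P[h1 h2 h3 h4 h5].
    by move/negP: h; case; apply/and3P; split; lra.
  case: ifPn => [/and3P[h4 h5 h6]|h].
    by rewrite mulr1 ifT//; apply/and5P; split; lra.
  rewrite mulr0; case: ifP => // /and5P[h4 h5 h6 h7 h8].
  by move/negP: h; case; apply/and3P; split; lra.
rewrite !andbF mul0e add0e; congr (_%:E * _)%E.
case: ifPn => [/and3P[h1 h2 h3]|h]; last first.
  rewrite mul0r; case: ifP => // /and5P[h1 h2 h3 h4 h5].
  by move/negP: h; case; apply/and3P; split; lra.
case: ifPn => [/and3P[h4 h5 h6]|h].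
  by rewrite mulr1 ifT//; apply/and5P; split; lra.
rewrite mulr0; case: ifP => // /and5P[h4 h5 h6 h7 h8].
by move/negP: h; case; apply/and3P; split; lra.
Qed.

(* Both sides split into the same two integrals, according to the order of the
   running minimum [m] and the next valley [v]. *)
Lemma fiber_step al z (F : R -> R -> R -> \bar R) :
  measurable_fun setT (fun p => F p.1.1 p.1.2 p.2) ->
  (forall m n y, 0 <= F m n y)%E ->
  (\int[mu]_m ((fiber al z m)%:E * \int[mu]_x \int[mu]_v
      ((zig (z + 2 * m - al)%R x v)%:E *
      F (Num.min m v) (Num.max m v - 2 * m + al)%R (x - 2 * Num.min m v + al)%R)) =
  \int[mu]_y \int[mu]_n ((zig z y n)%:E *
      \int[mu]_m ((fiber al y m)%:E * F m n y)))%E.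
Proof.
move=> mF F0.
pose T1 (m n y : R) := (((if [&& 0 < m, m < al, n < z, n < y & al - m <= n]
    then g (z + y - 2 * n) else 0)%:E) * F m n y)%E.
pose T2 (m n y : R) := (((if [&& 0 < m, m < al - n, 0 < n, n < z & al - m < y]
    then g (z + y - 2 * n) else 0)%:E) * F m n y)%E.
have T10 m n y : (0 <= T1 m n y)%E.
  by rewrite /T1 mule_ge0 // lee_fin; case: ifP.
have T20 m n y : (0 <= T2 m n y)%E.
  by rewrite /T2 mule_ge0 // lee_fin; case: ifP.
have mT1 d (H : measurableType d) (a b c : H -> R) :
  measurable_fun setT a -> measurable_fun setT b -> measurable_fun setT c ->
  measurable_fun setT (fun h => T1 (a h) (b h) (c h)).
  move=> ma mb mc; rewrite /T1; measurability; last exact: (measurable_fun3 mF).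
  by apply: (measurableT_comp mg); measurability.
have mT2 d (H : measurableType d) (a b c : H -> R) :
  measurable_fun setT a -> measurable_fun setT b -> measurable_fun setT c ->
  measurable_fun setT (fun h => T2 (a h) (b h) (c h)).
  move=> ma mb mc; rewrite /T2; measurability; last exact: (measurable_fun3 mF).
  by apply: (measurableT_comp mg); measurability.
transitivity (\int[mu]_m \int[mu]_x \int[mu]_v
    (T1 m (v + (al - 2 * m))%R (x + (al - 2 * m))%R +
     T2 v (al - m)%R (x + (al - 2 * v))%R))%E.
  apply: eq_lebesgue => m; rewrite -lebesgueZ ?fiber_ge0//; last 2 first.
  - apply: measurable_integral; last by move=> *; rewrite mule_ge0// lee_fin zig_ge0.
    measurability; first by apply: measurable_zig; measurability.
    by apply: (measurable_fun3 mF); measurability.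
  - by move=> x; apply: lebesgue_ge0 => v; rewrite mule_ge0// lee_fin zig_ge0.
  apply: eq_lebesgue => x; rewrite -lebesgueZ ?fiber_ge0//; last 2 first.
  - measurability; first by apply: measurable_zig; measurability.
    apply: (measurable_fun3 mF); measurability.
  - by move=> v; rewrite mule_ge0// lee_fin zig_ge0.
  by apply: eq_lebesgue => v; exact: zig_fiber_split.
(* In [T1], [v] and [x] are translated at fixed [m]. In [T2], [x] is translated at fixed [v], and
   the former minimum [m] becomes the valley [n = al - m], a reflection. *)
transitivity (\int[mu]_m \int[mu]_x (\int[mu]_v T1 m v x) +
              \int[mu]_n \int[mu]_m \int[mu]_y T2 m n y)%E.
  transitivity (\int[mu]_m (\int[mu]_x (\int[mu]_v T1 m v x) +
     (\int[mu]_y \int[mu]_x T2 y (al - m)%R x)))%E.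
    apply: eq_lebesgue => m.
    transitivity (\int[mu]_x (\int[mu]_v T1 m (v + (al - 2 * m))%R (x + (al - 2 * m))%R +
     \int[mu]_v T2 v (al - m)%R (x + (al - 2 * v))%R))%E.
      by apply: eq_lebesgue => x; rewrite lebesgueD//;
        [apply: mT1; measurability|apply: mT2; measurability].
    rewrite lebesgueD; last 4 first.
    - by apply: measurable_integral => //; apply: mT1; measurability.
    - by move=> x; apply: lebesgue_ge0.
    - by apply: measurable_integral => //; apply: mT2; measurability.
    - by move=> x; apply: lebesgue_ge0.
    apply: congr_adde.
      transitivity (\int[mu]_x (\int[mu]_v T1 m v (x + (al - 2 * m))%R))%E.
        apply: eq_lebesgue => x; apply: (integral_shift (f := fun v => T1 m v _)) => //.
        by apply: mT1; measurability.
      apply: (integral_shift (f := fun x => \int[mu]_v T1 m v x)%E).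
        by apply: measurable_integral => //; apply: mT1; measurability.
      by move=> x; apply: lebesgue_ge0.
    etransitivity.
      apply: (@exchange_integral _ (fun x v => T2 v (al - m) (x + (al - 2 * v)))%R).
        by apply: mT2; measurability.
      by [].
    apply: eq_lebesgue => v.
    apply: (integral_shift (f := fun x => T2 v (al - m)%R x)) => //.
    by apply: mT2; measurability.
  rewrite lebesgueD; last 4 first.
  - apply: measurable_integral; last by move=> *; apply: lebesgue_ge0.
    by apply: measurable_integral => //; apply: mT1; measurability.
  - by move=> x; apply: lebesgue_ge0 => y; apply: lebesgue_ge0.
  - apply: measurable_integral; last by move=> *; apply: lebesgue_ge0.
    by apply: measurable_integral => //; apply: mT2; measurability.
  - by move=> x; apply: lebesgue_ge0 => y; apply: lebesgue_ge0.
  apply: congr_adde; first by [].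
  apply: (@integral_reflect R (fun n => \int[mu]_m \int[mu]_y T2 m n y)%E al).
    apply: measurable_integral; last by move=> *; apply: lebesgue_ge0.
    by apply: measurable_integral => //; apply: mT2; measurability.
  by move=> x; apply: lebesgue_ge0 => y; apply: lebesgue_ge0.
apply/esym.
transitivity (\int[mu]_y \int[mu]_n (\int[mu]_m T1 m n y + \int[mu]_m T2 m n y))%E.
  apply: eq_lebesgue => y; apply: eq_lebesgue => n.
  rewrite -lebesgueZ ?zig_ge0//; last 2 first.
  - measurability; first by apply: measurable_fiber; measurability.
    by apply: (measurable_fun3 mF); measurability.
  - by move=> m; rewrite mule_ge0// lee_fin fiber_ge0.
  rewrite -lebesgueD//; last 2 first.
  - by apply: mT1; measurability.
  - by apply: mT2; measurability.
  by apply: eq_lebesgue => m; exact: fiber_zig_split.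
transitivity (\int[mu]_y (\int[mu]_n \int[mu]_m T1 m n y +
    \int[mu]_n \int[mu]_m T2 m n y))%E.
  apply: eq_lebesgue => y; rewrite lebesgueD//.
  - by apply: measurable_integral => //; apply: mT1; measurability.
  - by move=> x; apply: lebesgue_ge0.
  - by apply: measurable_integral => //; apply: mT2; measurability.
  - by move=> x; apply: lebesgue_ge0.
rewrite lebesgueD; last 4 first.
- apply: measurable_integral; last by move=> *; apply: lebesgue_ge0.
  by apply: measurable_integral => //; apply: mT1; measurability.
- by move=> x; apply: lebesgue_ge0 => y; apply: lebesgue_ge0.
- apply: measurable_integral; last by move=> *; apply: lebesgue_ge0.
  by apply: measurable_integral => //; apply: mT2; measurability.
- by move=> x; apply: lebesgue_ge0 => y; apply: lebesgue_ge0.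
apply: congr_adde.
  transitivity (\int[mu]_y \int[mu]_m (\int[mu]_n T1 m n y))%E.
    apply: eq_lebesgue => y; apply: (@exchange_integral _ (fun n m => T1 m n y)).
      by apply: mT1; measurability.
    by [].
  apply: (@exchange_integral _ (fun y m => \int[mu]_n T1 m n y)%E).
    by apply: measurable_integral => //; apply: mT1; measurability.
  by move=> x y; apply: lebesgue_ge0.
etransitivity.
  apply: (@exchange_integral _ (fun y n => \int[mu]_m T2 m n y)%E).
    by apply: measurable_integral => //; apply: mT2; measurability.
  by move=> x y; apply: lebesgue_ge0.
apply: eq_lebesgue => n.
apply: (@exchange_integral _ (fun y m => T2 m n y)).
  by apply: mT2; measurability.
by [].
Qed.

End zigzag.

(** * Joint measurability in lists of fixed length *)

Section measurable_in_list.
Context {dE : measure_display} {E : measurableType dE}.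

(* Measurability of [f h l] in [h] and in a list [l] of length [n], curried to
   allow inductions on [n]. *)
Fixpoint mseq n : forall d (H : measurableType d) dU (U : measurableType dU),
    (H -> seq E -> U) -> Prop :=
  match n with
  | 0 => fun d H dU U f => measurable_fun setT (fun h => f h [::])
  | n'.+1 => fun d H dU U f =>
      mseq n' (fun (p : H * E) l => f p.1 (p.2 :: l))
  end.

Lemma mseq_tuple n : forall d (H : measurableType d) dU (U : measurableType dU)
    (f : H -> seq E -> U), mseq n f ->
  measurable_fun setT (fun p : H * n.-tuple E => f p.1 p.2).
Proof.
elim: n => [|n IH] d H dU U f /= mf.
  rewrite (_ : (fun _ => _) = fun p : H * 0.-tuple E => f p.1 [::]).
    exact: (measurableT_comp mf measurable_fst).
  by apply/funext => -[h s] /=; rewrite tuple0.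
have m2 : measurable_fun setT (fun p : H * n.+1.-tuple E =>
    ((p.1, thead p.2), [tuple of behead p.2])).
  apply: measurable_fun_pair.
    apply: measurable_fun_pair => //.
    exact: (measurableT_comp (measurable_tnth ord0) measurable_snd).
  exact: (measurableT_comp (measurable_behead (n := n)) measurable_snd).
have := measurableT_comp (IH _ _ _ _ _ mf) m2; congr measurable_fun.
by apply/funext => -[h s] /=; rewrite [in RHS](tuple_eta s).
Qed.

Lemma mseq_comp n : forall d (H : measurableType d) d' (H' : measurableType d')
    dU (U : measurableType dU) (f : H -> seq E -> U) (p : H' -> H),
  mseq n f -> measurable_fun setT p -> mseq n (fun h => f (p h)).
Proof.
elim: n => [|n IH] d H d' H' dU U f p /= mf mp.
  exact: (measurableT_comp mf mp).
apply: (IH _ _ _ _ _ _ _ (fun q : H' * E => (p q.1, q.2)) mf).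
by apply: measurable_fun_pair => //; exact: (measurableT_comp mp measurable_fst).
Qed.

Lemma mseq_post n : forall d (H : measurableType d)
    dU (U : measurableType dU) dV (V : measurableType dV)
    (f : H -> seq E -> U) (g : U -> V),
  mseq n f -> measurable_fun setT g -> mseq n (fun h l => g (f h l)).
Proof.
elim: n => [|n IH] d H dU U dV V f g /= mf mg; last exact: IH.
exact: (measurableT_comp mg mf).
Qed.

Lemma mseq_pair n : forall d (H : measurableType d)
    dU (U : measurableType dU) dV (V : measurableType dV)
    (f : H -> seq E -> U) (g : H -> seq E -> V),
  mseq n f -> mseq n g -> mseq n (fun h l => (f h l, g h l)).
Proof.
elim: n => [|n IH] d H dU U dV V f g /= mf mg; last exact: IH.
exact: measurable_fun_pair.
Qed.

Lemma mseq_head n : forall d (H : measurableType d)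
    dU (U : measurableType dU) (f : H -> U),
  measurable_fun setT f -> mseq n (fun h _ => f h).
Proof.
elim: n => [|n IH] d H dU U f //= mf.
by apply: (IH _ _ _ _ (fun p : H * E => f p.1)); exact: measurableT_comp.
Qed.

Lemma eq_mseq n : forall d (H : measurableType d) dU (U : measurableType dU)
    (f g : H -> seq E -> U),
  (forall h l, f h l = g h l) -> mseq n f -> mseq n g.
Proof.
by move=> d H dU U f g fg; rewrite (_ : f = g)//; apply/funext => h; apply/funext.
Qed.

End measurable_in_list.

(** * Iterated integrals over zigzags *)

Section zigzag_integral.
Context {R : realType} (g : R -> R).
Hypothesis g0 : forall u, 0 <= g u.
Hypothesis mg : measurable_fun setT g.
Notation mu := (@lebesgue_measure R).
Local Open Scope ereal_scope.

(* An entry of the list is a valley followed by the next peak. *)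
Fixpoint zigint n (x : R) (f : R -> seq (R * R) -> \bar R) : \bar R :=
  if n is n'.+1 then
    \int[mu]_y \int[mu]_v ((zig g x y v)%:E * zigint n' y (fun z l => f z ((v, y) :: l)))
  else f x [::].

Lemma zigint_ge0 n x f : (forall z l, 0 <= f z l) -> 0 <= zigint n x f.
Proof.
elim: n x f => [|n IH] x f f0 //=.
apply: lebesgue_ge0 => y; apply: lebesgue_ge0 => v.
by rewrite mule_ge0// ?lee_fin ?zig_ge0// IH.
Qed.

Lemma zig_zigint_ge0 n x y v f : (forall z l, 0 <= f z l) ->
  0 <= (zig g x y v)%:E * zigint n y (fun z l => f z ((v, y) :: l)).
Proof. by move=> f0; rewrite mule_ge0// ?lee_fin ?zig_ge0// zigint_ge0. Qed.

Lemma eq_zigint n x f f' : (forall z l, size l = n -> f z l = f' z l) ->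
  zigint n x f = zigint n x f'.
Proof.
elim: n x f f' => [|n IH] x f f' ff' /=; first exact: ff'.
apply: eq_lebesgue => y; apply: eq_lebesgue => v; congr (_ * _).
by apply: IH => z l sl; apply: ff'; rewrite /= sl.
Qed.

Lemma mseq_cons2 n d (H : measurableType d) (f : H -> R -> seq (R * R) -> \bar R) :
  mseq n.+1 (fun p : H * R => f p.1 p.2) ->
  mseq n (fun q : (H * R * R) * R => f q.1.1.1 q.2 \o cons (q.1.2, q.1.1.2)).
Proof.
move=> mf.
have mp : measurable_fun setT (fun q : H * R * R * R =>
   ((q.1.1.1, q.2), (q.1.2, q.1.1.2))) by measurability.
exact: (mseq_comp (f := fun p l => f p.1.1 p.1.2 (p.2 :: l)) mf mp).
Qed.

Lemma measurable_zigint n : forall d (H : measurableType d)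
    (f : H -> R -> seq (R * R) -> \bar R) (x : H -> R),
  mseq n (fun p : H * R => f p.1 p.2) ->
  (forall h z l, 0 <= f h z l) -> measurable_fun setT x ->
  measurable_fun setT (fun h => zigint n (x h) (f h)).
Proof.
elim: n => [|n IH] d H f x mf f0 mx.
  move: mf => /= mf.
  exact: (measurableT_comp mf (measurable_fun_pair (@measurable_id _ _ _) mx)).
apply: measurable_integral; last first.
  by move=> h y; apply: lebesgue_ge0 => v; exact: zig_zigint_ge0.
apply: measurable_integral; last by move=> h v; exact: zig_zigint_ge0.
apply: emeasurable_funM.
  apply/measurable_EFinP; apply: measurable_zig => //; measurability.
  exact: (measurableT_comp mx (measurableT_comp measurable_fst measurable_fst)).
apply: (IH _ (H * R * R)%type (fun q z l => f q.1.1 z ((q.2, q.1.2) :: l))) => //.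
- exact: mseq_cons2 mf.
- by measurability.
Qed.

End zigzag_integral.

Section zigzag_theory.
Context {R : realType} (g : R -> R).
Hypothesis g0 : forall u, 0 <= g u.
Hypothesis mg : measurable_fun setT g.
Notation mu := (@lebesgue_measure R).
Local Open Scope ereal_scope.

Lemma measurable_zig_zigint n d (H : measurableType d)
    (f : H -> R -> seq (R * R) -> \bar R) (x y v : H -> R) :
  mseq n.+1 (fun p : H * R => f p.1 p.2) -> (forall h z l, 0 <= f h z l) ->
  measurable_fun setT x -> measurable_fun setT y -> measurable_fun setT v ->
  measurable_fun setT (fun h => (zig g (x h) (y h) (v h))%:E *
    zigint g n (y h) (fun z l => f h z ((v h, y h) :: l))).
Proof.
move=> mf f0 mx my mv; apply: emeasurable_funM.
  by apply/measurable_EFinP; exact: measurable_zig.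
apply: (measurable_zigint g0 mg (f := fun h z l => f h z ((v h, y h) :: l))) => //.
have mp : measurable_fun setT (fun q : H * R => (q, (v q.1, y q.1))).
  measurability; exact: (measurableT_comp _ measurable_fst).
exact: (mseq_comp (f := fun p l => f p.1.1 p.1.2 (p.2 :: l)) mf mp).
Qed.

Lemma measurable_zig_zigint_integral n d (H : measurableType d)
    (f : H -> R -> seq (R * R) -> \bar R) (x y : H -> R) :
  mseq n.+1 (fun p : H * R => f p.1 p.2) -> (forall h z l, 0 <= f h z l) ->
  measurable_fun setT x -> measurable_fun setT y ->
  measurable_fun setT (fun h => \int[mu]_v ((zig g (x h) (y h) v)%:E *
    zigint g n (y h) (fun z l => f h z ((v, y h) :: l)))).
Proof.
move=> mf f0 mx my; apply: measurable_integral; last first.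
  by move=> h v; exact: zig_zigint_ge0.
apply: (@measurable_zig_zigint n _ (H * R)%type (fun q => f q.1) (fun q => x q.1)
   (fun q => y q.1) snd) => //.
- have mp : measurable_fun setT (fun q : H * R * R => (q.1.1, q.2)) by measurability.
  exact: (mseq_comp mf mp).
- exact: (measurableT_comp mx measurable_fst).
- exact: (measurableT_comp my measurable_fst).
Qed.

Lemma mseq_cst n d (H : measurableType d) (f : R -> seq (R * R) -> \bar R) :
  mseq n f -> mseq n (fun p : H * R => f p.2).
Proof. by move=> mf; apply: (mseq_comp mf); measurability. Qed.

Lemma mseq_cons n (f : R -> seq (R * R) -> \bar R) c :
  mseq n.+1 f -> mseq n (fun z l => f z (c :: l)).
Proof.
move=> mf; have mp : measurable_fun setT (fun z : R => (z, c)) by measurability.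
exact: (mseq_comp (f := fun p l => f p.1 (p.2 :: l)) mf mp).
Qed.

Lemma zigintD n x (f f' : R -> seq (R * R) -> \bar R) :
  mseq n f -> (forall z l, 0 <= f z l) -> mseq n f' -> (forall z l, 0 <= f' z l) ->
  zigint g n x (fun z l => f z l + f' z l) = zigint g n x f + zigint g n x f'.
Proof.
elim: n x f f' => [//|n IH] x f f' mf f0 mf' f'0 /=.
transitivity (\int[mu]_y (
    \int[mu]_v ((zig g x y v)%:E * zigint g n y (fun z l => f z ((v, y) :: l))) +
    \int[mu]_v ((zig g x y v)%:E * zigint g n y (fun z l => f' z ((v, y) :: l))))).
  apply: eq_lebesgue => y; rewrite -lebesgueD; last 4 first.
  - apply: (@measurable_zig_zigint n _ R (fun=> f) (cst x) (cst y) id) => //.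
    exact: (mseq_cst (n := n.+1) _ mf).
  - by move=> v; exact: zig_zigint_ge0.
  - apply: (@measurable_zig_zigint n _ R (fun=> f') (cst x) (cst y) id) => //.
    exact: (mseq_cst (n := n.+1) _ mf').
  - by move=> v; exact: zig_zigint_ge0.
  apply: eq_lebesgue => v; rewrite IH//; try exact: mseq_cons.
  by rewrite ge0_muleDr// zigint_ge0.
rewrite lebesgueD//.
- apply: (@measurable_zig_zigint_integral n _ R (fun=> f) (cst x) id) => //.
  exact: (mseq_cst (n := n.+1) _ mf).
- by move=> y; apply: lebesgue_ge0 => v; exact: zig_zigint_ge0.
- apply: (@measurable_zig_zigint_integral n _ R (fun=> f') (cst x) id) => //.
  exact: (mseq_cst (n := n.+1) _ mf').
- by move=> y; apply: lebesgue_ge0 => v; exact: zig_zigint_ge0.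
Qed.

Lemma zigintZ n x (k : R) (f : R -> seq (R * R) -> \bar R) : (0 <= k)%R ->
  mseq n f -> (forall z l, 0 <= f z l) ->
  zigint g n x (fun z l => k%:E * f z l) = k%:E * zigint g n x f.
Proof.
move=> k0; elim: n x f => [//|n IH] x f mf f0 /=.
rewrite -lebesgueZ//; last 2 first.
- apply: (@measurable_zig_zigint_integral n _ R (fun=> f) (cst x) id) => //.
  exact: (mseq_cst (n := n.+1) _ mf).
- by move=> y; apply: lebesgue_ge0 => v; exact: zig_zigint_ge0.
apply: eq_lebesgue => y; rewrite -lebesgueZ//; last 2 first.
- apply: (@measurable_zig_zigint n _ R (fun=> f) (cst x) (cst y) id) => //.
  exact: (mseq_cst (n := n.+1) _ mf).
- by move=> v; exact: zig_zigint_ge0.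
apply: eq_lebesgue => v; rewrite IH//; last exact: mseq_cons.
by rewrite muleCA.
Qed.

Lemma zigint_integral n x (f : R -> R -> seq (R * R) -> \bar R) :
  mseq n (fun p : R * R => f p.1 p.2) -> (forall h z l, 0 <= f h z l) ->
  zigint g n x (fun z l => \int[mu]_h f h z l) = \int[mu]_h zigint g n x (f h).
Proof.
elim: n x f => [//|n IH] x f mf f0 /=.
have mw : measurable_fun setT (fun q : R * R * R =>
    (zig g x q.1.1 q.2)%:E * zigint g n q.1.1 (fun z l => f q.1.2 z ((q.2, q.1.1) :: l))).
  apply: (@measurable_zig_zigint n _ (R * R * R)%type (fun q => f q.1.2) (cst x)
    (fun q => q.1.1) snd) => //; try by measurability.
  have mp : measurable_fun setT (fun q : R * R * R * R => (q.1.1.2, q.2)) by measurability.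
  exact: (mseq_comp mf mp).
transitivity (\int[mu]_y \int[mu]_v \int[mu]_h ((zig g x y v)%:E *
    zigint g n y (fun z l => f h z ((v, y) :: l)))).
  apply: eq_lebesgue => y; apply: eq_lebesgue => v.
  have -> : zigint g n y (fun z l => \int[mu]_h f h z ((v, y) :: l)) =
      \int[mu]_h zigint g n y (fun z l => f h z ((v, y) :: l)).
    apply: (IH y (fun h z l => f h z ((v, y) :: l))) => //.
    have mp : measurable_fun setT (fun q : R * R => (q, (v, y))) by measurability.
    exact: (mseq_comp (f := fun p l => f p.1.1 p.1.2 (p.2 :: l)) mf mp).
  rewrite -lebesgueZ ?zig_ge0//; last by move=> h; exact: zigint_ge0.
  apply: (measurable_zigint g0 mg (f := fun h z l => f h z ((v, y) :: l))) => //.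
  have mp : measurable_fun setT (fun q : R * R => (q, (v, y))) by measurability.
  exact: (mseq_comp (f := fun p l => f p.1.1 p.1.2 (p.2 :: l)) mf mp).
transitivity (\int[mu]_y \int[mu]_h \int[mu]_v ((zig g x y v)%:E *
    zigint g n y (fun z l => f h z ((v, y) :: l)))).
  apply: eq_lebesgue => y.
  apply: (@exchange_integral _ (fun v h => (zig g x y v)%:E *
    zigint g n y (fun z l => f h z ((v, y) :: l)))).
    have mp : measurable_fun setT (fun q : R * R => ((y, q.2), q.1)) by measurability.
    exact: (measurableT_comp mw mp).
  by move=> v h; exact: zig_zigint_ge0.
apply: (@exchange_integral _ (fun y h => \int[mu]_v ((zig g x y v)%:E *
    zigint g n y (fun z l => f h z ((v, y) :: l))))).
  apply: measurable_integral; first exact: mw.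
  by move=> h v; exact: zig_zigint_ge0.
by move=> v h; apply: lebesgue_ge0 => y; exact: zig_zigint_ge0.
Qed.

End zigzag_theory.

(** * Intertwining and exchange of the endpoints *)

Section pitman.
Context {R : realType} (g : R -> R).
Hypothesis g0 : forall u, 0 <= g u.
Hypothesis mg : measurable_fun setT g.
Notation mu := (@lebesgue_measure R).

(* [m] is the running minimum of a zigzag started at [al]: a height [x] becomes
   [x - 2 * m + al], and valleys of the transform arise both from valleys above
   the running minimum and from the drops of the minimum. *)
Fixpoint pitman (al m : R) (w : seq (R * R)) : seq (R * R) :=
  if w is (v, x) :: w' then
    (Num.max m v - 2 * m + al, x - 2 * Num.min m v + al)
      :: pitman al (Num.min m v) w'
  else [::].

Lemma mseq_pitman n : forall d (H : measurableType d)
    dU (U : measurableType dU) (f : H -> seq (R * R) -> U) (al m : H -> R),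
  mseq n f -> measurable_fun setT al -> measurable_fun setT m ->
  mseq n (fun h l => f h (pitman (al h) (m h) l)).
Proof.
elim: n => [//|n IH] d H dU U f al m /= mf mal mm.
have mal1 : measurable_fun setT (fun p : H * (R * R) => al p.1).
  exact: (measurableT_comp mal measurable_fst).
have mm1 : measurable_fun setT (fun p : H * (R * R) => m p.1).
  exact: (measurableT_comp mm measurable_fst).
pose c (p : H * (R * R)) := (Num.max (m p.1) p.2.1 - 2 * m p.1 + al p.1,
    p.2.2 - 2 * Num.min (m p.1) p.2.1 + al p.1).
have mc : measurable_fun setT c by rewrite /c; measurability.
have mpc : measurable_fun setT (fun p => (p.1, c p)) by measurability.
have := IH _ _ _ _ _ (fun p => al p.1) (fun p => Num.min (m p.1) p.2.1)
  (mseq_comp mf mpc).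
have mmin : measurable_fun setT (fun p : H * (R * R) => Num.min (m p.1) p.2.1).
  by measurability.
move=> /(_ mal1 mmin); apply: eq_mseq => -[h [v x]] l //=.
Qed.

Local Open Scope ereal_scope.

(** Iterates [fiber_step]: after a move, the running minimum is again spread by [fiber] over the new
    transformed height, so the induction hypothesis applies to the rest. Given the transform, the
    global minimum thus depends on its final height alone. *)
Lemma intertwining n al z (F : R -> seq (R * R) -> \bar R) :
  mseq n F -> (forall y l, 0 <= F y l) ->
  \int[mu]_m ((fiber al z m)%:E *
      zigint g n (z + 2 * m - al)%R (fun y l => F y (pitman al m l))) =
  zigint g n z (fun y l => \int[mu]_m ((fiber al y m)%:E * F (y + 2 * m - al)%R l)).
Proof.
elim: n z F => [//|n IH] z F mF F0 /=.
(* What remains after the first move, in terms of the updated minimum, the new valley and the new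
   height of the transform. *)
pose F' m n' y' := zigint g n (y' + 2 * m - al)%R
  (fun y l => F y ((n', y') :: pitman al m l)).
transitivity (\int[mu]_y \int[mu]_n ((zig g z y n)%:E *
      \int[mu]_m ((fiber al y m)%:E * F' m n y))); last first.
  apply: eq_lebesgue => y; apply: eq_lebesgue => n'; apply: congr1.
  by rewrite -(IH y (fun z l => F z ((n', y) :: l)))//; exact: mseq_cons.
etransitivity; last first.
  apply: (@fiber_step _ _ g0 mg al z F').
- rewrite /F'.
  apply: (measurable_zigint g0 mg (f := fun p y l =>
    F y ((p.1.2, p.2) :: pitman al p.1.1 l))) => //; last by measurability.
  apply: (@mseq_pitman _ _ _ _ _ (fun (q : R * R * R * R) l =>
    F q.2 ((q.1.1.2, q.1.2) :: l)) (cst al) (fun q => q.1.1.1)); try by measurability.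
  have mp : measurable_fun setT (fun q : R * R * R * R => (q.2, (q.1.1.2, q.1.2))).
    by measurability.
  exact: (mseq_comp (f := fun p l => F p.1 (p.2 :: l)) mF mp).
- by move=> m n' y; exact: zigint_ge0.
- apply: eq_lebesgue => m; apply: congr1.
  apply: eq_lebesgue => x; apply: eq_lebesgue => v; apply: congr1.
  rewrite /F'; congr (zigint _ _ _ _); ring.
Qed.

(** Initially the running minimum is the height [al] itself, so the first valley is always a new
    minimum; the transform starts at 0 and its first valley is 0. The weight of that first move
    creates the factor [fiber] from which the intertwining starts. *)
Lemma intertwining0 n al (F : R -> seq (R * R) -> \bar R) :
  mseq n.+1 F -> (forall y l, 0 <= F y l) ->
  zigint g n.+1 al (fun y l => F y (pitman al al l)) =
  \int[mu]_z ((g z)%:E * zigint g n z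
    (fun y l => \int[mu]_m ((fiber al y m)%:E * F (y + 2 * m - al)%R ((0%R, z) :: l)))).
Proof.
move=> mF F0.
pose F1 v x := zigint g n x (fun y l => F y ((0%R, x - 2 * v + al)%R :: pitman al v l)).
have F10 v x : 0 <= F1 v x by exact: zigint_ge0.
have mF1 d (H : measurableType d) (a b : H -> R) :
    measurable_fun setT a -> measurable_fun setT b ->
    measurable_fun setT (fun h => F1 (a h) (b h)).
  move=> ma mb; rewrite /F1.
  apply: (measurable_zigint g0 mg (f := fun h y l =>
    F y ((0%R, b h - 2 * a h + al)%R :: pitman al (a h) l))) => //.
  have ma1 : measurable_fun setT (fun p : H * R => a p.1).
    exact: (measurableT_comp ma measurable_fst).
  have mb1 : measurable_fun setT (fun p : H * R => b p.1).
    exact: (measurableT_comp mb measurable_fst).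
  apply: (@mseq_pitman _ _ _ _ _ (fun (q : H * R) l =>
    F q.2 ((0%R, b q.1 - 2 * a q.1 + al)%R :: l)) (cst al) (fun q => a q.1));
    try by measurability.
  have mp : measurable_fun setT (fun q : H * R =>
    (q.2, (0%R : R, b q.1 - 2 * a q.1 + al)%R)) by measurability.
  exact: (mseq_comp (f := fun p l => F p.1 (p.2 :: l)) mF mp).
transitivity (\int[mu]_x \int[mu]_v ((zig g al x v)%:E * F1 v x)).
  apply: eq_lebesgue => x; apply: eq_lebesgue => v; rewrite /zig.
  case: ifPn => [/and3P[v0 va vx]|_]; last by rewrite !mul0e.
  apply: congr1; rewrite /F1 /=; congr (zigint _ _ _ _).
  apply/funext => y; apply/funext => l.
  rewrite (max_l (ltW va)) (min_r (ltW va)); congr (F _ ((_, _) :: _)); ring.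
transitivity (\int[mu]_v \int[mu]_x ((zig g al x v)%:E * F1 v x)).
  apply: (@exchange_integral _ (fun x v => (zig g al x v)%:E * F1 v x)).
    measurability; first by apply: measurable_zig => //; measurability.
    by apply: mF1; measurability.
  by move=> x v; rewrite mule_ge0// lee_fin zig_ge0.
transitivity (\int[mu]_v \int[mu]_z ((zig g al (z + (2 * v - al)) v)%:E *
    F1 v (z + (2 * v - al))%R)).
  apply: eq_lebesgue => v; apply/esym.
  apply: (@integral_shift _ (fun x => (zig g al x v)%:E * F1 v x)).
    measurability; first by apply: measurable_zig => //; measurability.
    by apply: mF1; measurability.
  by move=> x; rewrite mule_ge0// lee_fin zig_ge0.
transitivity (\int[mu]_z \int[mu]_v ((zig g al (z + (2 * v - al)) v)%:E *
    F1 v (z + (2 * v - al))%R)).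
  apply: (@exchange_integral _ (fun v z => (zig g al (z + (2 * v - al)) v)%:E *
    F1 v (z + (2 * v - al))%R)).
    measurability; first by apply: measurable_zig => //; measurability.
    by apply: mF1; measurability.
  by move=> x v; rewrite mule_ge0// lee_fin zig_ge0.
apply: eq_lebesgue => z.
rewrite -(intertwining al z (F := fun y l => F y ((0%R, z) :: l))); last 2 first.
- exact: mseq_cons.
- by [].
rewrite -lebesgueZ//; last 2 first.
- measurability; first by apply: measurable_fiber; measurability.
  apply: (measurable_zigint g0 mg (f := fun m y l =>
    F y ((0%R, z)%R :: pitman al m l))) => //; last by measurability.
  apply: (@mseq_pitman _ _ _ _ _ (fun (q : R * R) l =>
    F q.2 ((0%R, z)%R :: l)) (cst al) (fun q => q.1)); try by measurability.
  have mp : measurable_fun setT (fun q : R * R => (q.2, (0%R : R, z))) by measurability.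
  exact: (mseq_comp (f := fun p l => F p.1 (p.2 :: l)) mF mp).
- by move=> m; rewrite mule_ge0// ?lee_fin ?fiber_ge0// zigint_ge0.
apply: eq_lebesgue => v; rewrite muleA -EFinM.
(* The depth of the first move is [z], and [v < x] becomes [al - z < v]. *)
have -> : (zig g al (z + (2 * v - al)) v = g z * fiber al z v)%R.
  rewrite /zig /fiber; case: ifPn => [/and3P[v0 va vx]|h].
    rewrite ifT; last by apply/and3P; split; lra.
    by rewrite mulr1; congr g; ring.
  rewrite ifF ?mulr0//; apply/negbTE; apply: contra h => /and3P[v0 va vx].
  by apply/and3P; split; lra.
apply: congr1; rewrite /F1 addrA; congr (zigint _ _ _ _).
apply/funext => y; apply/funext => l; congr (F _ ((_, _) :: _)); ring.
Qed.

(** At fixed [m], the reflection [al |-> z + 2 * m - al] exchanges the two endpoints, and [fiber]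
    says that [m] is positive and below both of them, a symmetric condition. *)
Lemma fiber_sym z (phi : R -> R -> \bar R) :
  measurable_fun setT (fun p => phi p.1 p.2) -> (forall x y, 0 <= phi x y) ->
  \int[mu]_al \int[mu]_m ((fiber al z m)%:E * phi al (z + 2 * m - al)%R) =
  \int[mu]_al \int[mu]_m ((fiber al z m)%:E * phi (z + 2 * m - al)%R al).
Proof.
move=> mphi phi0.
have ge0 al m x y : 0 <= (fiber al z m)%:E * phi x y.
  by rewrite mule_ge0// lee_fin fiber_ge0.
transitivity (\int[mu]_m \int[mu]_al ((fiber al z m)%:E * phi al (z + 2 * m - al)%R)).
  apply: (@exchange_integral _ (fun al m =>
    (fiber al z m)%:E * phi al (z + 2 * m - al)%R)) => //.
  measurability; first by apply: measurable_fiber; measurability.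
  by apply: (measurable_fun2 mphi); measurability.
etransitivity; last first.
  apply/esym; apply: (@exchange_integral _ (fun al m =>
    (fiber al z m)%:E * phi (z + 2 * m - al)%R al)) => //.
  measurability; first by apply: measurable_fiber; measurability.
  by apply: (measurable_fun2 mphi); measurability.
apply: eq_lebesgue => m.
etransitivity.
  apply/esym; apply: (@integral_reflect _ (fun al =>
    (fiber al z m)%:E * phi al (z + 2 * m - al)%R) (z + 2 * m)%R) => //.
  measurability; first by apply: measurable_fiber; measurability.
  by apply: (measurable_fun2 mphi); measurability.
apply: eq_lebesgue => al /=.
rewrite (_ : z + 2 * m - (z + 2 * m - al) = al)%R; last by ring.
congr (_%:E * _); rewrite /fiber; congr (if _ then _ else _).
by apply/and3P/and3P => -[*]; split; lra.
Qed.

(** The zigzag itself is hidden from [f], which sees the endpoints and the transform: this is what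
    makes the exchange of endpoints possible. *)
Definition bridge_integral n (f : R -> R -> seq (R * R) -> \bar R) : \bar R :=
  \int[mu]_al zigint g n.+1 al (fun be l => f al be (pitman al al l)).

(** After the intertwining the weights of the transform no longer involve [al], so Fubini brings the
    integral over [al] next to that over [m], where [fiber_sym] applies. *)
Lemma bridge_integralE n (f : R -> R -> seq (R * R) -> \bar R) :
  mseq n.+1 (fun p : R * R => f p.1 p.2) -> (forall x y l, 0 <= f x y l) ->
  bridge_integral n f = \int[mu]_z ((g z)%:E * zigint g n z (fun y l =>
    \int[mu]_al \int[mu]_m
      ((fiber al y m)%:E * f al (y + 2 * m - al)%R ((0%R, z) :: l)))).
Proof.
move=> mf f0.
have fib0 al y m z l : 0 <= (fiber al y m)%:E * f al (y + 2 * m - al)%R ((0%R, z) :: l).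
  by rewrite mule_ge0// lee_fin fiber_ge0.
have mfib : mseq n (fun (q : R * R * R * R) (l : seq (R * R)) => (fiber q.1.1.1 q.1.2 q.2)%:E *
    f q.1.1.1 (q.1.2 + 2 * q.2 - q.1.1.1)%R ((0%R, q.1.1.2) :: l)).
  apply: (@mseq_post _ _ _ _ _ _ _ _ _ (fun (q : R * R * R * R) (l : seq (R * R)) =>
   ((fiber q.1.1.1 q.1.2 q.2)%:E,
    f q.1.1.1 (q.1.2 + 2 * q.2 - q.1.1.1)%R ((0%R, q.1.1.2) :: l)))
    (fun p => p.1 * p.2)); last by measurability.
  apply: mseq_pair.
    apply: mseq_head; apply/measurable_EFinP.
    by apply: measurable_fiber; measurability.
  have mp : measurable_fun setT (fun q : R * R * R * R =>
    ((q.1.1.1, (q.1.2 + 2 * q.2 - q.1.1.1)%R), (0%R : R, q.1.1.2))) by measurability.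
  exact: (mseq_comp (f := fun p l => f p.1.1 p.1.2 (p.2 :: l)) mf mp).
(* Integrating out a parameter preserves [mseq]; the induction moves list entries into the parameter
   space. *)
have mint : forall d (H : measurableType d) (F : H -> R -> seq (R * R) -> \bar R),
  mseq n (fun p : H * R => F p.1 p.2) -> (forall h x l, 0 <= F h x l) ->
  mseq n (fun h l => \int[mu]_x F h x l).
  elim: n {mf mfib} => [|k IH] d H F mF F0 /=; first exact: measurable_integral.
  apply: (IH _ (H * (R * R))%type (fun p x l => F p.1 x (p.2 :: l))) => //.
  have mp : measurable_fun setT (fun p : H * (R * R) * R => ((p.1.1, p.2), p.1.2)).
    by measurability.
  exact: (mseq_comp (f := fun p l => F p.1.1 p.1.2 (p.2 :: l)) mF mp).
have mfib1 : mseq n (fun (q : R * R * R) (l : seq (R * R)) => \int[mu]_m ((fiber q.1.1 q.2 m)%:E *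
    f q.1.1 (q.2 + 2 * m - q.1.1)%R ((0%R, q.1.2) :: l))).
  exact: (mint _ _ (fun q m l => (fiber q.1.1 q.2 m)%:E *
    f q.1.1 (q.2 + 2 * m - q.1.1)%R ((0%R, q.1.2) :: l))).
rewrite /bridge_integral.
transitivity (\int[mu]_al \int[mu]_z ((g z)%:E * zigint g n z (fun y l =>
    \int[mu]_m ((fiber al y m)%:E * f al (y + 2 * m - al)%R ((0%R, z) :: l))))).
  apply: eq_lebesgue => al; apply: (intertwining0 al (F := f al)) => //.
  have mp : measurable_fun setT (fun q : R => (al, q)) by measurability.
  exact: (mseq_comp (n := n.+1) mf mp).
have mzz : measurable_fun setT (fun q : R * R => zigint g n q.2 (fun y l =>
    \int[mu]_m ((fiber q.1 y m)%:E * f q.1 (y + 2 * m - q.1)%R ((0%R, q.2) :: l)))).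
  apply: (measurable_zigint g0 mg (f := fun q y l => \int[mu]_m ((fiber q.1 y m)%:E *
    f q.1 (y + 2 * m - q.1)%R ((0%R, q.2) :: l)))) => //.
  by move=> h z l; apply: lebesgue_ge0.
etransitivity.
  apply: (@exchange_integral _ (fun al z => (g z)%:E * zigint g n z (fun y l =>
    \int[mu]_m ((fiber al y m)%:E * f al (y + 2 * m - al)%R ((0%R, z) :: l))))).
    apply: emeasurable_funM => //.
    apply/measurable_EFinP; apply: (measurableT_comp mg); measurability.
  by move=> al z; rewrite mule_ge0// ?lee_fin// zigint_ge0// => y l; apply: lebesgue_ge0.
apply: eq_lebesgue => z.
have -> : zigint g n z (fun y l => \int[mu]_al \int[mu]_m
      ((fiber al y m)%:E * f al (y + 2 * m - al)%R ((0%R, z) :: l))) =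
   \int[mu]_al zigint g n z (fun y l => \int[mu]_m
      ((fiber al y m)%:E * f al (y + 2 * m - al)%R ((0%R, z) :: l))).
  apply: (zigint_integral g0 mg z (f := fun al y l => \int[mu]_m
      ((fiber al y m)%:E * f al (y + 2 * m - al)%R ((0%R, z) :: l)))).
    have mp : measurable_fun setT (fun q : R * R => ((q.1, z), q.2)) by measurability.
    exact: (mseq_comp mfib1 mp).
  by move=> al y l; apply: lebesgue_ge0.
apply: lebesgueZ => //.
  have mp : measurable_fun setT (fun q : R => (q, z)) by measurability.
  exact: (measurableT_comp mzz mp).
by move=> al; apply: zigint_ge0 => // y l; apply: lebesgue_ge0.
Qed.

Lemma bridge_integral_sym n (f : R -> R -> seq (R * R) -> \bar R) :
  mseq n.+1 (fun p : R * R => f p.1 p.2) -> (forall x y l, 0 <= f x y l) ->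
  bridge_integral n f = bridge_integral n (fun al be => f be al).
Proof.
move=> mf f0; etransitivity; first exact: bridge_integralE.
apply/esym; etransitivity.
  apply: (bridge_integralE (f := fun al be => f be al)); last by [].
  have mp : measurable_fun setT (fun q : R * R => (q.2, q.1)) by measurability.
  exact: (mseq_comp (n := n.+1) mf mp).
apply/esym.
apply: eq_lebesgue => z; apply: congr1; apply: eq_zigint => y l sl.
apply: (fiber_sym y (phi := fun al be => f al be ((0%R, z) :: l))) => //.
have ml := mseq_tuple mf.
have st : size ((0%R, z) :: l) == n.+1 by rewrite /= sl.
have mp : measurable_fun setT (fun q : R * R => (q, Tuple st)) by measurability.
exact: (measurableT_comp ml mp).
Qed.

End pitman.

Section zigzag_support.
Context {R : realType} (g : R -> R).
Hypothesis g0 : forall u, 0 <= g u.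
Hypothesis mg : measurable_fun setT g.

Fixpoint zigzag (x y : R) (w : seq (R * R)) : bool :=
  if w is (v, x') :: w' then [&& 0 < v, v < x, v < x' & zigzag x' y w']
  else x == y.

Lemma eq_zigint_zigzag n x (f f' : R -> seq (R * R) -> \bar R) :
  (forall y w, size w = n -> zigzag x y w -> f y w = f' y w) ->
  zigint g n x f = zigint g n x f'.
Proof.
elim: n x f f' => [|n IH] x f f' ff' /=; first by apply: ff' => /=.
apply: eq_lebesgue => y; apply: eq_lebesgue => v.
rewrite /zig; case: ifPn => [/and3P[v0 vx vy]|_]; last by rewrite !mul0e.
apply: congr1; apply: IH => z l sl zl; apply: ff'; rewrite /= ?sl//.
by rewrite v0 vx vy zl.
Qed.

Lemma le_zigint_zigzag n x (f f' : R -> seq (R * R) -> \bar R) :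
  mseq n f -> (forall y w, (0 <= f y w)%E) -> mseq n f' ->
  (forall y w, (0 <= f' y w)%E) ->
  (forall y w, size w = n -> zigzag x y w -> (f y w <= f' y w)%E) ->
  (zigint g n x f <= zigint g n x f')%E.
Proof.
elim: n x f f' => [|n IH] x f f' mf f0 mf' f'0 ff' /=; first exact: (ff' x [::] erefl (eqxx x)).
apply: le_lebesgue.
- apply: (@measurable_zig_zigint_integral _ g g0 mg n _ R (fun=> f) (cst x) id) => //.
  exact: (mseq_cst (n := n.+1) _ mf).
- by move=> y; apply: lebesgue_ge0 => v; exact: zig_zigint_ge0.
- apply: (@measurable_zig_zigint_integral _ g g0 mg n _ R (fun=> f') (cst x) id) => //.
  exact: (mseq_cst (n := n.+1) _ mf').
move=> y; apply: le_lebesgue.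
- apply: (@measurable_zig_zigint _ g g0 mg n _ R (fun=> f) (cst x) (cst y) id) => //.
  exact: (mseq_cst (n := n.+1) _ mf).
- by move=> v; exact: zig_zigint_ge0.
- apply: (@measurable_zig_zigint _ g g0 mg n _ R (fun=> f') (cst x) (cst y) id) => //.
  exact: (mseq_cst (n := n.+1) _ mf').
move=> v; rewrite /zig; case: ifPn => [/and3P[v0 vx vy]|_]; last by rewrite !mul0e.
rewrite lee_wpmul2l ?lee_fin// IH//; try exact: mseq_cons.
by move=> z l sl zl; apply: ff'; rewrite /= ?sl// v0 vx vy.
Qed.

End zigzag_support.

(** * The three processes along a zigzag *)

Section rows.
Context {R : realType}.
Implicit Types (al be m x z : R) (l w : seq (R * R)).

(** Every peak except the last lies above the valley that follows it, so the valleys and the final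
    height suffice. *)
Fixpoint future_min z l : R :=
  if l is (v, z') :: l' then Num.min v (future_min z' l') else z.

(* Recovers a zigzag from its Pitman transform, its endpoints and its global
   minimum [c]; [N] is the future minimum of the transform. *)
Definition pitman_row al be c z N : R * R * R :=
  (z - al + 2 * Num.max c (al - N), z, z - be + 2 * Num.max c (be - N)).

Fixpoint pitman_rows al be c z l : seq (R * R * R) :=
  pitman_row al be c z (future_min z l) ::
  if l is (_, z') :: l' then pitman_rows al be c z' l' else [::].

(* The values of [(X, Pbar X + al, Mbar X)] at height [x], running minimum [m]
   and future minimum [M]. *)
Definition zigzag_row al be m x M : R * R * R :=
  (x, x - 2 * m + al, x + `|be - al + m - M| - `|m - M|).

Fixpoint zigzag_rows al be m x w : seq (R * R * R) :=
  zigzag_row al be m x (future_min x w) ::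
  if w is (v, x') :: w' then zigzag_rows al be (Num.min m v) x' w' else [::].

Definition swap3 (p : R * R * R) : R * R * R := (p.2, p.1.2, p.1.1).

(** With the transform and [c] fixed, [al] and [be] enter the two outer coordinates by the same
    formula. *)
Lemma pitman_rows_swap al be c z l :
  pitman_rows be al c z l = map swap3 (pitman_rows al be c z l).
Proof. by elim: l z => [//|[v z'] l IH] z /=; rewrite IH. Qed.

(** If the zigzag never goes below [m] again, the transform is a translate of it by [al - 2 * m].
    Otherwise the drop below [m] leaves the valley [al - m], and the transform stays above it
    afterwards. *)
Lemma future_min_pitman al m x y w : zigzag x y w -> m <= x ->
  future_min (x - 2 * m + al) (pitman al m w) =
  al - 2 * m + Num.max (future_min x w) m.
Proof.
elim: w m x => [|[v x'] w IH] m x /=.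
  by move=> _ mx; rewrite (max_l mx); ring.
move=> /and4P[v0 vx vx' zw] mx; rewrite IH//; last by rewrite ge_min (ltW vx') orbT.
set M := future_min x' w.
have [mv|vm] := leP m v; rewrite /Order.min /Order.max;
  repeat case: ifPn => //; rewrite -?leNgt; lra.
Qed.

(** At the end the running minimum is the global one, so the last height of the transform and the
    endpoints determine it. *)
Lemma last_pitman al m x y w : zigzag x y w -> m <= x ->
  last (x - 2 * m + al) (map snd (pitman al m w)) =
  y - 2 * Num.min m (future_min x w) + al.
Proof.
elim: w m x => [|[v x'] w IH] m x /=.
  by move=> /eqP <- mx; rewrite (min_l mx).
move=> /and4P[v0 vx vx' zw] mx; rewrite IH ?minA//.
by rewrite ge_min (ltW vx') orbT.
Qed.

(** With [N] the future minimum of the transform, [Num.max c (al - N)] is the running minimum,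
    whichever of the past and the future contains the global minimum [c]; this gives the first
    coordinate. The absolute values of the third one are the same maximum with [be] instead of
    [al]. *)
Lemma pitman_rowsE al be m x y w : zigzag x y w -> m <= x ->
  pitman_rows al be (Num.min m (future_min x w)) (x - 2 * m + al) (pitman al m w) =
  zigzag_rows al be m x w.
Proof.
have rowE (M m' x' : R) : pitman_row al be (Num.min m' M) (x' - 2 * m' + al)
    (al - 2 * m' + Num.max M m') = zigzag_row al be m' x' M.
  rewrite /pitman_row /zigzag_row; congr (_, _, _).
    rewrite /Order.min /Order.max; repeat case: ifPn => //; rewrite -?leNgt; lra.
  have [h1|h1] := ler0P (be - al + m' - M); have [h2|h2] := ler0P (m' - M);
  rewrite /Order.min /Order.max; repeat case: ifPn => //; rewrite -?leNgt; lra.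
elim: w m x => [|[v x'] w IH] m x zw mx.
  rewrite /= -rowE; congr [:: pitman_row _ _ _ _ _].
  by rewrite (max_l mx); ring.
have fm := future_min_pitman al zw mx.
move: zw fm => /= /and4P[v0 vx vx' zw] ->.
rewrite -rowE; congr (_ :: _).
by rewrite minA IH// ge_min (ltW vx') orbT.
Qed.

(** The transform ends at [al + be - 2 * c], which yields an expression of the global minimum [c]
    symmetric in [al] and [be]. *)
Lemma pitman_rows_zigzag al be w : zigzag al be w ->
  pitman_rows al be ((al + be - last 0 (map snd (pitman al al w))) / 2) 0
    (pitman al al w) = zigzag_rows al be al al w.
Proof.
move=> zw; rewrite -(pitman_rowsE al be zw (lexx al)).
have := last_pitman al zw (lexx al).
rewrite (_ : al - 2 * al + al = 0); last by ring.
move=> ->; congr (pitman_rows _ _ _ _); lra.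
Qed.

End rows.

Section skeleton.
Context {R : realType}.
Implicit Types (al be m x e : R) (w : seq (R * R)).

(* The zigzag whose valleys are as shallow as possible. *)
Fixpoint skeleton x (ys : seq R) : seq (R * R) :=
  if ys is y :: ys' then (Num.min x y, y) :: skeleton y ys' else [::].

(** A real count, so that it can be integrated; as a sum of zeros and ones, it is 0 as soon as it is
    below 1. *)
Fixpoint deep_valleys e x w : R :=
  if w is (v, y) :: w' then (if v < Num.min x y - e then 1 else 0) + deep_valleys e y w'
  else 0.

Lemma deep_valleys_ge0 e x w : 0 <= deep_valleys e x w.
Proof.
elim: w x => [//|[v y] w IH] x /=; rewrite addr_ge0//.
by case: ifP.
Qed.

Lemma dist_min (a b a' b' e : R) : `|a - a'| <= e -> `|b - b'| <= e ->
  `|Num.min a b - Num.min a' b'| <= e.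
Proof.
rewrite !ler_distl => /andP[h1 h2] /andP[h3 h4].
by rewrite /Order.min; do 2 case: ifPn => //; rewrite -?leNgt => ? ?;
  apply/andP; split; lra.
Qed.

Lemma skeleton_close e x y w : 0 <= e -> zigzag x y w -> deep_valleys e x w < 1 ->
  `|future_min x w - future_min x (skeleton x (map snd w))| <= e.
Proof.
elim: w x => [|[v x'] w IH] x e0 /=; first by rewrite subrr normr0.
move=> /and4P[v0 vx vx' zw]; case: ifPn => [_|].
  by have := deep_valleys_ge0 e x' w; lra.
rewrite add0r -leNgt => h hd; apply: dist_min; last exact: IH.
by rewrite ler0_norm; [lra|rewrite subr_le0 le_min !ltW].
Qed.

Lemma dist_norm_diff (x a b a' b' e : R) :
  `|a - a'| <= 2 * e -> `|b - b'| <= 2 * e ->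
  `|x + `|a| - `|b| - (x + `|a'| - `|b'|)| <= 4 * e.
Proof.
move=> /(le_trans (ler_dist_dist a a')) h1 /(le_trans (ler_dist_dist b b')) h2.
move: h1 h2; rewrite !ler_distl => /andP[? ?] /andP[? ?].
by apply/andP; split; lra.
Qed.

(** The past and future minima each move by at most [e], hence each of the two absolute values of
    the third coordinate by at most [2 * e]. *)
Lemma zigzag_rows_skeleton al be e m m' x y w i :
  0 <= e -> zigzag x y w -> deep_valleys e x w < 1 -> `|m - m'| <= e ->
  `|(zigzag_rows al be m x w)`_i -
    (zigzag_rows al be m' x (skeleton x (map snd w)))`_i| <= 4 * e.
Proof.
move=> e0; elim: w m m' x i => [|[v x'] w IH] m m' x i zw hd hm.
  case: i => [|i] /=; last by rewrite nth_nil subrr normr0; lra.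
  move: hm; rewrite ler_distl => /andP[h1 h2].
  rewrite prod_normE /= prod_normE /= !ge_max -!andbA; apply/and3P; split.
  - by rewrite subrr normr0; lra.
  - by rewrite ler_distl; apply/andP; split; lra.
  by apply: dist_norm_diff; rewrite ler_distl; apply/andP; split; lra.
case: i => [|i].
  have := skeleton_close e0 zw hd; rewrite /=; move: hm.
  set M := Num.min v _; set M' := Num.min (Num.min _ _) _.
  rewrite !ler_distl => /andP[h1 h2] /andP[h3 h4].
  rewrite prod_normE /= prod_normE /= !ge_max -!andbA; apply/and3P; split.
  - by rewrite subrr normr0; lra.
  - by rewrite ler_distl; apply/andP; split; lra.
  by apply: dist_norm_diff; rewrite ler_distl; apply/andP; split; lra.
move: zw hd => /= /and4P[v0 vx vx' zw]; case: ifPn => [_|].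
  by have := deep_valleys_ge0 e x' w; lra.
rewrite add0r -leNgt => h hd; apply: IH => //.
apply: dist_min => //.
by rewrite ler0_norm; [lra|rewrite subr_le0 le_min !ltW].
Qed.

End skeleton.

(** * Integrating out the valleys *)

Section valley_integration.
Context {R : realType} (g : R -> R).
Hypothesis g0 : forall u, 0 <= g u.
Hypothesis mg : measurable_fun setT g.
Notation mu := (@lebesgue_measure R).
Local Open Scope ereal_scope.

Definition zmass (x y : R) : \bar R := \int[mu]_v (zig g x y v)%:E.

(* Zigzag integral of a function of the peaks only. *)
Fixpoint skel_integral n (x : R) (F : R -> seq R -> \bar R) : \bar R :=
  if n is n'.+1 then
    \int[mu]_y (zmass x y * skel_integral n' y (fun z l => F z (y :: l)))
  else F x [::].

Lemma measurable_zig1 x y : measurable_fun setT (fun v => (zig g x y v)%:E).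
Proof. by apply/measurable_EFinP; apply: measurable_zig. Qed.

Lemma zmass_ge0 x y : 0 <= zmass x y.
Proof. by apply: lebesgue_ge0 => v; rewrite lee_fin zig_ge0. Qed.

Lemma integral_zigM x y (c : \bar R) : 0 <= c ->
  \int[mu]_v ((zig g x y v)%:E * c) = zmass x y * c.
Proof.
move=> c0.
apply: (@ge0_integralZr _ (measurableTypeR R) R mu setT measurableT
  (fun v => (zig g x y v)%:E)) => //; first exact: measurable_zig1.
by move=> v _; rewrite lee_fin zig_ge0.
Qed.

Lemma zigint_snd n x (F : R -> seq R -> \bar R) : (forall y l, 0 <= F y l) ->
  zigint g n x (fun y w => F y (map snd w)) = skel_integral n x F.
Proof.
elim: n x F => [//|n IH] x F F0 /=; apply: eq_lebesgue => y.
rewrite integral_zigM; last by apply: zigint_ge0.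
by rewrite -(IH y (fun z l => F z (y :: l))).
Qed.

Lemma mseq_deep_valleys e n : forall d (H : measurableType d) (x : H -> R),
  measurable_fun setT x ->
  mseq n (fun h (w : seq (R * R)) => deep_valleys e (x h) w : R).
Proof.
elim: n => [|n IH] d H x mx /=; first exact: measurable_cst.
have : mseq n (fun (p : H * (R * R)) (l : seq (R * R)) =>
  ((if (p.2.1 < Num.min (x p.1) p.2.2 - e)%R then 1 else 0) + deep_valleys e p.2.2 l)%R); last first.
  by apply: eq_mseq => -[h [v y]] l.
apply: (@mseq_post _ _ n _ _ _ _ _ _ (fun (p : H * (R * R)) l =>
  ((if (p.2.1 < Num.min (x p.1) p.2.2 - e)%R then 1 else 0)%R : R,
    deep_valleys e p.2.2 l : R)) (fun p => p.1 + p.2)%R); last by measurability.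
apply: mseq_pair; last first.
  by apply: (IH _ (H * (R * R))%type (fun p => p.2.2)); measurability.
apply: mseq_head.
have mx1 : measurable_fun setT (fun p : H * (R * R) => x p.1).
  exact: (measurableT_comp mx measurable_fst).
by measurability.
Qed.

(** A first moment bound: given its two peaks, each of the [n] moves is deep with probability at
    most [delta]. The final weight [h] is arbitrary, for use with the kernels at the endpoints. *)
Lemma zigint_deep_valleys e (delta : R) : (0 <= delta)%R ->
  (forall x y, \int[mu]_v (zig g x y v *
    (if v < Num.min x y - e then 1 else 0))%:E <= delta%:E * zmass x y) ->
  forall n x (h : R -> \bar R), measurable_fun setT h -> (forall y, 0 <= h y) ->
  zigint g n x (fun y w => (deep_valleys e x w)%:E * h y) <=
  (n%:R * delta)%:E * zigint g n x (fun y _ => h y).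
Proof.
move=> d0 hd; elim=> [|n IH] x h mh h0.
  by rewrite /= mul0r !mul0e.
have mhh k d (H : measurableType d) (a : H -> R) : measurable_fun setT a ->
    mseq k (fun q (_ : seq (R * R)) => h (a q)).
  by move=> ma; apply: mseq_head; exact: (measurableT_comp mh ma).
have mhd k d (H : measurableType d) (a b : H -> R) : measurable_fun setT a ->
    measurable_fun setT b ->
    mseq k (fun q (w : seq (R * R)) => (deep_valleys e (b q) w)%:E * h (a q)).
  move=> ma mb; apply: (@mseq_post _ _ k _ _ _ _ _ _ (fun q w =>
    ((deep_valleys e (b q) w)%:E, h (a q))) (fun p => p.1 * p.2)); last by measurability.
  apply: mseq_pair; last exact: mhh.
  apply: (@mseq_post _ _ k _ _ _ _ _ _ (fun q w => deep_valleys e (b q) w : R)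
    EFin); [exact: mseq_deep_valleys|exact: EFin_measurable].
pose b x y v : R := if (v < Num.min x y - e)%R then 1%R else 0%R.
have b0 x' y v : (0 <= b x' y v)%R by rewrite /b; case: ifP.
pose H y := zigint g n y (fun z _ => h z).
have H0 y : 0 <= H y by apply: zigint_ge0.
have mH : measurable_fun setT H.
  apply: (measurable_zigint g0 mg (f := fun _ z _ => h z)) => //.
  by apply: mhh; measurability.
have mzm d (T : measurableType d) (a c : T -> R) : measurable_fun setT a ->
    measurable_fun setT c -> measurable_fun setT (fun t => zmass (a t) (c t)).
  move=> ma mc; apply: measurable_integral; last by move=> *; rewrite lee_fin zig_ge0.
  apply/measurable_EFinP; apply: measurable_zig => //.
  - exact: (measurableT_comp ma measurable_fst).
  - exact: (measurableT_comp mc measurable_fst).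
have dh0 y l z : 0 <= (deep_valleys e y l)%:E * h z by rewrite mule_ge0// lee_fin deep_valleys_ge0.
have -> : zigint g n.+1 x (fun y _ => h y) = \int[mu]_y (zmass x y * H y).
  by apply: eq_lebesgue => y; apply: integral_zigM; exact: H0.
rewrite -lebesgueZ; last 3 first.
- by apply: emeasurable_funM => //; apply: mzm; measurability.
- by move=> y; rewrite mule_ge0// zmass_ge0.
- by rewrite mulr_ge0.
apply: le_lebesgue.
- apply: (@measurable_zig_zigint_integral _ g g0 mg n _ R (fun _ y w => (deep_valleys e x w)%:E * h y)
    (cst x) id) => //.
  by apply: (mhd n.+1 _ (R * R)%type snd (cst x)); measurability.
- by move=> y; apply: lebesgue_ge0 => v;
  apply: (zig_zigint_ge0 g0 n x y v (f := fun y w => (deep_valleys e x w)%:E * h y)).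
- apply: emeasurable_funM; first exact: measurable_cst.
  by apply: emeasurable_funM => //; apply: mzm; measurability.
move=> y.
have mbH : measurable_fun setT (fun v => (zig g x y v * b x y v)%:E * H y).
  apply: emeasurable_funM; last exact: measurable_cst.
  apply/measurable_EFinP; apply: measurable_funM; first exact: measurable_zig.
  by rewrite /b; measurability.
(* Separates the indicator of the first move, a constant for the remaining integrals, from the count
   along the rest. *)
have step v : (zig g x y v)%:E * zigint g n y (fun z l => (deep_valleys e x ((v, y) :: l))%:E * h z) <=
  (zig g x y v * b x y v)%:E * H y + (zig g x y v)%:E * ((n%:R * delta)%:E * H y).
  have -> : zigint g n y (fun z l => (deep_valleys e x ((v, y) :: l))%:E * h z) =
    (b x y v)%:E * H y + zigint g n y (fun z l => (deep_valleys e y l)%:E * h z).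
    rewrite -zigintZ//; last by apply: mhh; measurability.
    rewrite -zigintD//; last 3 first.
    - apply: (@mseq_post _ _ n _ _ _ _ _ _ (fun z (_ : seq (R * R)) => h z)
        (fun u => (b x y v)%:E * u)); last by measurability.
      by apply: mhh; measurability.
    - by move=> z l; rewrite mule_ge0// lee_fin.
    - by apply: (mhd _ _ R id (cst y)); measurability.
    apply: eq_zigint => z l _ /=; rewrite EFinD ge0_muleDl// lee_fin ?b0//.
    exact: deep_valleys_ge0.
  rewrite ge0_muleDr//; last 2 first.
  - by rewrite mule_ge0// lee_fin.
  - by apply: zigint_ge0.
  rewrite EFinM muleA leeD2l// lee_wpmul2l ?lee_fin ?zig_ge0//.
  exact: IH.
apply: (@le_trans _ _ (\int[mu]_v ((zig g x y v * b x y v)%:E * H y +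
    (zig g x y v)%:E * ((n%:R * delta)%:E * H y)))).
  apply: le_lebesgue => //.
  - apply: (@measurable_zig_zigint _ g g0 mg n _ R (fun _ y w => (deep_valleys e x w)%:E * h y)
      (cst x) (cst y) id) => //.
    by apply: (mhd n.+1 _ (R * R)%type snd (cst x)); measurability.
  - by move=> v; apply: (zig_zigint_ge0 g0 n x y v (f := fun y w => (deep_valleys e x w)%:E * h y)).
  - apply: emeasurable_funD => //.
    by apply: emeasurable_funM; [exact: measurable_zig1|exact: measurable_cst].
have nH0 : 0 <= (n%:R * delta)%:E * H y by rewrite mule_ge0// lee_fin mulr_ge0.
rewrite lebesgueD//; last 3 first.
- by move=> v; rewrite mule_ge0// lee_fin mulr_ge0// zig_ge0.
- by apply: emeasurable_funM; [exact: measurable_zig1|exact: measurable_cst].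
- by move=> v; rewrite mule_ge0// lee_fin zig_ge0.
rewrite integral_zigM//.
have -> : \int[mu]_v ((zig g x y v * b x y v)%:E * H y) =
    \int[mu]_v (zig g x y v * b x y v)%:E * H y.
  apply: (@ge0_integralZr _ (measurableTypeR R) R mu setT measurableT
    (fun v => (zig g x y v * b x y v)%:E)) => //.
    apply/measurable_EFinP; apply: measurable_funM; first exact: measurable_zig.
    by rewrite /b; measurability.
  by move=> v _; rewrite lee_fin mulr_ge0// zig_ge0.
apply: (@le_trans _ _ (delta%:E * zmass x y * H y +
    zmass x y * ((n%:R * delta)%:E * H y))).
  by rewrite leeD2r// lee_wpmul2r// hd.
rewrite -muleA [X in _ + X]muleCA -ge0_muleDl ?lee_fin ?mulr_ge0//.
by rewrite -EFinD -[X in (X + _)%R]mul1r -mulrDl -natr1 addrC.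
Qed.

End valley_integration.

(** * The Gaussian weight of a move *)

Section gaussian.
Context {R : realType} (r : R).
Hypothesis r0 : 0 < r.
Notation mu := (@lebesgue_measure R).

Definition gauss (u : R) : R := expR (- u ^+ 2 / (2 * r)) / Num.sqrt (2 * pi * r).

(* The density at distance [u] below, of the minimum of a Brownian bridge. *)
Definition gauss_slope (u : R) : R := 2 * `|u| / r * gauss u.

Lemma sqrt_gauss_gt0 : 0 < Num.sqrt (2 * pi * r).
Proof. by rewrite sqrtr_gt0 !mulr_gt0// pi_gt0. Qed.

Lemma gauss_gt0 u : 0 < gauss u.
Proof. by rewrite divr_gt0// ?expR_gt0 ?sqrt_gauss_gt0. Qed.

Lemma gauss_slope_ge0 u : 0 <= gauss_slope u.
Proof. by rewrite !mulr_ge0// ?invr_ge0 ltW// gauss_gt0. Qed.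

Lemma gaussN u : gauss (- u) = gauss u.
Proof. by rewrite /gauss sqrrN. Qed.

(** Where [c - 2 * v >= 0] this derivative is [gauss_slope (c - 2 * v)], so valleys integrate out in
    closed form. *)
Lemma is_derive_gauss (c v : R) :
  is_derive v 1 (fun v : R => gauss (c - 2 * v)) (2 * (c - 2 * v) / r * gauss (c - 2 * v)).
Proof.
rewrite /gauss; apply: is_derive_eq => /=.
rewrite /GRing.scale /=.
field.
by rewrite gt_eqF ?sqrt_gauss_gt0 ?gt_eqF.
Qed.

Lemma continuous_gauss : continuous gauss.
Proof.
move=> u; rewrite /gauss; apply: cvgM; last exact: cvg_cst.
apply: continuous_comp; last exact: continuous_expR.
apply: cvgM; last exact: cvg_cst.
apply: cvgN; apply: exprn_continuous.
Qed.

Lemma continuous_gauss_slope : continuous gauss_slope.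
Proof.
move=> u; apply: cvgM; last exact: continuous_gauss.
apply: cvgM; last exact: cvg_cst.
apply: cvgM; first exact: cvg_cst.
exact: norm_continuous.
Qed.

Lemma measurable_gauss_slope : measurable_fun setT gauss_slope.
Proof. by apply: continuous_measurable_fun; exact: continuous_gauss_slope. Qed.

Lemma gauss_slope_integral (c M : R) : 0 <= M -> 2 * M <= c ->
  (\int[mu]_v (if (0 < v) && (v < M) then gauss_slope (c - 2 * v) else 0)%:E =
   (gauss (c - 2 * M) - gauss c)%:E)%E.
Proof.
rewrite le_eqVlt => /predU1P[<- _|M0 Mc].
  rewrite mulr0 subr0 subrr.
  rewrite (_ : (fun _ => _) = cst 0%E) ?integral0//.
  by apply/funext => v; rewrite ifF//; apply/negbTE/negP => /andP[]; lra.
have mf : continuous (fun v : R => gauss_slope (c - 2 * v)).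
  move=> v; apply: (continuous_comp (f := fun v : R => c - 2 * v)); last exact: continuous_gauss_slope.
  apply: cvgB; first exact: cvg_cst.
  by apply: cvgM; [exact: cvg_cst|exact: cvg_id].
have dF (v : R) := is_derive_gauss c v.
have cF : continuous (fun v : R => gauss (c - 2 * v)).
  move=> v; apply: (continuous_comp (f := fun v : R => c - 2 * v)); last exact: continuous_gauss.
  apply: cvgB; first exact: cvg_cst.
  by apply: cvgM; [exact: cvg_cst|exact: cvg_id].
transitivity (\int[mu]_(v in `[0%R, M]) (gauss_slope (c - 2 * v))%:E)%E.
  rewrite integral_itv_bndoo; last first.
    apply/measurable_EFinP; apply: measurable_funTS.
    exact: continuous_measurable_fun.
  rewrite [RHS]integral_mkcond; apply: eq_integral => v _.
  rewrite patchE mem_setE /= in_itv/=; by case: ifP.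
rewrite (@continuous_FTC2 _ _ (fun v : R => gauss (c - 2 * v)))//.
- by rewrite mulr0 subr0 EFinB.
- exact: continuous_subspaceT.
- split.
  + by move=> v _; case: (dF v).
  + apply: cvg_at_right_filter; exact: cF.
  + apply: cvg_at_left_filter; exact: cF.
- move=> v; rewrite in_itv/= => /andP[v0 vM].
  rewrite derive1E; case: (dF v) => _ ->.
  by rewrite /gauss_slope ger0_norm//; lra.
Qed.

Lemma zig_gauss_integral (x y M : R) : M <= Num.min x y ->
  (\int[mu]_v (zig gauss_slope x y v * (if v < M then 1 else 0))%:E =
   (if 0 < M then gauss (x + y - 2 * M) - gauss (x + y) else 0)%:E)%E.
Proof.
rewrite le_min => /andP[Mx My]; case: ifPn => [M0|]; last first.
  rewrite -leNgt => M0.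
  rewrite (_ : (fun _ => _) = cst 0%E) ?integral0//.
  apply/funext => v; rewrite /zig; case: ifP => [/and3P[v0 _ _]|]; last by rewrite mul0r.
  by rewrite ifF ?mulr0//; apply/negbTE; rewrite -leNgt; lra.
rewrite -gauss_slope_integral; [|lra|lra].
apply: eq_integral => v _; congr EFin; rewrite /zig.
have [vM|Mv] := ltP v M; last by rewrite andbF mulr0.
rewrite mulr1 andbT; case: ifP => [/and3P[-> _ _]//|h].
case: ifP => // v0; move: h; rewrite v0 (lt_le_trans vM Mx) (lt_le_trans vM My)//.
Qed.

(** The difference of Gaussians is the transition density of Brownian motion killed at 0, as the
    reflection principle gives it. *)
Lemma zmass_gauss (x y : R) : zmass gauss_slope x y =
  (if (0 < x) && (0 < y) then gauss (x - y) - gauss (x + y) else 0)%:E.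
Proof.
have := @zig_gauss_integral x y (Num.min x y) (lexx _); rewrite lt_min => h.
transitivity (\int[mu]_v (zig gauss_slope x y v *
    (if v < Num.min x y then 1 else 0))%:E)%E; last first.
  rewrite h; congr (if _ then _ - _ else _)%:E.
  have [xy|yx] := leP x y; last by congr gauss; ring.
  by rewrite -gaussN; congr gauss; ring.
apply: eq_lebesgue => v; congr EFin; rewrite /zig.
case: ifP => [/and3P[_ vx vy]|]; last by rewrite mul0r.
by rewrite lt_min vx vy mulr1.
Qed.

(** The Bessel process is the killed Brownian motion conditioned through the harmonic function
    [x |-> x], whence the factor [x * y]. *)
Lemma zmass_bessel (x y : R) : zmass gauss_slope x y =
  (if (0 < x) && (0 < y) then x * y * bessel_kernel r x y else 0)%:E.
Proof.
rewrite zmass_gauss; congr EFin; case: ifPn => // /andP[x0 y0].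
rewrite /bessel_kernel ifF; last by rewrite gt_eqF// mulr_gt0.
rewrite /gauss; field.
by rewrite !gt_eqF// sqrt_gauss_gt0.
Qed.

(** With [d] the distance between the peaks, the integral over deep valleys starts from
    [gauss (d + 2 * e)], and [(d + 2 * e) ^+ 2 >= d ^+ 2 + 4 * e ^+ 2] produces the exponential
    factor. This factor is at most 1, so it can also be put in front of the subtracted
    [gauss (x + y)]. *)
Lemma zig_gauss_deep (e x y : R) : 0 <= e ->
  (\int[mu]_v (zig gauss_slope x y v *
    (if v < Num.min x y - e then 1 else 0))%:E <=
  (expR (- (2 * e ^+ 2 / r)))%:E * zmass gauss_slope x y)%E.
Proof.
move=> e0; rewrite zig_gauss_integral ?gerBl// zmass_gauss -EFinM lee_fin.
set delta := expR _; have d0 : 0 <= delta by exact: expR_ge0.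
have d1 : delta <= 1.
  by rewrite -expR0 ler_expR oppr_le0 divr_ge0 ?mulr_ge0 ?sqr_ge0// ltW.
have gg (z : R) : 0 <= gauss z by rewrite ltW// gauss_gt0.
case: ifPn => [h|h]; last first.
  case: ifP => // [/andP[x0 y0]|]; last by rewrite mulr0.
  rewrite mulr_ge0// subr_ge0 ler_pM2r ?invr_gt0 ?sqrt_gauss_gt0// ler_expR.
  rewrite ler_pM2r ?invr_gt0 ?mulr_gt0// lerN2 -subr_ge0.
  by rewrite (_ : _ - _ = 4 * (x * y)) ?mulr_ge0 ?ltW//; ring.
have /andP[x0 y0] : (0 < x) && (0 < y) by rewrite -lt_min; lra.
rewrite x0 y0/=.
have key : gauss (x + y - 2 * (Num.min x y - e)) <= delta * gauss (x - y).
  rewrite /gauss mulrA ler_pM2r ?invr_gt0 ?sqrt_gauss_gt0// -expRD ler_expR.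
  rewrite -(ler_pM2r (_ : 0 < 2 * r)) ?mulr_gt0//.
  have r_neq0 : r != 0 by rewrite gt_eqF.
  set m := Num.min x y.
  rewrite [X in X <= _](_ : _ = - (x + y - 2 * (m - e)) ^+ 2); last by field.
  rewrite [X in _ <= X](_ : _ = - (4 * e ^+ 2 + (x - y) ^+ 2)); last by field.
  rewrite lerN2 {}/m.
  by have [xy|yx] := leP x y; nra.
have := ler_piMl (gg (x + y)) d1.
rewrite [delta * (_ - _)]mulrBr; exact: lerB.
Qed.

End gaussian.

(** * The bridge on a grid *)

Section positive_integral.
Context {R : realType}.
Notation mu := (@lebesgue_measure R).
Local Open Scope ereal_scope.

Definition pos_ind (x : R) : R := if (0 < x)%R then 1%R else 0%R.

Lemma pos_ind_ge0 x : (0 <= pos_ind x)%R.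
Proof. by rewrite /pos_ind; case: ifP. Qed.

Lemma measurable_pos_ind : measurable_fun setT (EFin \o pos_ind).
Proof.
apply/measurable_EFinP; apply: measurable_fun_ifT; try exact: measurable_cst.
by apply: measurable_fun_ltr; [exact: measurable_cst|exact: measurable_id].
Qed.

(** [iter_integral] rewritten on lists, over the whole line with an indicator, so that [mseq] and
    the Fubini lemmas apply. *)
Fixpoint pos_integral n (f : seq R -> \bar R) : \bar R :=
  if n is n'.+1 then
    \int[mu]_x ((pos_ind x)%:E * pos_integral n' (fun l => f (x :: l)))
  else f [::].

Lemma pos_integral_iter n (f : seq R -> \bar R) :
  iter_integral (fun x : n.-tuple R => f x) = pos_integral n f.
Proof.
elim: n f => [//|n IH] f /=; rewrite [LHS]integral_mkcond.
apply: eq_lebesgue => x; rewrite patchE mem_setE /= in_itv/= andbT /pos_ind.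
case: ifP => x0; last by rewrite mul0e.
by rewrite mul1e -(IH (fun l => f (x :: l))).
Qed.

Lemma pos_integral_ge0 n f : (forall l, 0 <= f l) -> 0 <= pos_integral n f.
Proof.
elim: n f => [|n IH] f f0 //=; apply: lebesgue_ge0 => x.
by rewrite mule_ge0// ?IH// lee_fin pos_ind_ge0.
Qed.

Lemma eq_pos_integral n f f' :
  (forall l, size l = n -> all (fun x => 0 < x)%R l -> f l = f' l) ->
  pos_integral n f = pos_integral n f'.
Proof.
elim: n f f' => [|n IH] f f' ff' /=; first exact: ff'.
apply: eq_lebesgue => x; rewrite /pos_ind; case: ifPn => [x0|_]; last by rewrite !mul0e.
apply: congr1; apply: IH => l sl al; apply: ff'; rewrite /= ?sl//.
by rewrite x0.
Qed.

Lemma measurable_pos_integral n : forall d (H : measurableType d)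
    (f : H -> seq R -> \bar R), mseq n f -> (forall h l, 0 <= f h l) ->
  measurable_fun setT (fun h => pos_integral n (f h)).
Proof.
elim: n => [//|n IH] d H f mf f0.
apply: measurable_integral; last first.
  by move=> h x; rewrite mule_ge0// ?pos_integral_ge0// lee_fin pos_ind_ge0.
apply: emeasurable_funM.
  exact: (measurableT_comp measurable_pos_ind measurable_snd).
exact: (IH _ (H * R)%type (fun p l => f p.1 (p.2 :: l))).
Qed.

Lemma measurable_pos_integrand n d (H : measurableType d)
    (f : H -> seq R -> \bar R) (x : H -> R) :
  mseq n.+1 f -> (forall h l, 0 <= f h l) -> measurable_fun setT x ->
  measurable_fun setT (fun h =>
    (pos_ind (x h))%:E * pos_integral n (fun l => f h (x h :: l))).
Proof.
move=> mf f0 mx; apply: emeasurable_funM; first exact: (measurableT_comp measurable_pos_ind).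
apply: (measurable_pos_integral (f := fun h l => f h (x h :: l))) => //.
have mp : measurable_fun setT (fun h => (h, x h)) by measurability.
exact: (mseq_comp (f := fun p l => f p.1 (p.2 :: l)) mf mp).
Qed.

Lemma pos_integrand_ge0 n f x : (forall l, 0 <= f l) ->
  0 <= (pos_ind x)%:E * pos_integral n (fun l => f (x :: l)).
Proof. by move=> f0; rewrite mule_ge0// ?pos_integral_ge0// lee_fin pos_ind_ge0. Qed.

Lemma mseq_fix_cons n (f : seq R -> \bar R) x :
  mseq n.+1 (fun _ : R => f) -> mseq n (fun _ : R => f \o cons x).
Proof.
move=> mf.
have mp : measurable_fun setT (fun h : R => (h, x)) by measurability.
exact: (mseq_comp (f := fun p l => f (p.2 :: l)) mf mp).
Qed.

Lemma pos_integralZ n (k : R) (f : seq R -> \bar R) : (0 <= k)%R ->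
  mseq n (fun _ : R => f) -> (forall l, 0 <= f l) ->
  pos_integral n (fun l => k%:E * f l) = k%:E * pos_integral n f.
Proof.
move=> k0; elim: n f => [//|n IH] f mf f0 /=.
rewrite -lebesgueZ//; last 2 first.
- by apply: (@measurable_pos_integrand n _ R (fun=> f) id).
- by move=> x; exact: pos_integrand_ge0.
apply: eq_lebesgue => x; rewrite (IH (fun l => f (x :: l)))//.
  by rewrite muleCA.
exact: mseq_fix_cons.
Qed.

Lemma pos_integral_exchange n (f : R -> seq R -> \bar R) :
  mseq n f -> (forall u l, 0 <= f u l) ->
  pos_integral n (fun l => \int[mu]_u f u l) = \int[mu]_u pos_integral n (f u).
Proof.
elim: n f => [//|n IH] f mf f0 /=.
have mfx x : mseq n (fun u l => f u (x :: l)).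
  have mp : measurable_fun setT (fun h : R => (h, x)) by measurability.
  exact: (mseq_comp (f := fun p l => f p.1 (p.2 :: l)) mf mp).
transitivity (\int[mu]_x \int[mu]_u ((pos_ind x)%:E *
    pos_integral n (fun l => f u (x :: l)))).
  apply: eq_lebesgue => x.
  have -> : pos_integral n (fun l => \int[mu]_u f u (x :: l)) =
      \int[mu]_u pos_integral n (fun l => f u (x :: l)).
    by apply: (IH (fun u l => f u (x :: l))).
  rewrite -lebesgueZ ?pos_ind_ge0//; last by move=> u; exact: pos_integral_ge0.
  exact: (measurable_pos_integral (f := fun u l => f u (x :: l))).
apply: (@exchange_integral _ (fun x u => (pos_ind x)%:E *
    pos_integral n (fun l => f u (x :: l)))).
  apply: (@measurable_pos_integrand n _ (R * R)%type (fun p => f p.2) fst) => //.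
  by apply: (mseq_comp mf); measurability.
by move=> x u; exact: (@pos_integrand_ge0 n (f u)).
Qed.

Lemma mseq_rcons n : forall d (H : measurableType d) dU (U : measurableType dU)
    (f : H -> seq R -> U) (x : H -> R), mseq n.+1 f -> measurable_fun setT x ->
  mseq n (fun h l => f h (rcons l (x h))).
Proof.
elim: n => [|n IH] d H dU U f x /= mf mx.
  exact: (measurableT_comp mf (measurable_fun_pair (@measurable_id _ _ _) mx)).
apply: (IH _ (H * R)%type _ _ (fun p l => f p.1 (p.2 :: l)) (fun p => x p.1)) => //.
exact: (measurableT_comp mx measurable_fst).
Qed.

Lemma mseq_rev n : forall d (H : measurableType d) dU (U : measurableType dU)
    (f : H -> seq R -> U), mseq n f -> mseq n (fun h l => f h (rev l)).
Proof.
elim: n => [//|n IH] d H dU U f /= mf.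
have := IH _ (H * R)%type _ _ (fun p l => f p.1 (rcons l p.2)).
have mfst : mseq n.+1 (fun p : H * R => f p.1).
  by apply: (mseq_comp (n := n.+1) mf); measurability.
have mr : mseq n (fun p : H * R => (f p.1) \o (rcons ^~ p.2)).
  by apply: (mseq_rcons mfst); measurability.
by move=> /(_ mr); apply: eq_mseq => p l; rewrite rev_cons.
Qed.

Lemma pos_integral_rcons n (f : seq R -> \bar R) :
  mseq n.+1 (fun _ : R => f) -> (forall l, 0 <= f l) ->
  pos_integral n.+1 f =
  \int[mu]_x ((pos_ind x)%:E * pos_integral n (fun l => f (rcons l x))).
Proof.
elim: n f => [//|n IH] f mf f0.
have mf2 : measurable_fun setT (fun p : R * R => pos_integral n (fun l => f (p.1 :: rcons l p.2))).
  apply: (measurable_pos_integral (f := fun p l => f (p.1 :: rcons l p.2))) => //.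
  apply: (@mseq_rcons n _ (R * R)%type _ _ (fun p l => f (p.1 :: l)) snd) => //.
  have mp : measurable_fun setT (fun q : R * R => (0%R : R, q.1)) by measurability.
  exact: (mseq_comp (n := n.+1) (f := fun p l => f (p.2 :: l)) mf mp).
transitivity (\int[mu]_x \int[mu]_y ((pos_ind x)%:E * ((pos_ind y)%:E *
    pos_integral n (fun l => f (x :: rcons l y))))).
  apply: eq_lebesgue => x.
  etransitivity.
    apply: congr1; apply: (IH (fun l => f (x :: l))) => //.
    exact: (mseq_fix_cons (n := n.+1)).
  rewrite -lebesgueZ ?pos_ind_ge0//.
    apply: emeasurable_funM; first exact: measurable_pos_ind.
    have mp : measurable_fun setT (fun y : R => (x, y)) by measurability.
    exact: (measurableT_comp mf2 mp).
  by move=> y; rewrite mule_ge0// ?lee_fin ?pos_ind_ge0// pos_integral_ge0.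
transitivity (\int[mu]_y \int[mu]_x ((pos_ind x)%:E * ((pos_ind y)%:E *
    pos_integral n (fun l => f (x :: rcons l y))))).
  apply: (@exchange_integral _ (fun x y => (pos_ind x)%:E * ((pos_ind y)%:E *
    pos_integral n (fun l => f (x :: rcons l y))))).
    apply: emeasurable_funM.
      exact: (measurableT_comp measurable_pos_ind measurable_fst).
    apply: emeasurable_funM => //.
    exact: (measurableT_comp measurable_pos_ind measurable_snd).
  by move=> x y; rewrite !mule_ge0// ?lee_fin ?pos_ind_ge0// pos_integral_ge0.
apply: eq_lebesgue => y /=.
rewrite -lebesgueZ ?pos_ind_ge0//; last 2 first.
- apply: emeasurable_funM; first exact: measurable_pos_ind.
  have mp : measurable_fun setT (fun x : R => (x, y)) by measurability.
  exact: (measurableT_comp mf2 mp).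
- by move=> x; rewrite mule_ge0// ?lee_fin ?pos_ind_ge0// pos_integral_ge0.
by apply: eq_lebesgue => x; rewrite muleCA.
Qed.

Lemma pos_integral_rev n (f : seq R -> \bar R) :
  mseq n (fun _ : R => f) -> (forall l, 0 <= f l) ->
  pos_integral n (fun l => f (rev l)) = pos_integral n f.
Proof.
elim: n f => [//|n IH] f mf f0.
apply/esym; etransitivity; first exact: pos_integral_rcons.
apply: eq_lebesgue => x; apply: congr1; apply/esym.
etransitivity; last first.
  apply: (IH (fun l => f (rcons l x))) => //.
  by apply: (@mseq_rcons n _ R _ _ (fun=> f) (cst x)); first exact: mf.
by apply: eq_pos_integral => l _ _; rewrite rev_cons.
Qed.

End positive_integral.

(** * Factorisation of the bridge density *)

Section density.
Context {R : realType}.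
Notation mu := (@lebesgue_measure R).

Lemma bessel_kernelC (r x y : R) : bessel_kernel r x y = bessel_kernel r y x.
Proof.
rewrite /bessel_kernel (mulrC y x) (addrC (y ^+ 2)) (addrC y x).
by rewrite (_ : (y - x) ^+ 2 = (x - y) ^+ 2)//; ring.
Qed.

Lemma bessel_kernel_ge0 (r x y : R) : 0 < r -> 0 <= x -> 0 <= y ->
  0 <= bessel_kernel r x y.
Proof.
move=> r0 x0 y0; rewrite /bessel_kernel; case: ifPn => [_|xy].
  by rewrite mulr_ge0 ?expR_ge0// divr_ge0// mulr_ge0 ?sqrtr_ge0// ltW.
rewrite mulr_ge0//.
  by rewrite divr_ge0// !mulr_ge0// sqrtr_ge0.
rewrite subr_ge0 ler_expR ler_pM2r ?invr_gt0 ?mulr_gt0// lerN2.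
have := mulr_ge0 x0 y0; nra.
Qed.

Variable r : R.
Hypothesis r0 : 0 < r.

(** Transition density of killed Brownian motion with respect to Lebesgue measure, set to 0 off the
    positive quadrant. *)
Definition chain_kernel (x y : R) : R :=
  if (0 < x) && (0 < y) then x * y * bessel_kernel r x y else 0.

Lemma chain_kernel_ge0 x y : 0 <= chain_kernel x y.
Proof.
rewrite /chain_kernel; case: ifP => // /andP[x0 y0].
by rewrite !mulr_ge0 ?bessel_kernel_ge0// ltW.
Qed.

Lemma chain_kernelC x y : chain_kernel x y = chain_kernel y x.
Proof. by rewrite /chain_kernel andbC bessel_kernelC (mulrC x). Qed.

(** Written as [zmass], the kernel is an integral depending on parameters, and the quotients of
    [bessel_kernel] disappear. *)
Lemma measurable_chain_kernel d (H : measurableType d) (a b : H -> R) :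
  measurable_fun setT a -> measurable_fun setT b ->
  measurable_fun setT (fun h => chain_kernel (a h) (b h)).
Proof.
move=> ma mb; apply/measurable_EFinP.
rewrite (_ : _ \o _ = fun h => zmass (gauss_slope r) (a h) (b h)); last first.
  by apply/funext => h /=; rewrite zmass_bessel.
apply: measurable_integral; last by move=> *; rewrite lee_fin zig_ge0// => u; exact: gauss_slope_ge0.
apply/measurable_EFinP; apply: measurable_zig => //.
- exact: measurable_gauss_slope.
- exact: (measurableT_comp ma measurable_fst).
- exact: (measurableT_comp mb measurable_fst).
Qed.

Fixpoint chain (x : R) (l : seq R) : R :=
  if l is y :: l' then chain_kernel x y * chain y l' else 1.

Lemma chain_ge0 x l : 0 <= chain x l.
Proof. by elim: l x => [//|y l IH] x /=; rewrite mulr_ge0// chain_kernel_ge0. Qed.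

Lemma chain_rcons x l y : chain x (rcons l y) = chain x l * chain_kernel (last x l) y.
Proof. by elim: l x => [|z l IH] x /=; rewrite ?mulr1 ?mul1r// IH mulrA. Qed.

Lemma mseq_chain n : forall d (H : measurableType d) (x : H -> R),
  measurable_fun setT x -> mseq n (fun h l => chain (x h) l : R).
Proof.
elim: n => [|n IH] d H x mx /=; first exact: measurable_cst.
have mx1 : measurable_fun setT (fun p : H * R => x p.1).
  exact: (measurableT_comp mx measurable_fst).
apply: (@mseq_post _ _ n _ _ _ _ _ _ (fun (p : H * R) l =>
  (chain_kernel (x p.1) p.2, chain p.2 l)) (fun p => p.1 * p.2)); last by measurability.
apply: mseq_pair; last by apply: (IH _ (H * R)%type snd).
by apply: mseq_head; apply: measurable_chain_kernel; measurability.
Qed.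

Lemma mseq_last n : forall d (H : measurableType d) dU (U : measurableType dU)
    (G : H -> R -> seq R -> U) (x : H -> R),
  mseq n (fun p : H * R => G p.1 p.2) -> measurable_fun setT x ->
  mseq n (fun h l => G h (last (x h) l) l).
Proof.
elim: n => [|n IH] d H dU U G x /= mG mx.
  exact: (measurableT_comp mG (measurable_fun_pair (@measurable_id _ _ _) mx)).
apply: (IH _ (H * R)%type _ _ (fun p z l => G p.1 z (p.2 :: l)) snd) => //.
have mp : measurable_fun setT (fun q : H * R * R => ((q.1.1, q.2), q.1.2)).
  by measurability.
exact: (mseq_comp (f := fun p l => G p.1.1 p.1.2 (p.2 :: l)) mG mp).
Qed.

(** By [zmass_bessel] each factor of [chain] is the mass of a move, so a function of the peaks has
    the same integral with or without valleys. *)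
Lemma pos_integral_chain n x (F : R -> seq R -> \bar R) : 0 < x ->
  mseq n F -> (forall y l, 0 <= F y l)%E ->
  pos_integral n (fun l => ((chain x l)%:E * F (last x l) l)%E) =
  skel_integral (gauss_slope r) n x F.
Proof.
elim: n x F => [|n IH] x F x0 mF F0 /=; first by rewrite mul1e.
apply: eq_lebesgue => y.
rewrite zmass_bessel// -/(chain_kernel x y) /pos_ind.
case: ifPn => [y0|y0]; last first.
  by rewrite mul0e /chain_kernel (negbTE y0) andbF mul0e.
rewrite mul1e -(IH y (fun z l => F z (y :: l)))//; last first.
  have mp : measurable_fun setT (fun h : R => (h, y)) by measurability.
  exact: (mseq_comp (f := fun p l => F p.1 (p.2 :: l)) mF mp).
rewrite -pos_integralZ ?chain_kernel_ge0//.
- by apply: eq_pos_integral => l _ _ /=; rewrite EFinM muleA.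
- apply: (@mseq_post _ _ n _ _ _ _ _ _ (fun _ l =>
    (chain y l, F (last y l) (y :: l))) (fun p => p.1%:E * p.2)%E); last by measurability.
  apply: mseq_pair; first exact: (mseq_chain n (x := cst y)).
  apply: (@mseq_last n _ R _ _ (fun _ z l => F z (y :: l)) (cst y)) => //.
  have mp : measurable_fun setT (fun h : R * R => (h.2, y)) by measurability.
  exact: (mseq_comp (f := fun p l => F p.1 (p.2 :: l)) mF mp).
- by move=> l; rewrite mule_ge0// lee_fin chain_ge0.
Qed.

(** There is a factor [x] but none for the endpoint, so that [a = 0] keeps a nonzero weight through
    the extended kernel. *)
Definition end_kernel (a x : R) : R :=
  if 0 < x then x * bessel_kernel r a x else 0.

Lemma end_kernel_ge0 a x : 0 <= a -> 0 <= end_kernel a x.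
Proof.
move=> a0; rewrite /end_kernel; case: ifP => // x0.
by rewrite mulr_ge0 ?bessel_kernel_ge0// ltW.
Qed.

Lemma measurable_end_kernel a : measurable_fun setT (end_kernel a).
Proof.
apply: measurable_fun_ifT.
- by apply: measurable_fun_ltr; [exact: measurable_cst|exact: measurable_id].
- apply: measurable_funM; first exact: measurable_id.
  apply: continuous_measurable_fun => x.
  have ca : {for x, continuous (fun x : R => (a, x))}.
    have c1 : a @[_ --> x] --> a by exact: cvg_cst.
    have c2 : y @[y --> x] --> x by exact: cvg_id.
    exact: (cvg_pair c1 c2).
  exact: (continuous_comp ca (bessel_kernel_continuous r0 (x := (a, x)))).
- exact: measurable_cst.
Qed.

Definition skel_density (a b : R) (l : seq R) : R :=
  if l is x :: l' then
    end_kernel a x * (chain x l' * end_kernel b (last x l'))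
  else 0.

Lemma skel_density_ge0 a b l : 0 <= a -> 0 <= b -> 0 <= skel_density a b l.
Proof.
move=> a0 b0; case: l => [//|x l] /=.
by rewrite !mulr_ge0 ?end_kernel_ge0 ?chain_ge0.
Qed.

Lemma mseq_skel_density n (a b : R) :
  mseq n.+1 (fun (_ : R) l => skel_density a b l : R).
Proof.
rewrite /=.
apply: (@mseq_post _ _ n _ _ _ _ _ _ (fun (p : R * R) l =>
  (end_kernel a p.2, (chain p.2 l, end_kernel b (last p.2 l))))
  (fun p => p.1 * (p.2.1 * p.2.2))); last by measurability.
apply: mseq_pair.
  apply: mseq_head; exact: (measurableT_comp (measurable_end_kernel a) measurable_snd).
apply: mseq_pair; first by apply: (@mseq_chain n _ (R * R)%type snd).
apply: (@mseq_last n _ (R * R)%type _ _ (fun _ z _ => end_kernel b z) snd) => //.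
apply: mseq_head; exact: (measurableT_comp (measurable_end_kernel b) measurable_snd).
Qed.

Lemma chain_rev x l y : chain y (rcons (rev l) x) = chain x (rcons l y).
Proof.
elim: l x => [|z l IH] x /=; first by rewrite chain_kernelC.
by rewrite rev_cons chain_rcons last_rcons IH mulrC chain_kernelC.
Qed.

Lemma skel_density_rev a b l : skel_density b a (rev l) = skel_density a b l.
Proof.
case: l => [//|x l]; case/lastP: l => [|l y].
  by rewrite /rev /=; ring.
by rewrite rev_cons rev_rcons /= chain_rev !last_rcons; ring.
Qed.

(** Each square [y ^+ 2] of the density is shared between the two kernels around [y]; the leading
    [x] is the half of [x ^+ 2] left over by the kernel at the start. *)
Lemma kernel_prodE x l b : 0 < x -> all (fun y => 0 < y) l ->
  x * (\prod_(i < (size l).+1)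
    bessel_kernel r (x :: rcons l b)`_i (x :: rcons l b)`_i.+1) *
  \prod_(y <- l) y ^+ 2 = chain x l * end_kernel b (last x l).
Proof.
elim: l x => [|y l IH] x x0 /=.
  move=> _; rewrite big_ord_recl big_ord0 big_nil /= !mulr1 mul1r.
  by rewrite /end_kernel x0 bessel_kernelC.
move=> /andP[y0 l0]; rewrite big_ord_recl big_cons /= /chain_kernel x0 y0/=.
rewrite -[RHS]mulrA -IH//.
rewrite (eq_bigr (fun i : 'I_(size l).+1 => bessel_kernel r
  (y :: rcons l b)`_i (y :: rcons l b)`_i.+1))//.
set A := \prod_(i < _) _; set B := \prod_(j <- l) _.
rewrite /=; ring.
Qed.

Lemma bridge_densityE (t a b : R) n (s x : n.+1.-tuple R) :
  (forall i, (i < n.+2)%N ->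
    (0 :: rcons s t)`_i.+1 - (0 :: rcons s t)`_i = r) ->
  all (fun y => 0 < y) x ->
  bridge_density t a b s x = skel_density a b x / bessel_kernel t a b.
Proof.
move=> sr; case/tupleP: x => x l /= /andP[x0 l0].
rewrite {1}/end_kernel x0.
rewrite /bridge_density mulrAC; congr (_ / _).
rewrite (eq_bigr (fun i : 'I_n.+2 => bessel_kernel r
  (a :: x :: rcons l b)`_i (a :: x :: rcons l b)`_i.+1)); last first.
  by move=> i _; rewrite sr.
have -> : \prod_(i < n.+1) tnth [tuple of x :: l] i ^+ 2 =
    x ^+ 2 * \prod_(y <- l) y ^+ 2.
  by rewrite -(big_tuple _ _ [tuple of x :: l] xpredT (fun y => y ^+ 2)) big_cons.
rewrite big_ord_recl /=.
have := kernel_prodE b x0 l0; rewrite size_tuple => <-.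
rewrite (eq_bigr (fun i : 'I_n.+1 => bessel_kernel r
  (x :: rcons l b)`_i (x :: rcons l b)`_i.+1))//.
set A := \prod_(i < _) _; set B := \prod_(j <- l) _.
rewrite /=; ring.
Qed.

End density.

(** * Paths and grids *)

Section cpath_topology.
Context {R : realType}.

Lemma ball_continuous (U W : pseudoMetricType R) (f : U -> W) (C : R) : 0 < C ->
  (forall x y e, 0 < e -> ball x e y -> ball (f x) (C * e) (f y)) -> continuous f.
Proof.
move=> C0 fC x A /nbhs_ballP[e /= e0 eA]; apply/nbhs_ballP.
exists (e / C); rewrite /= ?divr_gt0// => y /fC; rewrite divr_gt0// => /(_ isT).
by rewrite mulrC divfK ?gt_eqF// => ?; exact: eA.
Qed.

Context {t : {posnum R}} {V : normedModType R}.

Lemma measurable_continuous_cpath (f : cpath t V -> R) : continuous f ->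
  measurable_fun setT f.
Proof.
move=> cf; apply: (measurability _ (RGenOInfty.measurableE R)) => //.
move=> _ [_ [a ->] <-]; rewrite setTI; apply: sub_sigma_algebra => /=.
by move/continuousP: cf; apply; exact: interval_open.
Qed.

Lemma measurable_continuous_cpath_cpath {V' : normedModType R}
    (f : cpath t V -> cpath t V') : continuous f -> measurable_fun setT f.
Proof.
move=> cf; apply: (measurability (@open (cpath t V'))) => //.
move=> _ [B oB <-]; rewrite setTI; apply: sub_sigma_algebra => /=.
by move/continuousP: cf; apply.
Qed.

Lemma lipschitz_continuous (f : cpath t V -> R) (C : R) :
  (forall (x y : cpath t V) (e : R), 0 <= e -> (forall s, `|x s - y s| <= e) ->
    `|f x - f y| <= C * e) ->
  continuous f.
Proof.
move=> fC.
have C0 : 0 < `|C| + 1 by rewrite ltr_wpDl.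
apply: (@ball_continuous (cpath t V) R f (`|C| + 1) C0) => x y e e0 /cpath_ballE xy.
rewrite -ball_normE /=; apply: (@le_lt_trans _ _ (`|C| * e)).
  apply: (le_trans (fC x y e (ltW e0) _)); first by move=> s; exact: ltW.
  by rewrite ler_pM2r// ler_norm.
by rewrite ltr_pM2r// ltrDl.
Qed.

Lemma lipschitz_continuous_cpath {V' : normedModType R}
    (f : cpath t V -> cpath t V') (C : R) :
  (forall (x y : cpath t V) (e : R), 0 <= e -> (forall s, `|x s - y s| <= e) ->
    forall s, `|f x s - f y s| <= C * e) ->
  continuous f.
Proof.
move=> fC.
have C0 : 0 < `|C| + 1 by rewrite ltr_wpDl.
apply: (@ball_continuous (cpath t V) (cpath t V') f (`|C| + 1) C0) => x y e e0 /cpath_ballE xy.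
apply/cpath_ballE => s; apply: (@le_lt_trans _ _ (`|C| * e)).
  apply: (le_trans (fC x y e (ltW e0) _ s)); first by move=> u; exact: ltW.
  by rewrite ler_pM2r// ler_norm.
by rewrite ltr_pM2r// ltrDl.
Qed.

End cpath_topology.

Section eval.
Context {R : realType} {t : {posnum R}}.

Lemma measurable_eval (s : timeI t) : measurable_fun setT (fun x : cpath t R => x s).
Proof.
apply: measurable_continuous_cpath; apply: (@lipschitz_continuous _ _ _ _ 1).
by move=> x y e e0 xy; rewrite mul1r.
Qed.

End eval.

Section grid.
Context {R : realType} (t : {posnum R}).

Definition mesh n : R := t%:num / n.+1%:R.

Lemma mesh_gt0 n : 0 < mesh n.
Proof. by rewrite divr_gt0. Qed.

Lemma grid_subproof n (i : 'I_n) : i.+1%:R * mesh n \in timeI t.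
Proof.
rewrite mem_set// /timeI/= in_itv/= mulr_ge0 ?ltW ?mesh_gt0//=.
by rewrite /mesh mulrCA -[X in _ < X]mulr1 ltr_pM2l// ltr_pdivrMr// mul1r ltr_nat ltnS.
Qed.

(* The [i]-th entry is [(i + 1) * mesh n]: the endpoints 0 and [t] are left out. *)
Definition grid n : n.-tuple (timeI t) :=
  [tuple exist (fun x => x \in timeI t) _ (grid_subproof i) | i < n].

Lemma grid_nth n i : (i < n.+2)%N ->
  (0 :: rcons [tuple \val (tnth (grid n) j) | j < n] t%:num)`_i = i%:R * mesh n.
Proof.
case: i => [|i]; first by rewrite mul0r.
rewrite ltnS /= nth_rcons size_map size_enum_ord => ni.
have [lin|] := ltnP i n.
  transitivity (\val (tnth (grid n) (Ordinal lin))); last by rewrite tnth_mktuple.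
  rewrite -[RHS](tnth_mktuple (fun j => \val (tnth (grid n) j)) (Ordinal lin)).
  by rewrite (tnth_nth 0).
rewrite leq_eqVlt => /predU1P[<-|]; last by rewrite ltnNge -ltnS ni.
by rewrite eqxx /mesh mulrC divfK.
Qed.

Lemma grid_sorted n :
  sorted <%R (0 :: rcons [tuple \val (tnth (grid n) j) | j < n] t%:num).
Proof.
apply/(sortedP 0) => i; rewrite [size _]/= size_rcons size_map size_enum_ord => ni.
rewrite !grid_nth//; last exact: ltnW.
by rewrite ltr_pM2r ?mesh_gt0// ltr_nat.
Qed.

Lemma grid_rev n i : time_rev (tnth (grid n) i) = tnth (grid n) (rev_ord i).
Proof.
apply/val_inj; rewrite /= !tnth_mktuple /=.
rewrite -[X in X - _](divfK (_ : n.+1%:R != 0 :> R))// -/(mesh n).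
rewrite mulrC -mulrBl -natrB ?ltnS 1?ltnW//; congr (_%:R * _).
by rewrite subSS -subSn.
Qed.

End grid.

(** * From finite-dimensional laws to expectations on the grid *)

Section layer_cake.
Context {R : realType}.
Notation mu := (@lebesgue_measure R).

Definition layer (u y : R) : R := if (0 < u) && (u <= y) then 1 else 0.

Lemma layer_ge0 u y : 0 <= layer u y.
Proof. by rewrite /layer; case: ifP. Qed.

Lemma layer_cake (y : R) : 0 <= y -> (\int[mu]_u (layer u y)%:E = y%:E)%E.
Proof.
move=> y0; rewrite (_ : (fun _ => _) = fun u => (\1_(`]0, y]%classic) u)%:E); last first.
  by apply/funext => u; rewrite indicE mem_setE in_itv/= /layer; case: ifP.
rewrite integral_indic// setIT.
have := @lebesgue_measure_itv R `]0, y]; rewrite /= lte_fin => ->.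
case: ltP => [_|y0'].
  by rewrite oppr0 adde0.
by congr EFin; lra.
Qed.

Lemma measurable_layer d (H : measurableType d) (a b : H -> R) :
  measurable_fun setT a -> measurable_fun setT b ->
  measurable_fun setT (fun h => layer (a h) (b h)).
Proof. by move=> ma mb; rewrite /layer; measurability. Qed.

End layer_cake.

Section expectation.
Context {R : realType} {t : {posnum R}} {d : measure_display}
  {T : measurableType d} (P : probability T R).
Notation mu := (@lebesgue_measure R).
Variables (a b : R) (X : T -> cpath t R).
Hypothesis a0 : 0 <= a.
Hypothesis b0 : 0 <= b.
Hypothesis mX : measurable_fun setT X.

Lemma eq_iter_integral n (f f' : n.-tuple R -> \bar R) :
  (forall x : n.-tuple R, all (fun y => 0 < y) x -> f x = f' x) ->
  iter_integral f = iter_integral f'.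
Proof.
elim: n f f' => [|n IH] f f' ff' /=; first exact: ff'.
apply: eq_integral => x; rewrite inE /= in_itv/= andbT => x0.
by apply: IH => y y0; apply: ff'; rewrite /= x0.
Qed.

Definition grid_values n (x : cpath t R) : seq R := map x (grid t n).

Lemma grid_valuesE n (x : cpath t R) :
  [tuple x (tnth (grid t n) i) | i < n] = grid_values n x :> seq R.
Proof.
by rewrite /grid_values -[X in map x X]map_tnth_enum -map_comp.
Qed.

Lemma measurable_grid_values n dU (U : measurableType dU) (psi : seq R -> U) :
  mseq n (fun _ : R => psi) -> measurable_fun setT (fun w => psi (grid_values n (X w))).
Proof.
move=> mpsi; have := mseq_tuple mpsi => m.
have ms : measurable_fun setT (fun w => [tuple X w (tnth (grid t n) i) | i < n]).
  apply/measurable_fun_tnthP => i.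
  rewrite (_ : _ \o _ = (fun x : cpath t R => x (tnth (grid t n) i)) \o X).
    by apply: measurableT_comp => //; exact: measurable_eval.
  by apply/funext => w /=; rewrite tnth_mktuple.
have := measurableT_comp m (measurable_fun_pair (measurable_cst (0 : R)) ms).
congr measurable_fun; apply/funext => w.
exact: congr1 (grid_valuesE n (X w)).
Qed.

(** The form in which the finite-dimensional laws are used: uniform grids and nonnegative functions
    instead of sets. It is stable under time reversal. A grid of [n.+1] points is nonempty, as
    [skel_density] requires. *)
Definition has_bridge_law : Prop :=
  forall n (psi : seq R -> R), mseq n.+1 (fun _ : R => psi) -> (forall l, 0 <= psi l) ->
  (\int[P]_w (psi (grid_values n.+1 (X w)))%:E =
   pos_integral n.+1 (fun l =>
     (psi l * (skel_density (mesh t n.+1) a b l / bessel_kernel t%:num a b))%:E))%E.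

Lemma has_bridge_law_fdd :
  (forall (n : nat) (s : n.-tuple (timeI t)) (A : set (n.-tuple R)),
    let s' := [tuple \val (tnth s i) | i < n] in
    sorted <%R (0 :: rcons s' t%:num) -> measurable A ->
    P [set w | A [tuple X w (tnth s i) | i < n]] =
    iter_integral (fun x => (\1_A x * bridge_density t%:num a b s' x)%:E)) ->
  has_bridge_law.
Proof.
move=> fdd n psi mpsi psi0.
set D := fun l => skel_density (mesh t n.+1) a b l / bessel_kernel t%:num a b.
have D0 l : 0 <= D l.
  rewrite divr_ge0 ?bessel_kernel_ge0//.
  by apply: skel_density_ge0 => //; exact: mesh_gt0.
have mpsiX := measurable_grid_values mpsi.
(* Layer cake: [psi] is decomposed into the indicators of its superlevel sets, to which [fdd]
   applies, and reassembled at the end. *)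
transitivity (\int[P]_w \int[mu]_u (layer u (psi (grid_values n.+1 (X w))))%:E)%E.
  by apply: eq_integral => w _; rewrite layer_cake.
transitivity (\int[mu]_u \int[P]_w (layer u (psi (grid_values n.+1 (X w))))%:E)%E.
  apply: (@fubini_tonelli _ _ T (measurableTypeR R) R P mu
    (fun p => (layer p.2 (psi (grid_values n.+1 (X p.1))))%:E)).
    apply/measurable_EFinP; apply: measurable_layer; first exact: measurable_snd.
    exact: (measurableT_comp mpsiX measurable_fst).
  by move=> p; rewrite lee_fin layer_ge0.
transitivity (\int[mu]_u pos_integral n.+1 (fun l => (layer u (psi l) * D l)%:E))%E.
  apply: eq_lebesgue => u.
  have [u0|u0] := ltP 0 u; last first.
    rewrite [LHS](_ : _ = \int[P]_w (cst 0 w))%E; last first.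
      by apply: eq_integral => w _; rewrite /layer ltNge u0.
    rewrite integral0; apply/esym.
    transitivity (@pos_integral R n.+1 (fun _ => (0%R)%:E * (0%R)%:E)%E).
      by apply: eq_pos_integral => l _ _; rewrite /layer ltNge u0/= !mul0r mul0e.
    by rewrite pos_integralZ ?mul0e//; apply: mseq_head; exact: measurable_cst.
  pose A := [set x : n.+1.-tuple R | u <= psi x].
  have mA : measurable A.
    have := mseq_tuple mpsi => m.
    have mt : measurable_fun setT (fun x : n.+1.-tuple R => psi x).
      exact: (measurableT_comp m (measurable_fun_pair (measurable_cst (0 : R)) (@measurable_id _ _ _))).
    have mle : measurable_fun setT (fun x : n.+1.-tuple R => u <= psi x).
      by apply: measurable_fun_ler => //; exact: measurable_cst.
    move: mle => /(_ measurableT [set true]); rewrite setTI; exact.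
  transitivity (P [set w | A [tuple X w (tnth (grid t n.+1) i) | i < n.+1]]).
    have -> : [set w | A [tuple X w (tnth (grid t n.+1) i) | i < n.+1]] =
        (fun w => u <= psi (grid_values n.+1 (X w))) @^-1` [set true].
      by apply/funext => w; rewrite /A /mkset grid_valuesE.
    rewrite -[X in P X]setIT -integral_indic//; last first.
      rewrite -[X in measurable X]setTI; apply: (measurable_fun_ler (measurable_cst u) mpsiX) => //.
    apply: eq_integral => w _; rewrite indicE /layer u0 /=.
    by case: ifPn => h; [rewrite mem_set|rewrite memNset//; apply/negP].
  rewrite (fdd _ _ _ (grid_sorted t n.+1) mA) -pos_integral_iter.
  apply: eq_iter_integral => x x0.
  rewrite (bridge_densityE (r := mesh t n.+1))//; last first.
    move=> i ni; rewrite !grid_nth//; last exact: ltnW.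
    by rewrite -natr1; ring.
  congr (_ * _)%:E; rewrite indicE /layer u0 /=.
  by rewrite /A; case: ifPn => h; [rewrite mem_set|rewrite memNset//; apply/negP].
etransitivity.
  apply/esym; apply: (@pos_integral_exchange R n.+1 (fun u l => (layer u (psi l) * D l)%:E)).
    apply: (@mseq_post _ _ n.+1 _ _ _ _ _ _ (fun (u : R) (l : seq R) =>
      (u, (psi l, skel_density (mesh t n.+1) a b l)))
      (fun p => (layer p.1 p.2.1 * (p.2.2 / bessel_kernel t%:num a b))%:E)).
      apply: mseq_pair; first by apply: mseq_head; exact: measurable_id.
      by apply: mseq_pair => //; apply: mseq_skel_density; exact: mesh_gt0.
    measurability; apply: measurable_layer; measurability.
  by move=> u l; rewrite lee_fin mulr_ge0// layer_ge0.
apply: eq_pos_integral => l _ _.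
rewrite [RHS]EFinM muleC -(layer_cake (psi0 l)) -lebesgueZ//.
- by apply: eq_lebesgue => u; rewrite -EFinM mulrC.
- by apply/measurable_EFinP; apply: measurable_layer; measurability.
- by move=> u; rewrite lee_fin layer_ge0.
- exact: D0.
Qed.

End expectation.

Section measurable_rows.
Context {R : realType}.

(** Converse of [mseq_tuple]: together they allow coordinatewise arguments on tuples inside the list
    inductions. *)
Lemma tuple_mseq {dE} {E : measurableType dE} n : forall d (H : measurableType d)
    dU (U : measurableType dU) (f : H -> seq E -> U),
  measurable_fun setT (fun p : H * n.-tuple E => f p.1 p.2) -> mseq n f.
Proof.
elim: n => [|n IH] d H dU U f mf /=.
  exact: (measurableT_comp mf (measurable_fun_pair (@measurable_id _ _ _)
    (measurable_cst [tuple]))).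
apply: IH.
have mp : measurable_fun setT (fun q : H * E * n.-tuple E =>
    (q.1.1, [the n.+1.-tuple E of q.1.2 :: q.2])).
  apply: measurable_fun_pair; first by measurability.
  by apply: measurable_cons; measurability.
exact: (measurableT_comp mf mp).
Qed.

Lemma mseq_nth {dE} {E : measurableType dE} {dE'} {E' : measurableType dE'}
    n k (x0 : E') d (H : measurableType d) dU (U : measurableType dU)
    (f : H -> seq E' -> U) (tr : H -> seq E -> seq E') :
  mseq k f -> (forall h l, size l = n -> size (tr h l) = k) ->
  (forall i, mseq n (fun h l => nth x0 (tr h l) i)) ->
  mseq n (fun h l => f h (tr h l)).
Proof.
move=> mf str mtr; apply: tuple_mseq.
have st (p : H * n.-tuple E) : size (tr p.1 p.2) == k.
  by rewrite str// size_tuple.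
have mp : measurable_fun setT (fun p : H * n.-tuple E => (p.1, Tuple (st p))).
  apply: measurable_fun_pair => //; apply/measurable_fun_tnthP => i.
  have := mseq_tuple (mtr i); congr measurable_fun; apply/funext => p /=.
  by rewrite (tnth_nth x0).
exact: (measurableT_comp (mseq_tuple mf) mp).
Qed.

Lemma mseq_future_min n : forall d (H : measurableType d) (x : H -> R),
  measurable_fun setT x -> mseq n (fun h (w : seq (R * R)) => future_min (x h) w : R).
Proof.
elim: n => [//|n IH] d H x mx /=.
have : mseq n (fun (p : H * (R * R)) w => Num.min p.2.1 (future_min p.2.2 w)).
  apply: (@mseq_post _ _ n _ _ _ _ _ _ (fun (p : H * (R * R)) w =>
    (p.2.1, future_min p.2.2 w)) (fun p => Num.min p.1 p.2)); last by measurability.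
  apply: mseq_pair; first by apply: mseq_head; measurability.
  by apply: (IH _ (H * (R * R))%type (fun p => p.2.2)); measurability.
by apply: eq_mseq => -[h [v x']] w.
Qed.

Lemma size_zigzag_rows (al be m x : R) w : size (zigzag_rows al be m x w) = (size w).+1.
Proof. by elim: w m x => [//|[v x'] w IH] m x /=; rewrite IH. Qed.

Lemma size_pitman_rows (al be c z : R) l : size (pitman_rows al be c z l) = (size l).+1.
Proof. by elim: l z => [//|[v x'] w IH] z /=; rewrite IH. Qed.

Lemma size_skeleton (x : R) ys : size (skeleton x ys) = size ys.
Proof. by elim: ys x => [//|y ys IH] x /=; rewrite IH. Qed.

Lemma mseq_zigzag_rows n i : forall d (H : measurableType d) (al be m x : H -> R),
  measurable_fun setT al -> measurable_fun setT be -> measurable_fun setT m ->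
  measurable_fun setT x ->
  mseq n (fun h w => nth (0 : R * R * R)
    (zigzag_rows (al h) (be h) (m h) (x h) w) i : (R * R * R)%type).
Proof.
have mrow k d (H : measurableType d) (al be m x : H -> R) :
  measurable_fun setT al -> measurable_fun setT be -> measurable_fun setT m ->
  measurable_fun setT x -> mseq k (fun h w =>
    zigzag_row (al h) (be h) (m h) (x h) (future_min (x h) w) : (R * R * R)%type).
  move=> mal mbe mm mx.
  apply: (@mseq_post _ _ k _ _ _ _ _ _ (fun h w =>
    ((al h, be h, m h, x h), future_min (x h) w))
    (fun p => zigzag_row p.1.1.1.1 p.1.1.1.2 p.1.1.2 p.1.2 p.2)).
    by apply: mseq_pair; [apply: mseq_head; measurability|exact: mseq_future_min].
  rewrite /zigzag_row; measurability; apply: measurableT_comp => //; measurability.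
elim: n i => [|n IH] i d H al be m x mal mbe mm mx.
  case: i => [|i] /=; first exact: (mrow 0%N).
  by rewrite nth_nil; exact: measurable_cst.
case: i => [|i] /=.
  exact: (mrow n.+1 _ _ al be m x).
have := IH i _ (H * (R * R))%type (fun p => al p.1) (fun p => be p.1)
  (fun p => Num.min (m p.1) p.2.1) (fun p => p.2.2).
have mal1 := measurableT_comp mal (@measurable_fst _ _ H (R * R)%type).
have mbe1 := measurableT_comp mbe (@measurable_fst _ _ H (R * R)%type).
have mm1 := measurableT_comp mm (@measurable_fst _ _ H (R * R)%type).
move=> /(_ mal1 mbe1); have mmin : measurable_fun setT
  (fun p : H * (R * R) => Num.min (m p.1) p.2.1).
  by apply: measurable_minr; [exact: mm1|measurability].
have m22 : measurable_fun setT (fun p : H * (R * R) => p.2.2) by measurability.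
by move=> /(_ mmin m22); apply: eq_mseq => -[h [v x']] w.
Qed.

Lemma mseq_pitman_rows n i : forall d (H : measurableType d) (al be c z : H -> R),
  measurable_fun setT al -> measurable_fun setT be -> measurable_fun setT c ->
  measurable_fun setT z ->
  mseq n (fun h w => nth (0 : R * R * R)
    (pitman_rows (al h) (be h) (c h) (z h) w) i : (R * R * R)%type).
Proof.
have mrow k d (H : measurableType d) (al be m x : H -> R) :
  measurable_fun setT al -> measurable_fun setT be -> measurable_fun setT m ->
  measurable_fun setT x -> mseq k (fun h w =>
    pitman_row (al h) (be h) (m h) (x h) (future_min (x h) w) : (R * R * R)%type).
  move=> mal mbe mm mx.
  apply: (@mseq_post _ _ k _ _ _ _ _ _ (fun h w =>
    ((al h, be h, m h, x h), future_min (x h) w))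
    (fun p => pitman_row p.1.1.1.1 p.1.1.1.2 p.1.1.2 p.1.2 p.2)).
    by apply: mseq_pair; [apply: mseq_head; measurability|exact: mseq_future_min].
  rewrite /pitman_row; measurability.
elim: n i => [|n IH] i d H al be c z mal mbe mc mz.
  case: i => [|i] /=; first exact: (mrow 0%N).
  by rewrite nth_nil; exact: measurable_cst.
case: i => [|i] /=.
  exact: (mrow n.+1 _ _ al be c z).
have mal1 := measurableT_comp mal (@measurable_fst _ _ H (R * R)%type).
have mbe1 := measurableT_comp mbe (@measurable_fst _ _ H (R * R)%type).
have mc1 := measurableT_comp mc (@measurable_fst _ _ H (R * R)%type).
have m22 : measurable_fun setT (fun p : H * (R * R) => p.2.2) by measurability.
have := IH i _ (H * (R * R))%type (fun p => al p.1) (fun p => be p.1)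
  (fun p => c p.1) (fun p => p.2.2) mal1 mbe1 mc1 m22.
by apply: eq_mseq => -[h [v x']] w.
Qed.

Lemma mseq_nth_seq {dE} {E : measurableType dE} (e0 : E) n i :
  forall d (H : measurableType d) , mseq n (fun (_ : H) (l : seq E) => nth e0 l i : E).
Proof.
elim: n i => [|n IH] i d H; first by rewrite /= nth_nil; exact: measurable_cst.
case: i => [|i] /=; first by apply: mseq_head; measurability.
exact: (IH i _ (H * E)%type).
Qed.

Lemma mseq_skeleton n : forall d (H : measurableType d)
    dU (U : measurableType dU) (f : H -> seq (R * R) -> U) (x : H -> R),
  mseq n f -> measurable_fun setT x ->
  mseq n (fun h ys => f h (skeleton (x h) ys)).
Proof.
elim: n => [//|n IH] d H dU U f x /= mf mx.
have mx1 := measurableT_comp mx (@measurable_fst _ _ H R).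
have mp : measurable_fun setT (fun p : H * R => (p.1, (Num.min (x p.1) p.2, p.2))).
  by measurability; exact: mx1.
apply: (IH _ (H * R)%type _ _ (fun p l => f p.1 ((Num.min (x p.1) p.2, p.2) :: l)) snd) => //.
exact: (mseq_comp (f := fun p l => f p.1 (p.2 :: l)) mf mp).
Qed.

Lemma mseq_map_snd n : forall d (H : measurableType d)
    dU (U : measurableType dU) (f : H -> seq R -> U),
  mseq n f -> mseq n (fun h (w : seq (R * R)) => f h (map snd w)).
Proof.
elim: n => [//|n IH] d H dU U f /= mf.
apply: (IH _ (H * (R * R))%type _ _ (fun p l => f p.1 (p.2.2 :: l))).
have mp : measurable_fun setT (fun p : H * (R * R) => (p.1, p.2.2)) by measurability.
exact: (mseq_comp (f := fun p l => f p.1 (p.2 :: l)) mf mp).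
Qed.

End measurable_rows.

(** * The cost of forgetting the valleys *)

Section estimate.
Context {R : realType} (r : R).
Hypothesis r0 : 0 < r.
Notation mu := (@lebesgue_measure R).
Notation g := (gauss_slope r).
Let g0 := gauss_slope_ge0 r0.
Let mg := measurable_gauss_slope r.

Lemma mseq_subst {dE} {E : measurableType dE} n d (H : measurableType d)
    dU (U : measurableType dU) dV (V : measurableType dV)
    (G : H -> U -> seq E -> V) (c : H -> seq E -> U) :
  mseq n (fun p : H * U => G p.1 p.2) -> mseq n c ->
  mseq n (fun h l => G h (c h l) l).
Proof.
move=> mG mc; apply: tuple_mseq.
have mp : measurable_fun setT (fun p : H * n.-tuple E => ((p.1, c p.1 p.2), p.2)).
  apply: measurable_fun_pair; last exact: measurable_snd.
  by apply: measurable_fun_pair; [exact: measurable_fst|exact: mseq_tuple].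
exact: (measurableT_comp (mseq_tuple mG) mp).
Qed.

(* Integral over all zigzags, with free endpoints. *)
Definition pathint n (F : R -> R -> seq (R * R) -> R) : \bar R :=
  (\int[mu]_al zigint g n.+1 al (fun be w => (F al be w)%:E))%E.

Definition mpathint n (F : R -> R -> seq (R * R) -> R) :=
  mseq n.+1 (fun p : R * R => F p.1 p.2 : seq (R * R) -> R).

Lemma mpathint_EFin n F : mpathint n F -> mseq n.+1 (fun (p : R * R) w => (F p.1 p.2 w)%:E).
Proof. by move=> mF; apply: (mseq_post mF); exact: EFin_measurable. Qed.

Lemma mpathint_EFin1 n F al : mpathint n F -> mseq n.+1 (fun be w => (F al be w)%:E).
Proof.
move=> /mpathint_EFin mF.
have mp : measurable_fun setT (fun be : R => (al, be)) by measurability.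
exact: (mseq_comp (n := n.+1) mF mp).
Qed.

Lemma measurable_pathint n F : mpathint n F -> (forall al be w, 0 <= F al be w) ->
  measurable_fun setT (fun al => zigint g n.+1 al (fun be w => (F al be w)%:E)).
Proof.
move=> mF F0; apply: (measurable_zigint g0 mg (f := fun al be w => (F al be w)%:E)) => //.
exact: mpathint_EFin.
Qed.

Lemma pathint_ge0 n F : (forall al be w, 0 <= F al be w) -> (0 <= pathint n F)%E.
Proof.
by move=> F0; apply: lebesgue_ge0 => al; apply: zigint_ge0 => // be w; rewrite lee_fin.
Qed.

Lemma pathintD n F F' : mpathint n F -> (forall al be w, 0 <= F al be w) ->
  mpathint n F' -> (forall al be w, 0 <= F' al be w) ->
  pathint n (fun al be w => F al be w + F' al be w) = (pathint n F + pathint n F')%E.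
Proof.
move=> mF F0 mF' F'0; rewrite /pathint -lebesgueD; last 4 first.
- exact: measurable_pathint.
- by move=> al; apply: zigint_ge0 => // be w; rewrite lee_fin.
- exact: measurable_pathint.
- by move=> al; apply: zigint_ge0 => // be w; rewrite lee_fin.
apply: eq_lebesgue => al.
rewrite -(zigintD g0 mg al (f := fun be w => (F al be w)%:E)
  (f' := fun be w => (F' al be w)%:E))//;
  try exact: mpathint_EFin1; by move=> ? ?; rewrite lee_fin.
Qed.

Lemma pathintZ n F k : 0 <= k -> mpathint n F -> (forall al be w, 0 <= F al be w) ->
  pathint n (fun al be w => k * F al be w) = (k%:E * pathint n F)%E.
Proof.
move=> k0 mF F0; rewrite /pathint -lebesgueZ//; last 2 first.
- exact: measurable_pathint.
- by move=> al; apply: zigint_ge0 => // be w; rewrite lee_fin.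
apply: eq_lebesgue => al.
rewrite -(zigintZ g0 mg al (f := fun be w => (F al be w)%:E))//;
  try exact: mpathint_EFin1; by move=> ? ?; rewrite lee_fin.
Qed.

Lemma le_pathint n F F' : mpathint n F -> (forall al be w, 0 <= F al be w) ->
  mpathint n F' -> (forall al be w, 0 <= F' al be w) ->
  (forall al be w, zigzag al be w -> F al be w <= F' al be w) ->
  (pathint n F <= pathint n F')%E.
Proof.
move=> mF F0 mF' F'0 FF'; apply: le_lebesgue.
- exact: measurable_pathint.
- by move=> al; apply: zigint_ge0 => // be w; rewrite lee_fin.
- exact: measurable_pathint.
move=> al; apply: (le_zigint_zigzag g0 mg).
- exact: mpathint_EFin1.
- by move=> y w; rewrite lee_fin.
- exact: mpathint_EFin1.
- by move=> y w; rewrite lee_fin.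
- by move=> y w _ zw; rewrite lee_fin FF'.
Qed.

Lemma eq_pathint n F F' :
  (forall al be w, size w = n.+1 -> zigzag al be w -> F al be w = F' al be w) ->
  pathint n F = pathint n F'.
Proof.
move=> FF'; apply: eq_lebesgue => al; apply: eq_zigint_zigzag => y w sw zw.
by rewrite FF'.
Qed.

Definition end_weight (a b al be : R) : R := end_kernel r a al * end_kernel r b be.

Section weights.
Variables (a b : R).
Hypotheses (a0 : 0 <= a) (b0 : 0 <= b).

Lemma end_weight_ge0 al be : 0 <= end_weight a b al be.
Proof. by rewrite mulr_ge0// end_kernel_ge0. Qed.

Lemma end_weightC al be : end_weight a b al be = end_weight b a be al.
Proof. by rewrite /end_weight mulrC. Qed.

Lemma measurable_end_weight d (H : measurableType d) (x y : H -> R) :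
  measurable_fun setT x -> measurable_fun setT y ->
  measurable_fun setT (fun h => end_weight a b (x h) (y h)).
Proof.
move=> mx my; apply: measurable_funM.
  exact: (measurableT_comp (measurable_end_kernel r0 a) mx).
exact: (measurableT_comp (measurable_end_kernel r0 b) my).
Qed.

Lemma mpathint_end_weight n (F : R -> R -> seq (R * R) -> R) : mpathint n F ->
  mpathint n (fun al be w => end_weight a b al be * F al be w).
Proof.
move=> mF.
apply: (@mseq_post _ _ n.+1 _ _ _ _ _ _ (fun (p : R * R) w =>
  (end_weight a b p.1 p.2, F p.1 p.2 w)) (fun p => p.1 * p.2)); last by measurability.
by apply: mseq_pair => //; apply: mseq_head; apply: measurable_end_weight; measurability.
Qed.

Lemma mpathint_endw1 n : mpathint n (fun al be w => end_weight a b al be).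
Proof. by apply: mseq_head; apply: measurable_end_weight; measurability. Qed.

Lemma pathint_deep n (e : R) : 0 <= e ->
  (pathint n (fun al be w => end_weight a b al be * deep_valleys e al w)%R <=
   (n.+1%:R * expR (- (2 * e ^+ 2 / r)))%:E * pathint n (fun al be w => end_weight a b al be))%E.
Proof.
move=> e0; set k := n.+1%:R * _.
have k0 : 0 <= k by rewrite mulr_ge0// expR_ge0.
have mw := @mpathint_endw1 n.
have E := pathintZ k0 mw (fun al be _ => end_weight_ge0 al be).
apply: (@le_trans _ _ (pathint n (fun al be w => k * end_weight a b al be))); last by rewrite E.
have mdeep : mpathint n (fun al be w => deep_valleys e al w).
  by apply: (@mseq_deep_valleys _ e n.+1 _ (R * R)%type fst); measurability.
apply: le_lebesgue.
- apply: measurable_pathint; first exact: mpathint_end_weight.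
  by move=> al be w; rewrite mulr_ge0 ?end_weight_ge0// deep_valleys_ge0.
- move=> al; apply: zigint_ge0 => // be w.
  by rewrite lee_fin mulr_ge0 ?end_weight_ge0// deep_valleys_ge0.
- apply: measurable_pathint; last by move=> al be w; rewrite mulr_ge0// end_weight_ge0.
  apply: (mseq_post mw (g := fun x => k * x)); measurability.
move=> al; have h := zigint_deep_valleys g0 mg (expR_ge0 _) (fun x y => zig_gauss_deep r0 x y e0)
  n.+1 al (h := fun be => (end_weight a b al be)%:E).
apply: (@le_trans _ _ (zigint g n.+1 al (fun be w =>
    (deep_valleys e al w)%:E * (end_weight a b al be)%:E)%E)).
  by rewrite (@eq_zigint _ g n.+1 al _ (fun be w =>
    (deep_valleys e al w)%:E * (end_weight a b al be)%:E)%E)//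
    => be w _; rewrite -EFinM mulrC.
apply: (le_trans (h _ _)).
- by apply/measurable_EFinP; apply: measurable_end_weight; measurability.
- by move=> y; rewrite lee_fin end_weight_ge0.
rewrite -zigintZ//; first exact: (mpathint_EFin1 al mw).
by move=> be w; rewrite lee_fin end_weight_ge0.
Qed.

Lemma lee_combine (x y z : \bar R) (k c : R) : 0 <= k -> 0 <= c -> (0 <= y)%E ->
  (z <= c%:E * y -> x + k%:E * y + z <= x + (k + c)%:E * y)%E.
Proof.
move=> k0 c0 y0 zy; rewrite EFinD ge0_muleDl ?lee_fin// addeA.
exact: leeD2l.
Qed.

(** Designed for [A] bounded by 1: without deep valleys [A] and [B] differ by at most [k], and
    otherwise the count is at least 1 and absorbs [A]. *)
Lemma pathint_perturb n (e k : R) (A B : R -> R -> seq (R * R) -> R) : 0 <= e -> 0 <= k ->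
  mpathint n A -> (forall al be w, 0 <= A al be w) ->
  mpathint n B -> (forall al be w, 0 <= B al be w) ->
  (forall al be w, zigzag al be w -> A al be w <= B al be w + k + deep_valleys e al w) ->
  (pathint n (fun al be w => end_weight a b al be * A al be w)%R <=
   pathint n (fun al be w => end_weight a b al be * B al be w)%R +
   (k + n.+1%:R * expR (- (2 * e ^+ 2 / r)))%:E * pathint n (fun al be w => end_weight a b al be))%E.
Proof.
move=> e0 k0 mA A0 mB B0 AB.
have mdeep : mpathint n (fun al be w => deep_valleys e al w).
  by apply: (@mseq_deep_valleys _ e n.+1 _ (R * R)%type fst); measurability.
have w0 := end_weight_ge0; have mw := @mpathint_endw1 n.
have mkw : mpathint n (fun al be _ => k * end_weight a b al be).
  by apply: (mseq_post mw (g := fun x => k * x)); measurability.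
have mBw := mpathint_end_weight mB; have mdw := mpathint_end_weight mdeep.
have mBk : mpathint n (fun al be w => end_weight a b al be * B al be w + k * end_weight a b al be).
  apply: (@mseq_post _ _ n.+1 _ _ _ _ _ _ (fun (p : R * R) w =>
    (end_weight a b p.1 p.2 * B p.1 p.2 w, k * end_weight a b p.1 p.2)) (fun p => p.1 + p.2));
    last by measurability.
  exact: mseq_pair.
have d0 e' x w := @deep_valleys_ge0 R e' x w.
have mAll : mpathint n (fun al be w => end_weight a b al be * B al be w + k * end_weight a b al be +
    end_weight a b al be * deep_valleys e al w).
  apply: (@mseq_post _ _ n.+1 _ _ _ _ _ _ (fun (p : R * R) w =>
    (end_weight a b p.1 p.2 * B p.1 p.2 w + k * end_weight a b p.1 p.2,
     end_weight a b p.1 p.2 * deep_valleys e p.1 w)) (fun p => p.1 + p.2)); last by measurability.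
  exact: mseq_pair.
apply: (@le_trans _ _ (pathint n (fun al be w => end_weight a b al be * B al be w +
    k * end_weight a b al be + end_weight a b al be * deep_valleys e al w))).
  apply: le_pathint => //.
  - exact: mpathint_end_weight.
  - by move=> al be w; rewrite mulr_ge0.
  - by move=> al be w; apply: addr_ge0; [apply: addr_ge0|]; rewrite mulr_ge0.
  - move=> al be w zw; rewrite (mulrC k) -!mulrDr; exact: ler_wpM2l (AB _ _ _ zw).
rewrite pathintD//; last 2 first.
- by move=> al be w; apply: addr_ge0; rewrite mulr_ge0.
- by move=> al be w; rewrite mulr_ge0.
rewrite pathintD//; last 2 first.
- by move=> al be w; rewrite mulr_ge0.
- by move=> al be w; rewrite mulr_ge0.
have -> := pathintZ k0 mw (fun al be _ => end_weight_ge0 al be).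
apply: lee_combine => //.
  by apply: pathint_ge0 => al be w; exact: end_weight_ge0.
exact: pathint_deep.
Qed.

End weights.
End estimate.

(** * Comparison of the two bridges at fixed mesh *)

Section compare.
Context {R : realType}.
Notation mu := (@lebesgue_measure R).
Notation V3 := (R * R * R)%type.

Definition skel_rows (l : seq R) : seq V3 :=
  if l is x :: ys then zigzag_rows x (last x ys) x x (skeleton x ys) else [::].

Definition lip_seq (L : R) (Phi : seq V3 -> R) := forall v v' e, 0 <= e ->
  size v = size v' -> (forall i, `|v`_i - v'`_i| <= e) -> Phi v <= Phi v' + L * e.

Lemma swap3K : involutive (@swap3 R).
Proof. by case=> [[x y] z]. Qed.

Lemma measurable_swap3 : measurable_fun setT (@swap3 R).
Proof. by rewrite /swap3; measurability. Qed.

Lemma mseq_swap n (Phi : seq V3 -> R) : mseq n (fun _ : R => Phi) ->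
  mseq n (fun _ : R => Phi \o map (@swap3 R)).
Proof.
move=> mPhi.
apply: (mseq_nth (x0 := 0 : V3) (f := fun _ => Phi) (tr := fun _ => map (@swap3 R)) mPhi).
  by move=> h l; rewrite size_map.
move=> i; have := mseq_post (mseq_nth_seq (0 : V3) n i R) measurable_swap3.
apply: eq_mseq => h l.
have [il|li] := ltnP i (size l); first by rewrite (nth_map 0).
by rewrite !nth_default ?size_map.
Qed.

Lemma lip_seq_swap L Phi : lip_seq L Phi -> lip_seq L (Phi \o map (@swap3 R)).
Proof.
move=> lPhi v v' e e0 sv vv' /=; apply: lPhi => //; first by rewrite !size_map.
move=> i; have := vv' i.
have sw (l : seq V3) : (map (@swap3 R) l)`_i = swap3 l`_i.
  have [il|li] := ltnP i (size l); first by rewrite (nth_map 0).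
  by rewrite !nth_default ?size_map.
rewrite !sw; case: (v`_i) => [[x y] z]; case: (v'`_i) => [[x' y'] z'].
by rewrite !prod_normE /= !ge_max => /andP[/andP[-> ->] ->].
Qed.

Section pathint_rows.
Variables (r a b : R) (n : nat) (Phi : seq V3 -> R).
Hypotheses (r0 : 0 < r) (a0 : 0 <= a) (b0 : 0 <= b).
Hypothesis mPhi : mseq n.+2 (fun _ : R => Phi).
Hypothesis Phi0 : forall v, 0 <= Phi v.

Definition pathint_rows (a b : R) Psi := pathint r n (fun al be w =>
  end_weight r a b al be * Psi (zigzag_rows al be al al w)).

Lemma mpathint_rows : mpathint n (fun al be w => Phi (zigzag_rows al be al al w)).
Proof.
have mP : mseq n.+2 (fun _ : R * R => Phi) := mseq_comp mPhi (measurable_cst (0 : R)).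
apply: (mseq_nth (x0 := 0 : V3) mP (tr := fun p => zigzag_rows p.1 p.2 p.1 p.1)).
  by move=> h l sl; rewrite size_zigzag_rows sl.
by move=> i; apply: (@mseq_zigzag_rows _ n.+1 i _ (R * R)%type fst snd fst fst); measurability.
Qed.

Lemma mseq_skel_rows d (H : measurableType d) (x : H -> R) :
  measurable_fun setT x -> mseq n.+1 (fun h ys => Phi (skel_rows (x h :: ys))).
Proof.
move=> mx.
have mx1 := measurableT_comp mx (@measurable_fst _ _ H R).
apply: (@mseq_last _ n.+1 _ H _ R (fun h z ys =>
  Phi (zigzag_rows (x h) z (x h) (x h) (skeleton (x h) ys))) x) => //.
apply: (@mseq_skeleton _ n.+1 _ (H * R)%type _ R (fun q w =>
  Phi (zigzag_rows (x q.1) q.2 (x q.1) (x q.1) w)) (fun q => x q.1)); last exact: mx1.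
have mP : mseq n.+2 (fun _ : H * R => Phi) := mseq_comp mPhi (measurable_cst (0 : R)).
apply: (@mseq_nth _ _ _ _ n.+1 n.+2 (0 : V3) _ (H * R)%type _ R (fun _ => Phi)
    (fun q => zigzag_rows (x q.1) q.2 (x q.1) (x q.1)) mP).
  by move=> h l sl; rewrite size_zigzag_rows sl.
by move=> i; apply: (@mseq_zigzag_rows _ n.+1 i _ (H * R)%type
  (fun q => x q.1) snd (fun q => x q.1) (fun q => x q.1)).
Qed.

Lemma mpathint_skel_rows : mpathint n (fun al be w => Phi (skel_rows (al :: map snd w))).
Proof.
apply: (@mseq_map_snd _ n.+1 _ (R * R)%type _ R (fun p ys => Phi (skel_rows (p.1 :: ys)))).
exact: mseq_skel_rows.
Qed.

(** The theorem for zigzags. Rows are functions of the transform and the endpoints, so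
    [bridge_integral_sym] may exchange [al] and [be]; this swaps the outer coordinates of every row
    and the roles of [a] and [b] in the weight. *)
Lemma pathint_rows_sym : pathint_rows a b Phi = pathint_rows b a (Phi \o map (@swap3 R)).
Proof.
pose f al be (l : seq (R * R)) := (end_weight r a b al be * Phi (pitman_rows al be
    ((al + be - last 0 (map snd l)) / 2) 0 l))%:E.
have f0 al be l : (0 <= f al be l)%E by rewrite lee_fin mulr_ge0// end_weight_ge0.
have mf : mseq n.+1 (fun p : R * R => f p.1 p.2).
  apply: (@mseq_post _ _ n.+1 _ _ _ _ _ _ (fun (p : R * R) (l : seq (R * R)) =>
    (end_weight r a b p.1 p.2, Phi (pitman_rows p.1 p.2
    ((p.1 + p.2 - last 0 (map snd l)) / 2) 0 l))) (fun p => (p.1 * p.2)%:E));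
    last by measurability.
  apply: mseq_pair; first by apply: mseq_head; apply: measurable_end_weight; measurability.
  apply: (@mseq_subst _ _ n.+1 _ (R * R)%type _ R _ R (fun (p : R * R) z (l : seq (R * R)) =>
    Phi (pitman_rows p.1 p.2 ((p.1 + p.2 - z) / 2) 0 l)) (fun _ (l : seq (R * R)) => last 0 (map snd l))); last first.
    apply: (mseq_map_snd (f := fun (_ : R * R) ys => last 0 ys)).
    apply: (mseq_last (G := fun (_ : R * R) z _ => z) (x := cst 0)); last exact: measurable_cst.
    by apply: mseq_head; measurability.
  have mP : mseq n.+2 (fun _ : R * R * R => Phi) := mseq_comp mPhi (measurable_cst (0 : R)).
  apply: (@mseq_nth _ _ _ _ n.+1 n.+2 (0 : V3) _ (R * R * R)%type _ R (fun _ => Phi)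
    (fun p => pitman_rows p.1.1 p.1.2 ((p.1.1 + p.1.2 - p.2) / 2) 0) mP).
    by move=> h l sl; rewrite size_pitman_rows sl.
  by move=> i; apply: (@mseq_pitman_rows _ n.+1 i _ (R * R * R)%type
    (fun p => p.1.1) (fun p => p.1.2) (fun p => (p.1.1 + p.1.2 - p.2) / 2) (cst 0));
    measurability.
transitivity (bridge_integral (gauss_slope r) n f).
  apply: eq_lebesgue => al; apply: eq_zigint_zigzag => be w _ zw.
  by rewrite /f pitman_rows_zigzag.
etransitivity.
  exact: (bridge_integral_sym (gauss_slope_ge0 r0) (measurable_gauss_slope r) mf f0).
apply: eq_lebesgue => al; apply: eq_zigint_zigzag => be w _ zw.
rewrite /f /= end_weightC pitman_rows_swap (addrC be) pitman_rows_zigzag//.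
Qed.

Lemma pathint_rows_perturb L e : 0 <= e -> 0 <= L -> (forall v, Phi v <= 1) -> lip_seq L Phi ->
  let K := (L * (4 * e) + n.+1%:R * expR (- (2 * e ^+ 2 / r)))%:E in
  let mass := pathint r n (fun al be w => end_weight r a b al be) in
  let S := pathint r n (fun al be w => end_weight r a b al be * Phi (skel_rows (al :: map snd w))) in
  (pathint_rows a b Phi <= S + K * mass)%E /\ (S <= pathint_rows a b Phi + K * mass)%E.
Proof.
move=> e0 L0 Phi1 lPhi K mass S.
have k0 : 0 <= L * (4 * e) by rewrite !mulr_ge0.
have e4 : 0 <= 4 * e by rewrite mulr_ge0.
have last_zigint (al be : R) (w : seq (R * R)) : zigzag al be w -> last al (map snd w) = be.
  by elim: w al => [al /eqP //|[v x'] w IH] al /= /and4P[_ _ _]; exact: IH.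
have sz (al be : R) (w : seq (R * R)) : size (zigzag_rows al be al al w) =
    size (zigzag_rows al be al al (skeleton al (map snd w))).
  by rewrite !size_zigzag_rows size_skeleton size_map.
have close (al be : R) (w : seq (R * R)) : zigzag al be w -> deep_valleys e al w < 1 -> forall i,
  `|(zigzag_rows al be al al w)`_i -
    (zigzag_rows al be al al (skeleton al (map snd w)))`_i| <= 4 * e.
  by move=> zw dw i; apply: (@zigzag_rows_skeleton _ al be e al al al be w i e0 zw dw);
    rewrite subrr normr0.
split; apply: (pathint_perturb r0 a0 b0 e0 k0) => //; try exact: mpathint_rows;
  try exact: mpathint_skel_rows; move=> al be w zw /=; rewrite (last_zigint _ _ _ zw).
(* Without a deep valley the rows are within [4 * e]; otherwise
   [Phi <= 1 <= deep_valleys e al w]. *)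
- have [dw|dw] := ltP (deep_valleys e al w) 1.
    rewrite -[leLHS]addr0 lerD ?deep_valleys_ge0//; apply: lPhi => //; exact: close.
  apply: (le_trans (Phi1 _)); apply: (le_trans dw).
  by rewrite lerDr addr_ge0.
- have [dw|dw] := ltP (deep_valleys e al w) 1.
    rewrite -[leLHS]addr0 lerD ?deep_valleys_ge0//; apply: lPhi => // i.
    by rewrite distrC; exact: close.
  apply: (le_trans (Phi1 _)); apply: (le_trans dw).
  by rewrite lerDr addr_ge0.
Qed.

End pathint_rows.

Section bridge_law.
Context {t : {posnum R}} {d : measure_display} {T : measurableType d}
  (P : probability T R).

(** Puts the valleys back: [psi] ignores them, so its expectation is an integral over zigzags. The
    [n.+2] grid values are the start [al] and the peaks of [n.+1] moves. *)
Lemma bridge_law_pathint a b (X : T -> cpath t R) n (psi : seq R -> R) :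
  0 <= a -> 0 <= b -> has_bridge_law P a b X ->
  mseq n.+2 (fun _ : R => psi) -> (forall l, 0 <= psi l) ->
  (\int[P]_w (psi (grid_values n.+2 (X w)))%:E =
   (bessel_kernel t%:num a b)^-1%:E * pathint (mesh t n.+2) n (fun al be w =>
     end_weight (mesh t n.+2) a b al be * psi (al :: map snd w))%R)%E.
Proof.
move=> a0 b0 law mpsi psi0; rewrite law//.
have r0 := mesh_gt0 t n.+2; set r := mesh t n.+2.
set c := (bessel_kernel t%:num a b)^-1.
have c0 : 0 <= c by rewrite invr_ge0 bessel_kernel_ge0.
have mpsi1 d' (H : measurableType d') (x : H -> R) : measurable_fun setT x ->
    mseq n.+1 (fun h l => psi (x h :: l)).
  move=> mx; have mp : measurable_fun setT (fun h : H => (0 : R, x h)) by measurability.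
  exact: (mseq_comp (n := n.+1) (f := fun p l => psi (p.2 :: l)) mpsi mp).
have mF : mpathint n (fun al be w => end_weight r a b al be * psi (al :: map snd w)).
  apply: mpathint_end_weight => //.
  apply: (@mseq_map_snd _ n.+1 _ (R * R)%type _ R (fun p ys => psi (p.1 :: ys))).
  exact: mpsi1.
have <- := pathintZ r0 c0 mF (fun al be w => mulr_ge0 (end_weight_ge0 r0 a0 b0 al be) (psi0 _)).
apply: eq_lebesgue => al.
pose F be ys := (c * (end_weight r a b al be * psi (al :: ys)))%:E.
have F0 be ys : (0 <= F be ys)%E.
  by rewrite lee_fin !mulr_ge0// end_kernel_ge0.
transitivity (skel_integral (gauss_slope r) n.+1 al F); last first.
  by rewrite -zigint_snd//; [exact: gauss_slope_ge0|exact: measurable_gauss_slope].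
have mF1 : mseq n.+1 F.
  apply: (@mseq_post _ _ n.+1 _ _ _ _ _ _ (fun (be : R) (l : seq R) =>
    (end_weight r a b al be, psi (al :: l))) (fun p => (c * (p.1 * p.2))%:E)); last by measurability.
  apply: mseq_pair; last exact: (mpsi1 _ _ (cst al)).
  by apply: mseq_head; apply: measurable_end_weight => //; measurability.
transitivity ((pos_ind al)%:E * pos_integral n.+1 (fun l => (psi (al :: l) *
  (skel_density r a b (al :: l) / bessel_kernel t%:num a b))%:E))%E; first by [].
have [al0|al0] := ltP 0 al.
  have -> : pos_ind al = 1 by rewrite /pos_ind al0.
  rewrite mul1e -(pos_integral_chain r0 al0 mF1 F0).
  apply: eq_pos_integral => l _ _; rewrite /F -EFinM; congr EFin.
  by rewrite /= /end_weight -/c; ring.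
(* Both sides vanish for [al <= 0], the zigzag integral because [end_kernel] does. *)
have -> : pos_ind al = 0 by rewrite /pos_ind ltNge al0.
rewrite mul0e.
have F00 : F = fun be ys => 0%:E.
  by apply/funext => be; apply/funext => ys;
     rewrite /F /end_weight {1}/end_kernel ltNge al0 !mul0r mulr0.
rewrite F00 -(zigint_snd (gauss_slope_ge0 r0) (measurable_gauss_slope r))//.
transitivity (zigint (gauss_slope r) n.+1 al (fun _ _ => 0%:E * 0%:E)%E); last first.
  by apply: eq_zigint => y l _; rewrite mul0e.
rewrite zigintZ ?mul0e//.
- exact: gauss_slope_ge0.
- exact: measurable_gauss_slope.
- by apply: mseq_head; exact: measurable_cst.
Qed.

Lemma size_grid_values n (x : cpath t R) : size (grid_values n x) = n.
Proof. by rewrite size_map size_tuple. Qed.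

Lemma nth_grid_values n (x : cpath t R) (i : 'I_n) :
  (grid_values n x)`_i = x (tnth (grid t n) i).
Proof.
by rewrite (nth_map (time_start t)) ?size_tuple// -tnth_nth.
Qed.

Lemma grid_values_trev n (x : cpath t R) : grid_values n (trev x) = rev (grid_values n x).
Proof.
apply: (@eq_from_nth _ 0); rewrite ?size_rev ?size_grid_values// => i ni.
rewrite nth_rev ?size_grid_values//.
rewrite (nth_grid_values (trev x) (Ordinal ni)) -[(n - i.+1)%N]/(val (rev_ord (Ordinal ni))).
by rewrite nth_grid_values -grid_rev.
Qed.

(** Reversal maps the uniform grid to itself, and the kernels are symmetric, so reversing the list
    exchanges [a] and [b] in the density. *)
Lemma has_bridge_law_trev a b (X : T -> cpath t R) : 0 <= a -> 0 <= b ->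
  has_bridge_law P a b X -> has_bridge_law P b a (fun w => trev (X w)).
Proof.
move=> a0 b0 law n psi mpsi psi0.
have r0 := mesh_gt0 t n.+1.
transitivity (\int[P]_w (psi (rev (grid_values n.+1 (X w))))%:E)%E.
  by apply: eq_integral => w _; rewrite grid_values_trev.
etransitivity.
  apply: (law n (fun l => psi (rev l))); last by [].
  exact: (mseq_rev (n := n.+1) (f := fun _ : R => psi) mpsi).
transitivity (pos_integral n.+1 (fun l => (psi (rev l) *
  (skel_density (mesh t n.+1) b a (rev l) / bessel_kernel t%:num b a))%:E)); last first.
  apply: (@pos_integral_rev R n.+1 (fun l => (psi l *
    (skel_density (mesh t n.+1) b a l / bessel_kernel t%:num b a))%:E)).
    apply: (@mseq_post _ _ n.+1 _ _ _ _ _ _ (fun (_ : R) (l : seq R) =>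
      (psi l, skel_density (mesh t n.+1) b a l))
      (fun p => (p.1 * (p.2 / bessel_kernel t%:num b a))%:E)); last by measurability.
    by apply: mseq_pair => //; exact: mseq_skel_density.
  move=> l; rewrite lee_fin mulr_ge0// divr_ge0 ?bessel_kernel_ge0//.
  exact: skel_density_ge0.
by apply: eq_pos_integral => l _ _; rewrite skel_density_rev (bessel_kernelC _ b).
Qed.

Definition skel_expectation (X : T -> cpath t R) n (Phi : seq V3 -> R) : \bar R :=
  (\int[P]_w (Phi (skel_rows (grid_values n.+2 (X w))))%:E)%E.

Lemma le_combine_perturb (c K : R) (s s' x m m' : \bar R) : 0 <= c -> 0 <= K ->
  (0 <= s' -> c%:E * m = 1 -> c%:E * m' = 1 -> s <= x + K%:E * m -> x <= s' + K%:E * m' ->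
  c%:E * s <= c%:E * s' + (2 * K)%:E)%E.
Proof.
move=> c0 K0 s'0 cm cm' sx xs'.
(* The normalisation forces the masses to be nonnegative, which makes distributivity available in
   [\bar R]. *)
have ge0 (y : \bar R) : (c%:E * y = 1 -> 0 <= y)%E.
  case: y => [y|_|]; [|by rewrite le0y|]; last first.
    move: c0; rewrite le_eqVlt => /predU1P[<-|c0]; last by rewrite gt0_muleNy ?lte_fin.
    by rewrite mul0e => /eqP; rewrite eqe eq_sym oner_eq0.
  by rewrite lee_fin -EFinM => -[]; have [//|y0 h] := leP 0 y; nra.
apply: (@le_trans _ _ (c%:E * (s' + K%:E * m' + K%:E * m)))%E.
  by rewrite lee_wpmul2l ?lee_fin// (le_trans sx)// leeD2r.
have m0 := ge0 _ cm; have m'0 := ge0 _ cm'.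
rewrite !ge0_muleDr ?adde_ge0 ?mule_ge0 ?lee_fin//.
rewrite (muleCA c%:E K%:E m') (muleCA c%:E K%:E m) cm cm' !mule1 -addeA -EFinD.
by rewrite leeD2l// lee_fin; lra.
Qed.

(** From skeleton rows to zigzag rows for the first bridge, across [pathint_rows_sym], then back to
    skeleton rows for the second bridge; each of the two passages costs [K]. *)
Lemma skel_compare a b (X X' : T -> cpath t R) n (Phi : seq V3 -> R) L e K :
  0 <= a -> 0 <= b -> has_bridge_law P a b X -> has_bridge_law P b a X' ->
  mseq n.+2 (fun _ : R => Phi) -> (forall v, 0 <= Phi v) -> (forall v, Phi v <= 1) ->
  lip_seq L Phi -> 0 <= L -> 0 <= e ->
  K = L * (4 * e) + n.+1%:R * expR (- (2 * e ^+ 2 / mesh t n.+2)) ->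
  (skel_expectation X n Phi <= skel_expectation X' n (Phi \o map (@swap3 R)) + (2 * K)%:E)%E.
Proof.
move=> a0 b0 law law' mPhi Phi0 Phi1 lPhi L0 e0 KE.
have r0 := mesh_gt0 t n.+2.
pose c := (bessel_kernel t%:num a b)^-1.
have c0 : 0 <= c by rewrite invr_ge0 bessel_kernel_ge0.
have K0 : 0 <= K.
  rewrite KE; apply: addr_ge0; first by rewrite !mulr_ge0.
  by rewrite mulr_ge0// expR_ge0.
(* The case [psi = 1] of [bridge_law_pathint]. The same [c] normalises both bridges because the
   kernel is symmetric. *)
have mass_one (a' b' : R) (Y : T -> cpath t R) : 0 <= a' -> 0 <= b' -> has_bridge_law P a' b' Y ->
    bessel_kernel t%:num a' b' = bessel_kernel t%:num a b ->
    (c%:E * pathint (mesh t n.+2) n (fun al be w => end_weight (mesh t n.+2) a' b' al be) = 1)%E.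
  move=> a'0 b'0 lawY bb.
  have m1 : mseq n.+2 (fun _ : R => fun _ : seq R => 1 : R).
    by apply: mseq_head; exact: measurable_cst.
  have E := bridge_law_pathint a'0 b'0 lawY m1 (fun=> ler01); rewrite bb in E.
  have E' : (\int[P]_w (1 : R)%:E = 1)%E.
    rewrite integral_cst; last exact: measurableT.
    by rewrite mul1e; exact: probability_setT.
  rewrite -[RHS]E' [RHS]E; apply: congr1.
  by apply: eq_pathint => al be w _ _; rewrite mulr1.
have mPhi' := mseq_swap mPhi.
have lPhi' := lip_seq_swap lPhi.
have mS (Psi : seq V3 -> R) : mseq n.+2 (fun _ : R => Psi) -> mseq n.+2 (fun _ : R => Psi \o skel_rows).
  move=> mPsi; have := mseq_skel_rows mPsi (x := @snd R R) (@measurable_snd _ _ R R).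
  exact.
have E1 : (skel_expectation X n Phi = c%:E * pathint (mesh t n.+2) n (fun al be w =>
    end_weight (mesh t n.+2) a b al be * Phi (skel_rows (al :: map snd w)))%R)%E.
  apply: (bridge_law_pathint (psi := Phi \o skel_rows) a0 b0 law); first exact: (mS _ mPhi).
  by move=> l; exact: Phi0.
have E2 : (skel_expectation X' n (Phi \o map (@swap3 R)) = c%:E *
    pathint (mesh t n.+2) n (fun al be w => end_weight (mesh t n.+2) b a al be *
      (Phi \o map (@swap3 R)) (skel_rows (al :: map snd w)))%R)%E.
  rewrite /c bessel_kernelC.
  apply: (bridge_law_pathint (psi := Phi \o map (@swap3 R) \o skel_rows) b0 a0 law').
    exact: (mS _ mPhi').
  by move=> l; exact: Phi0.
have [_ P2] := pathint_rows_perturb r0 a0 b0 mPhi Phi0 e0 L0 Phi1 lPhi.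
have [P1 _] := pathint_rows_perturb r0 b0 a0 mPhi' (fun v => Phi0 _) e0 L0 (fun v => Phi1 _) lPhi'.
have sym := pathint_rows_sym r0 a0 b0 mPhi Phi0; rewrite -sym in P1.
rewrite E1 E2; rewrite -KE in P1 P2.
apply: (le_combine_perturb c0 K0 _ (mass_one _ _ _ a0 b0 law erefl)
  (mass_one _ _ _ b0 a0 law' (bessel_kernelC _ _ _)) P2); last exact: P1.
apply: (pathint_ge0 r0) => al be w.
by apply: mulr_ge0; [exact: end_weight_ge0|exact: Phi0].
Qed.

End bridge_law.
End compare.

(** * The limit of vanishing mesh *)

Section interpolation.
Context {R : realType} {t : {posnum R}}.

Lemma grid_val n (i : 'I_n) : \val (tnth (grid t n) i) = i.+1%:R * mesh t n.
Proof. by rewrite tnth_mktuple. Qed.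

Lemma mesh_end n : n.+1%:R * mesh t n = t%:num.
Proof. by rewrite /mesh mulrC divfK. Qed.

(** The last two clauses keep [j] on the same side as [u] of every grid point, so that a minimum
    over a past or a future reached at [u] is almost reached on the grid. *)
Lemma near_grid n (u : timeI t) : (0 < n)%N -> exists j : 'I_n,
  [/\ `|\val u - \val (tnth (grid t n) j)| <= mesh t n,
      forall i : 'I_n, \val u <= \val (tnth (grid t n) i) -> (j <= i)%N &
      forall i : 'I_n, \val (tnth (grid t n) i) <= \val u -> (i <= j)%N].
Proof.
move=> n0; have h0 := mesh_gt0 t n; set h := mesh t n in h0 *.
have /andP[u0 ut] : 0 <= \val u <= t%:num.
  by have := valP u; rewrite inE /timeI /= in_itv.
rewrite -(mesh_end n) -/h in ut.
pose k := Num.truncn (\val u / h).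
have /andP[k1 k2] : k%:R <= \val u / h < k.+1%:R.
  by apply: truncn_itv; rewrite divr_ge0// ltW.
rewrite ler_pdivlMr// in k1; rewrite ltr_pdivrMr// in k2.
have kn : (k <= n.+1)%N.
  by rewrite -(ler_nat R) -(ler_pM2r h0); exact: le_trans k1 ut.
(* Index [k.-1] stands for time [k * h]. The grid omits both ends: the truncated predecessor sends
   [k = 0] to the first grid point, and the minimum sends [k = n.+1] to the last. *)
have jn : (minn k.-1 n.-1 < n)%N.
  by rewrite (leq_ltn_trans (geq_minr _ _))// prednK.
exists (Ordinal jn); rewrite grid_val -/h -[nat_of_ord _]/(minn k.-1 n.-1); split.
- rewrite ler_distl; case: (posnP k) => [k0|kgt0].
    by move: k2; rewrite k0 min0n !mul1r => k2; apply/andP; split; lra.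
  have [kn1|kn1] := leqP k n.
    have -> : (minn k.-1 n.-1).+1 = k.
      by rewrite (minn_idPl _) ?prednK// -ltnS !prednK.
    by rewrite -natr1 mulrDl mul1r in k2; apply/andP; split; lra.
  have -> : (minn k.-1 n.-1).+1 = n.
    by rewrite (minn_idPr _) ?prednK// -ltnS !prednK// ltnW.
  have kE : k = n.+1 by apply/eqP; rewrite eqn_leq kn.
  move: k1 k2 ut; rewrite kE -!natr1 !mulrDl mul1r => *.
  by apply/andP; split; lra.
- move=> i; rewrite grid_val -/h => ui; rewrite (leq_trans (geq_minl _ _))//.
  have : (k <= i.+1)%N.
    by rewrite -(ler_nat R) -(ler_pM2r h0); exact: le_trans k1 ui.
  by case: (k).
- move=> i; rewrite grid_val -/h => ui; rewrite leq_min; apply/andP; split; last by rewrite -ltnS prednK.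
  have : (i.+1 < k.+1)%N.
    by rewrite -(ltr_nat R) -(ltr_pM2r h0); exact: le_lt_trans ui k2.
  by rewrite ltnS; case: (k).
Qed.

Context {V : normedModType R}.

Lemma convex_close n (w : 'I_n -> R) (x : 'I_n -> V) (y : V) (e : R) :
  0 <= e -> (forall i, 0 <= w i) -> \sum_i w i = 1 ->
  (forall i, 0 < w i -> `|x i - y| <= e) -> `|\sum_i w i *: x i - y| <= e.
Proof.
move=> e0 w0 w1 xy.
have -> : \sum_i w i *: x i - y = \sum_i w i *: (x i - y).
  under [RHS]eq_bigr do rewrite scalerBr.
  by rewrite sumrB -scaler_suml w1 scale1r.
apply: (le_trans (ler_norm_sum _ _ _)).
rewrite -[leRHS]mul1r -w1 mulr_suml; apply: ler_sum => i _.
rewrite normrZ ger0_norm//; have := w0 i; rewrite le_eqVlt => /predU1P[<-|wi].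
  by rewrite !mul0r.
by rewrite ler_pM2l// xy.
Qed.

Definition hat n (i : 'I_n) (s : timeI t) : R :=
  Num.max 0 (2 * mesh t n - `|\val s - \val (tnth (grid t n) i)|).

Lemma hat_ge0 n (i : 'I_n) s : 0 <= hat i s.
Proof. by rewrite /hat le_max lexx. Qed.

Lemma hat_gt0 n (i : 'I_n) s : 0 < hat i s ->
  `|\val s - \val (tnth (grid t n) i)| < 2 * mesh t n.
Proof. by rewrite /hat lt_max ltxx /= subr_gt0. Qed.

Lemma hat_sum_gt0 n s : (0 < n)%N -> 0 < \sum_(i < n) hat i s.
Proof.
move=> n0; have [j [hj _ _]] := near_grid s n0.
rewrite (bigD1 j)//= ltr_pwDl//; last by apply: sumr_ge0 => i _; exact: hat_ge0.
by have h0 := mesh_gt0 t n; rewrite /hat lt_max; apply/orP; right; lra.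
Qed.

Lemma hat_continuous n (i : 'I_n) : continuous (hat i).
Proof.
move=> s; have FF : Filter (nbhs s) := nbhs_filter s.
pose f (u : timeI t) : R := 2 * mesh t n - `|\val u - \val (tnth (grid t n) i)|.
have cf : f u @[u --> s] --> f s.
  apply: (@cvgB _ _ _ (nbhs s)); first exact: cvg_cst.
  apply: cvg_norm; apply: (@cvgB _ _ _ (nbhs s)); last exact: cvg_cst.
  exact: val_timeI_continuous.
exact: (@continuous_max R (timeI t) (cst 0) f s (@cst_continuous _ _ _ s) cf).
Qed.

(* The hats have width [2 * mesh], hence cover the interval including its two
   ends; dividing by their sum makes this a convex combination. *)
Definition interp_fun n (v : seq V) (s : timeI t) : V :=
  \sum_(i < n.+1) (hat i s / \sum_(j < n.+1) hat j s) *: v`_i.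

Lemma interp_continuous n v : continuous (interp_fun n v).
Proof.
move=> s; have FF : Filter (nbhs s) := nbhs_filter s.
have csum : (fun s => \sum_(j < n.+1) hat j s) u @[u --> s] --> \sum_(j < n.+1) hat j s.
  apply: (cvg_big (op := +%R)) => [|j _]; first exact: add_continuous.
  exact: hat_continuous.
apply: (cvg_big (op := +%R)) => [|i _]; first exact: add_continuous.
apply: cvgZr_tmp.
apply: (@cvgM _ _ (nbhs s)); first exact: hat_continuous.
by apply: cvgV => //; rewrite gt_eqF// hat_sum_gt0.
Qed.

Definition interp n (v : seq V) : cpath t V := mkcts (@interp_continuous n v).

Lemma interp_close n (v : seq V) (s : timeI t) (y : V) (e : R) : 0 <= e ->
  (forall i : 'I_n.+1, `|\val s - \val (tnth (grid t n.+1) i)| < 2 * mesh t n.+1 ->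
    `|v`_i - y| <= e) ->
  `|interp n v s - y| <= e.
Proof.
move=> e0 h; have S0 := hat_sum_gt0 s (ltn0Sn n).
apply: convex_close => //.
- by move=> i; rewrite divr_ge0 ?hat_ge0// ltW.
- by rewrite -mulr_suml divff// gt_eqF.
- by move=> i; rewrite pmulr_lgt0 ?invr_gt0// => /hat_gt0; exact: h.
Qed.

Lemma interp_lip n (v v' : seq V) (e : R) : 0 <= e ->
  (forall i, `|v`_i - v'`_i| <= e) ->
  forall s, `|interp n v s - interp n v' s| <= e.
Proof.
move=> e0 h s; have S0 := hat_sum_gt0 s (ltn0Sn n).
have -> : interp n v s - interp n v' s =
    \sum_(i < n.+1) (hat i s / \sum_(j < n.+1) hat j s) *: (v`_i - v'`_i) - 0.
  rewrite subr0; under [RHS]eq_bigr do rewrite scalerBr.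
  by rewrite sumrB.
apply: convex_close => //.
- by move=> i; rewrite divr_ge0 ?hat_ge0// ltW.
- by rewrite -mulr_suml divff// gt_eqF.
- by move=> i _; rewrite subr0.
Qed.

(** Uniform continuity, from compactness of [timeI] as a near-covering property: half of the
    continuity radius at [s] serves all points close to [s]. *)
Lemma cpath_uniform (x : cpath t V) (e : R) : 0 < e -> exists2 d : R, 0 < d &
  forall s u : timeI t, `|\val s - \val u| < d -> `|x s - x u| <= e.
Proof.
move=> e0; have e2 : 0 < e / 2 by rewrite divr_gt0.
pose good (d : R) (s : timeI t) := forall u : timeI t,
  `|\val s - \val u| < d -> `|x s - x u| <= e.
have /compact_near_coveringP/(_ R (0^'+) good _) := @timeI_compact R t.
move=> /(_ _)[|d /= d0 hd]; last first.
  exists (d / 2); first by rewrite divr_gt0.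
  move=> s; apply: (hd (d / 2)) => //=; last by rewrite divr_gt0.
  by rewrite sub0r normrN gtr0_norm ?divr_gt0//; lra.
move=> s _.
have /(@cvgrPdist_le _ _ _ (nbhs s) (nbhs_filter s))/(_ _ e2)/nbhs_ballP[d /= d0 hd] :=
  @cts_fun _ _ x s.
have d2 : 0 < d / 2 by rewrite divr_gt0.
exists (ball s (d / 2), [set r : R | 0 < r < d / 2]) => /=.
  split; first exact: nbhsx_ballx.
  near=> r; apply/andP; split; near: r; [exact: nbhs_right_gt|exact: nbhs_right_lt].
move=> [s' r] /= [ss' /andP[r0 rd]] u su.
have ss2 : `|\val s - \val s'| < d / 2 by exact: ss'.
have h1 : `|x s - x s'| <= e / 2 by apply: hd; apply: (lt_trans ss2); lra.
have h2 : `|x s - x u| <= e / 2.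
  apply: hd; apply: (@le_lt_trans _ _ (`|\val s - \val s'| + `|\val s' - \val u|)).
    by rewrite -(subrKA (\val s') (\val s)) ler_normD.
  by rewrite [ltRHS](splitr d) ltrD// (lt_trans su).
rewrite (_ : x s' - x u = (x s' - x s) + (x s - x u)); last by rewrite addrA subrK.
apply: (le_trans (ler_normD _ _)); rewrite distrC (splitr e); exact: lerD.
Unshelve. all: by end_near. Qed.

End interpolation.

Section skeleton_rows.
Context {R : realType}.

Lemma future_min_skeleton (x : R) ys :
  (forall j, (j <= size ys)%N -> future_min x (skeleton x ys) <= (x :: ys)`_j) /\
  exists2 j, (j <= size ys)%N & future_min x (skeleton x ys) = (x :: ys)`_j.
Proof.
elim: ys x => [|y ys IH] x /=.
  by split => [[|]//|]; exists 0%N.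
have [h1 [j js h2]] := IH y; set M := future_min y _ in h1 h2 *.
have My : M <= y by have := h1 0%N isT.
split.
  case=> [|k] ks; first by rewrite !ge_min lexx.
  by rewrite ge_min (h1 k ks) orbT.
have [xM|Mx] := leP x M.
  exists 0%N => //=; rewrite (min_idPl (le_trans xM My)); exact/min_idPl.
exists j.+1 => //=; rewrite -h2.
by rewrite (min_idPr _)// le_min (ltW Mx) My.
Qed.

(** Valleys of a skeleton are minima of neighbouring peaks, so its past and future minima are those
    of the values up to, and from, index [i]. Bounds and attainment are stated separately, ready to
    be compared with the minima of a path. *)
Lemma skeleton_row_spec (al be m x : R) ys i : m <= x -> (i <= size ys)%N ->
  exists m' M, [/\ (zigzag_rows al be m x (skeleton x ys))`_i =
      zigzag_row al be m' (x :: ys)`_i M,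
    m' <= m /\ (forall j, (j <= i)%N -> m' <= (x :: ys)`_j),
    m' = m \/ (exists2 j, (j <= i)%N & m' = (x :: ys)`_j),
    forall j, (i <= j <= size ys)%N -> M <= (x :: ys)`_j &
    exists2 j, (i <= j <= size ys)%N & M = (x :: ys)`_j].
Proof.
elim: ys i m x => [|y ys IH] i m x mx ile.
  move: ile; rewrite leqn0 => /eqP ->.
  exists m, x; split => //=; first by split => // -[].
  - by left.
  - by case.
  - by exists 0%N.
case: i ile => [|i] ile.
  have [h1 [j js h2]] := future_min_skeleton x (y :: ys).
  exists m, (future_min x (skeleton x (y :: ys))); split => //.
  - by split => // -[].
  - by left.
  - by exists j.
have mm : Num.min m (Num.min x y) <= y by rewrite !ge_min lexx !orbT.
have [m' [M [h1 [h2 h2'] h3 h4 [k ik h5]]]] := IH i _ _ mm ile.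
exists m', M; split.
- exact: h1.
- split; first by rewrite (le_trans h2)// ge_min lexx.
  case=> [|j] ji /=; last exact: h2'.
  by rewrite (le_trans h2)// !ge_min lexx orbT.
- case: h3 => [->|[j ji ->]]; last by right; exists j.+1.
  have [mxy|xym] := leP m (Num.min x y); first by left.
  right; have [xy|yx] := leP x y; first by exists 0%N.
  by exists 1%N.
- by case=> // j; exact: h4.
- by exists k.+1.
Qed.

(** The constant is [1 + 4 + 2]: the height, then the numbers of terms in the two absolute values of
    the third coordinate. *)
Lemma zigzag_row_close (al be m x M al' be' m' x' M' e : R) :
  `|al - al'| <= e -> `|be - be'| <= e -> `|m - m'| <= e -> `|x - x'| <= e ->
  `|M - M'| <= e ->
  `|zigzag_row al be m x M - zigzag_row al' be' m' x' M'| <= 7 * e.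
Proof.
move=> ha hb hm hx hM; have e0 : 0 <= e by exact: le_trans ha.
have d1 := ler_dist_dist (be - al + m - M) (be' - al' + m' - M').
have d2 := ler_dist_dist (m - M) (m' - M').
have d1' : `|be - al + m - M - (be' - al' + m' - M')| <= 4 * e.
  move: ha hb hm hM; rewrite !ler_distl => /andP[? ?] /andP[? ?] /andP[? ?] /andP[? ?].
  by apply/andP; split; lra.
have d2' : `|m - M - (m' - M')| <= 2 * e.
  move: hm hM; rewrite !ler_distl => /andP[? ?] /andP[? ?].
  by apply/andP; split; lra.
move: (le_trans d1 d1') (le_trans d2 d2') => {d1 d2 d1' d2'} d1 d2.
rewrite prod_normE /= prod_normE /= !ge_max -!andbA.
move: d1 d2; set A := `|be - _ + _ - _|; set A' := `|be' - _ + _ - _|.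
set B := `|m - M|; set B' := `|m' - M'|; clearbody A A' B B'.
move: ha hb hm hx hM; rewrite !ler_distl.
move=> /andP[? ?] /andP[? ?] /andP[? ?] /andP[? ?] /andP[? ?] /andP[? ?] /andP[? ?].
by apply/and3P; split; [apply/andP; split; lra|apply/andP; split; lra|apply/andP; split; lra].
Qed.

End skeleton_rows.

Section path_rows.
Context {R : realType} {t : {posnum R}}.
Implicit Types x : cpath t R.

Definition path_row a b x (s : timeI t) : R * R * R :=
  zigzag_row a b (minover (past s) x) (x s) (minover (future s) x).

Lemma minover_addc x (A : set (timeI t)) (k : R) : A !=set0 ->
  minover A (addc x k) = minover A x + k.
Proof.
move=> A0; apply/eqP; rewrite eq_le; apply/andP; split.
  rewrite -lerBlDr; apply: le_minover => // u Au.
  by rewrite lerBlDr; exact: (minover_le (addc x k) Au).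
by apply: le_minover => // u Au /=; rewrite lerD2r; exact: minover_le.
Qed.

Lemma past_nonempty (s : timeI t) : past s !=set0.
Proof. by exists s; rewrite /past /=. Qed.

Lemma future_nonempty (s : timeI t) : future s !=set0.
Proof. by exists s; rewrite /future /=. Qed.

Definition bridge_path a b x : cpath t (R * R * R)%type :=
  cpath3 x (addc (Pbar x) a) (addc (Mbar (a - b) (addc x (- a))) b).

(** The shifted path ends at [b - a], so the half-difference with [a - b] in [Mbar_fun] is [b - a],
    and the shift by [a] cancels in the difference of the minima. *)
Lemma bridge_pathE a b x s : x (time_end t) = b ->
  bridge_path a b x s = path_row a b x s.
Proof.
move=> xb.
have -> : bridge_path a b x s =
    (x s, Pbar_fun x s + a, Mbar_fun (a - b) (addc x (- a)) s + b) by [].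
congr (_, _, _); rewrite /Mbar_fun.
rewrite !minover_addc; [|exact: future_nonempty|exact: past_nonempty].
have -> : addc x (- a) (time_end t) = b - a by rewrite -xb.
have -> : addc x (- a) s = x s - a by [].
rewrite (_ : (b - a - (a - b)) / 2 = b - a); last by field.
set m := minover _ _; set M := minover _ _.
rewrite (_ : b - a + (m - a) - (M - a) = b - a + m - M); last by ring.
rewrite (_ : m - a - (M - a) = m - M); last by ring.
by ring.
Qed.

(** Grid minima are above path minima; conversely a path minimum is attained at some [u], and
    [near_grid] gives a grid point of the same past or future within one mesh. The endpoints are
    also one mesh away from the first and last grid points. *)
Lemma skel_rows_close a b x n (i : 'I_n.+1) (w : R) :
  x (time_start t) = a -> x (time_end t) = b ->
  (forall s u : timeI t, `|\val s - \val u| <= mesh t n.+1 -> `|x s - x u| <= w) ->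
  `|(skel_rows (grid_values n.+1 x))`_i - path_row a b x (tnth (grid t n.+1) i)| <= 7 * w.
Proof.
move=> xa xb hw; have h0 := mesh_gt0 t n.+1.
case E : (grid_values n.+1 x) => [|y ys].
  by have := size_grid_values n.+1 x; rewrite E.
have sy : size ys = n by have := size_grid_values n.+1 x; rewrite E => -[].
have xg (j : 'I_n.+1) : (y :: ys)`_j = x (tnth (grid t n.+1) j).
  by rewrite -E nth_grid_values.
have iy : (i <= size ys)%N by rewrite sy -ltnS.
have [m [M [-> [_ m1] m2 M1 [k ki M2]]]] :=
  skeleton_row_spec y (last y ys) (lexx y) iy.
rewrite xg; set s := tnth (grid t n.+1) i.
have gmono (j k' : 'I_n.+1) : (j <= k')%N ->
    \val (tnth (grid t n.+1) j) <= \val (tnth (grid t n.+1) k').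
  by move=> jk; rewrite !grid_val ler_pM2r// ler_nat.
apply: zigzag_row_close.
- rewrite -[y]/((y :: ys)`_(ord0 : 'I_n.+1)) xg -xa; apply: hw.
  by rewrite grid_val mul1r subr0 gtr0_norm.
- rewrite (last_nth 0) sy -[n]/(nat_of_ord (ord_max : 'I_n.+1)) xg -xb; apply: hw.
  rewrite grid_val /= distrC -(mesh_end (t := t) n.+1) -mulrBl -natrB//.
  by rewrite subSnn mul1r gtr0_norm.
- have [u us mu] := minover_attained x (past_nonempty s) (@closed_past _ _ s).
  have mle : minover (past s) x <= m.
    have [j ji ->] : exists2 j, (j <= i)%N & m = (y :: ys)`_j.
      by case: m2 => [->|//]; exists 0%N.
    have jn : (j < n.+1)%N by exact: leq_ltn_trans ji _.
    rewrite -[j]/(nat_of_ord (Ordinal jn)) xg; apply: minover_le.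
    by rewrite /past /=; exact: (gmono (Ordinal jn)).
  have [j [hj ju _]] := near_grid u (ltn0Sn n).
  have mj : m <= x (tnth (grid t n.+1) j) by rewrite -xg; apply: m1; exact: ju.
  have := hw _ _ hj; rewrite ler_distl => /andP[? ?].
  by move: mle; rewrite mu => mle; rewrite ler_distl; apply/andP; split; lra.
- by have := hw s s; rewrite !subrr !normr0; apply; exact: ltW.
- have [u us mu] := minover_attained x (future_nonempty s) (@closed_future _ _ s).
  have mle : minover (future s) x <= M.
    move: ki => /andP[ik]; rewrite sy -ltnS => kn.
    rewrite M2 -[k]/(nat_of_ord (Ordinal kn)) xg; apply: minover_le.
    by rewrite /future /=; exact: (gmono i (Ordinal kn)).
  have [j [hj _ ju]] := near_grid u (ltn0Sn n).
  have mj : M <= x (tnth (grid t n.+1) j).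
    rewrite -(xg j); apply: (M1 j); apply/andP; split; first exact: (ju i us).
    by rewrite sy -ltnS.
  have := hw _ _ hj; rewrite ler_distl => /andP[? ?].
  by move: mle; rewrite mu => mle; rewrite ler_distl; apply/andP; split; lra.
Qed.

(** [F] stands for the identity or [swap3]. The rank [N] depends on the path through its modulus of
    continuity, so this convergence is pathwise. *)
Lemma interp_skel_rows (phi : cpath t (R * R * R)%type) (F : R * R * R -> R * R * R)
    a b x (e : R) : 0 < e ->
  (forall p q, `|F p - F q| = `|p - q|) ->
  x (time_start t) = a -> x (time_end t) = b ->
  (forall s, phi s = F (path_row a b x s)) ->
  exists N, forall n, (N <= n)%N -> forall s,
    `|interp n (map F (skel_rows (grid_values n.+1 x))) s - phi s| <= e.
Proof.
move=> e0 FF xa xb phiE.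
(* [7 * (e / 14)] bounds the error at grid points by [e / 2]; the other half is the oscillation of
   [phi] on the support of a hat. *)
have e14 : 0 < e / 14 by rewrite divr_gt0.
have e2 : 0 < e / 2 by rewrite divr_gt0.
have [d1 d10 hd1] := cpath_uniform x e14.
have [d2 d20 hd2] := cpath_uniform phi e2.
pose d := Num.min d1 d2.
have d0 : 0 < d by rewrite lt_min d10.
exists (Num.truncn (2 * t%:num / d)).+1 => n Nn s.
have hn : 2 * mesh t n.+1 < d.
  have := truncnS_gt (2 * t%:num / d).
  rewrite ltr_pdivrMr// => /lt_le_trans h.
  rewrite /mesh mulrA ltr_pdivrMr//.
  apply: h; rewrite mulrC ler_pM2l// ler_nat.
  exact: (leq_trans Nn (leqW (leqnSn n))).
have h0 := mesh_gt0 t n.+1.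
apply: interp_close => [|i hi]; first exact: ltW.
set v := (map F _)`_i.
have -> : v = F (skel_rows (grid_values n.+1 x))`_i.
  rewrite /v (nth_map 0)//.
  case E : (grid_values n.+1 x) => [|y ys].
    by have := size_grid_values n.+1 x; rewrite E.
  by rewrite /= size_zigzag_rows size_skeleton; have := size_grid_values n.+1 x; rewrite E /= => ->.
have h1 : `|(skel_rows (grid_values n.+1 x))`_i - path_row a b x (tnth (grid t n.+1) i)| <= 7 * (e / 14).
  apply: skel_rows_close => // s1 u1 su; apply: hd1.
  apply: (le_lt_trans su); apply: (@lt_le_trans _ _ d); last by rewrite ge_min lexx.
  by apply: le_lt_trans hn; lra.
have h2 : `|phi (tnth (grid t n.+1) i) - phi s| <= e / 2.
  apply: hd2; rewrite distrC; apply: (lt_trans hi); apply: (lt_le_trans hn).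
  by rewrite ge_min lexx orbT.
rewrite -(subrKA (phi (tnth (grid t n.+1) i))).
apply: (le_trans (ler_normD _ _)); rewrite {1}phiE FF.
by apply: (le_trans (lerD h1 h2)); lra.
Qed.

End path_rows.

Section lipschitz_measurable.
Context {R : realType}.
Notation V3 := (R * R * R)%type.

(* A Lipschitz function of finitely many variables is measurable for the product
   sigma-algebra because its superlevel sets are countable unions of boxes with
   rational centres. *)
Lemma measurable_box n (q : 'I_n -> V3) (e : R) :
  measurable [set v : n.-tuple V3 | forall i, `|tnth v i - q i| <= e].
Proof.
rewrite (_ : [set v | _] =
    \bigcap_(i in [set: 'I_n]) [set v : n.-tuple V3 | `|tnth v i - q i| <= e]); last first.
  by apply/seteqP; split => [v h i _|v h i]; [exact: h|exact: (h i I)].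
apply: fin_bigcap_measurable; first exact: finite_finset.
move=> i _.
pose c (v : n.-tuple V3) : bool :=
  [&& `|(tnth v i).1.1 - (q i).1.1| <= e, `|(tnth v i).1.2 - (q i).1.2| <= e &
      `|(tnth v i).2 - (q i).2| <= e].
have m1 : measurable_fun setT (fun v : n.-tuple V3 => tnth v i) := measurable_tnth i.
have mabs (f : n.-tuple V3 -> R) k : measurable_fun setT f ->
    measurable_fun setT (fun v => `|f v - k| <= e).
  move=> mf; apply: measurable_fun_ler; last exact: measurable_cst.
  apply: (measurableT_comp (@normr_measurable R setT)).
  by apply: measurable_funD => //; exact: measurable_cst.
have mc : measurable_fun setT c.
  by rewrite /c; apply: measurable_and; [|apply: measurable_and]; apply: mabs;
    measurability.
rewrite (_ : [set v | _] = c @^-1` [set true]).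
  by rewrite -[X in measurable X]setTI; exact: mc.
apply/funext => v; apply/propext; rewrite /c /= prod_normE /= prod_normE /= !ge_max -andbA.
by split => [->|].
Qed.

Lemma rat_tuple_dense n (v : n.-tuple V3) (e : R) : 0 < e ->
  exists q : n.-tuple (rat * rat * rat), forall i,
    `|tnth v i - (ratr (tnth q i).1.1, ratr (tnth q i).1.2, ratr (tnth q i).2)| <= e.
Proof.
move=> e0.
have rd (x : R) : exists p : rat, `|x - ratr p| <= e.
  have [|p hp] := @rat_in_itvoo R (x - e) (x + e); first by lra.
  exists p; move: hp; rewrite in_itv/= ler_distl => /andP[? ?].
  by apply/andP; split; lra.
pose r x := xchoose (rd x).
have rP x : `|x - ratr (r x)| <= e := xchooseP (rd x).
exists [tuple (r (tnth v i).1.1, r (tnth v i).1.2, r (tnth v i).2) | i < n] => i.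
rewrite tnth_mktuple; case: (tnth v i) => [[x y] z] /=.
by rewrite prod_normE /= prod_normE /= !ge_max !rP.
Qed.

Lemma lipschitz_measurable n (G : n.-tuple V3 -> R) (L : R) : 0 <= L ->
  (forall (v v' : n.-tuple V3) (e : R), 0 <= e -> (forall i, `|tnth v i - tnth v' i| <= e) ->
    G v <= G v' + L * e) ->
  measurable_fun setT G.
Proof.
move=> L0 lG; apply: (measurability _ (RGenOInfty.measurableE R)) => //.
move=> _ [_ [c ->] <-]; rewrite setTI.
pose rv (q : n.-tuple (rat * rat * rat)) : n.-tuple V3 :=
  [tuple (ratr (tnth q i).1.1, ratr (tnth q i).1.2, ratr (tnth q i).2) | i < n].
pose B (p : n.-tuple (rat * rat * rat) * nat) : set (n.-tuple V3) :=
  if c + L * p.2.+1%:R^-1 < G (rv p.1) then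
    [set v | forall i, `|tnth v i - tnth (rv p.1) i| <= p.2.+1%:R^-1] else set0.
rewrite (_ : _ @^-1` _ = \bigcup_p B p).
  apply: countable_bigcupT_measurable => // p.
  by rewrite /B; case: ifP => // _; exact: measurable_box.
apply/seteqP; split => v.
  rewrite /= in_itv /= andbT => cv.
  (* Leaves room for two errors [L * e]: one from [v] to its rational approximation, one in the
     threshold defining [B]. *)
  pose D := (2 * L + 1) / (G v - c).
  pose k := Num.truncn D.
  have gc : 0 < G v - c by rewrite subr_gt0.
  have kD : D < k.+1%:R by exact: truncnS_gt.
  pose e : R := k.+1%:R^-1.
  have e0 : 0 < e by rewrite invr_gt0.
  have he : 2 * L * e < G v - c.
    move: kD; rewrite /D ltr_pdivrMr// => kD.
    by rewrite /e ltr_pdivrMr// [ltRHS]mulrC; apply: le_lt_trans kD; rewrite lerDl.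
  have [q hq] := rat_tuple_dense v e0.
  have hq' i : `|tnth v i - tnth (rv q) i| <= e by rewrite tnth_mktuple.
  exists (q, k) => //; rewrite /B /= ifT//.
  by have := lG _ _ _ (ltW e0) hq'; rewrite -/e; lra.
move=> [[q k] _]; rewrite /B /=; case: ifP => // hc hv; rewrite in_itv /= andbT.
have /lG : forall i, `|tnth (rv q) i - tnth v i| <= k.+1%:R^-1.
  by move=> i; rewrite distrC.
by rewrite invr_ge0 => /(_ (ler0n _ _)) h2;
  rewrite -(ltrD2r (L * k.+1%:R^-1)); exact: lt_le_trans hc h2.
Qed.

Lemma lip_seq_mseq n (Phi : seq V3 -> R) (L : R) : 0 <= L -> lip_seq L Phi ->
  mseq n (fun _ : R => Phi).
Proof.
move=> L0 lPhi; apply: tuple_mseq.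
have mG : measurable_fun setT (fun v : n.-tuple V3 => Phi v).
  apply: (lipschitz_measurable L0) => v v' e e0 vv'; apply: lPhi => //.
    by rewrite !size_tuple.
  move=> i; have [ni|ni] := ltnP i n; last by rewrite !nth_default ?size_tuple// subrr normr0.
  by have := vv' (Ordinal ni); rewrite !(tnth_nth 0).
exact: (measurableT_comp mG measurable_snd).
Qed.

End lipschitz_measurable.

Section path_maps_lipschitz.
Context {R : realType} {t : {posnum R}}.
Notation V3 := (R * R * R)%type.
Implicit Types x y : cpath t R.

Lemma minover_lip x y (A : set (timeI t)) e : A !=set0 ->
  (forall s, `|x s - y s| <= e) -> `|minover A x - minover A y| <= e.
Proof.
move=> A0 xy; rewrite ler_distl; apply/andP; split.
  apply: le_minover => // u Au; have := xy u; rewrite ler_distl => /andP[h _].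
  by apply: (le_trans _ h); rewrite lerD2r; exact: minover_le.
rewrite -lerBlDr; apply: le_minover => // u Au.
have := xy u; rewrite ler_distl -[X in _ && X]lerBlDr => /andP[_ h].
by apply: (le_trans _ h); rewrite lerD2r; exact: minover_le.
Qed.

(** In the third coordinate the height counts for 1, the final value for 1/2, and the two absolute
    values for at most 3 and 2. *)
Lemma bridge_path_lip a b x y e : (forall s, `|x s - y s| <= e) ->
  forall s, `|bridge_path a b x s - bridge_path a b y s| <= 7 * e.
Proof.
move=> xy s; have e0 : 0 <= e by exact: le_trans (xy s).
have hs := xy s; have ht := xy (time_end t).
have hp := minover_lip (past_nonempty s) xy.
have hf := minover_lip (future_nonempty s) xy.
have E z : bridge_path a b z s =
    (z s, Pbar_fun z s + a, Mbar_fun (a - b) (addc z (- a)) s + b) by [].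
rewrite !E prod_normE /= prod_normE /= !ge_max -andbA /Pbar_fun /Mbar_fun.
rewrite !minover_addc; try by [exact: future_nonempty|exact: past_nonempty].
have A z u : addc z (- a) u = z u - a by [].
rewrite !A {E A}.
set mx := minover (past s) x in hp *; set my := minover (past s) y in hp *.
set Mx := minover (future s) x in hf *; set My := minover (future s) y in hf *.
set x1 := x s in hs *; set y1 := y s in hs *.
set xt := x _ in ht *; set yt := y _ in ht *.
clearbody mx my Mx My x1 y1 xt yt.
set p := (xt - a - (a - b)) / 2 + (mx - a) - (Mx - a).
set q := (yt - a - (a - b)) / 2 + (my - a) - (My - a).
have d1 := ler_dist_dist p q.
set p' := mx - a - (Mx - a); set q' := my - a - (My - a).
have d2 := ler_dist_dist p' q'.
move: hs ht hp hf; rewrite !ler_distl => /andP[? ?] /andP[? ?] /andP[? ?] /andP[? ?].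
have d1' : `|p - q| <= 3 * e.
  by rewrite ler_distl /p /q; apply/andP; split; lra.
have d2' : `|p' - q'| <= 2 * e.
  by rewrite ler_distl /p' /q'; apply/andP; split; lra.
move: (le_trans d1 d1') (le_trans d2 d2') => {d1 d2 d1' d2'}.
set P := `|p|; set Q := `|q|; set P' := `|p'|; set Q' := `|q'|.
clearbody P Q P' Q'; rewrite !ler_distl => /andP[? ?] /andP[? ?].
by apply/and3P; split; apply/andP; split; lra.
Qed.

Lemma normB_swap3 (p q : V3) : `|swap3 p - swap3 q| = `|p - q|.
Proof.
case: p q => [[x y] z] [[x' y'] z'].
by rewrite !prod_normE /= maxC -maxA [Num.max `|y - y'| _]maxC maxA
  [in RHS]maxC [in RHS]maxA maxC maxA.
Qed.

End path_maps_lipschitz.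

(** * Expectations of bounded Lipschitz functionals *)

Section lipschitz_expectation.
Context {R : realType} {t : {posnum R}} {d : measure_display}
  {T : measurableType d} (P : probability T R).
Notation V3 := (R * R * R)%type.
Implicit Types (X : T -> cpath t R) (f : cpath t V3 -> R).

Definition lipschitz01 (L : R) f := [/\ 0 <= L, forall x, 0 <= f x <= 1 &
  forall (x y : cpath t V3) (e : R), 0 <= e -> (forall s, `|x s - y s| <= e) ->
    f x <= f y + L * e].

Lemma lipschitz01_dist L f : lipschitz01 L f -> forall (x y : cpath t V3) (e : R), 0 <= e ->
  (forall s, `|x s - y s| <= e) -> `|f x - f y| <= L * e.
Proof.
move=> [L0 _ lf] x y e e0 xy; rewrite ler_distl lerBlDr !lf// => s.
by rewrite distrC.
Qed.

Lemma lipschitz01_measurable L f : lipschitz01 L f -> measurable_fun setT f.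
Proof.
move=> lf; apply: measurable_continuous_cpath.
exact: lipschitz_continuous (lipschitz01_dist lf).
Qed.

Lemma lipschitz01_lip_seq L f n : lipschitz01 L f -> lip_seq L (f \o @interp R t V3 n).
Proof.
by move=> [L0 _ lf] v v' e e0 _ vv' /=; apply: lf => //; exact: interp_lip.
Qed.

(** Dominated convergence with bound 1. The pathwise limit holds where the bridge has its prescribed
    endpoints, hence the conditional form of the hypothesis on [phi]. *)
Lemma skel_expectation_cvg (F : V3 -> V3) (a b L : R) X (phi : T -> cpath t V3) f
    (Phi : nat -> seq V3 -> R) :
  (forall p q, `|F p - F q| = `|p - q|) -> lipschitz01 L f ->
  (forall n v, Phi n v = f (interp n.+1 (map F v))) ->
  (forall n, mseq n.+2 (fun _ : R => Phi n)) ->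
  measurable_fun setT X -> measurable_fun setT phi ->
  {ae P, forall w, X w (time_start t) = a} -> {ae P, forall w, X w (time_end t) = b} ->
  (forall w s, X w (time_end t) = b -> phi w s = F (path_row a b (X w) s)) ->
  skel_expectation P X n (Phi n) @[n --> \oo] --> (\int[P]_w (f (phi w))%:E)%E.
Proof.
move=> FF lf PhiE mPhi mX mphi Xa Xb phiE; have [L0 f01 _] := lf.
have [] := @dominated_convergence _ T R P setT measurableT
  (fun n w => (Phi n (skel_rows (grid_values n.+2 (X w))))%:E)
  (fun w => (f (phi w))%:E) (cst 1%E); last by [].
- move=> n; apply/measurable_EFinP.
  apply: (@measurable_grid_values _ _ _ _ X mX n.+2 _ _ (fun l => Phi n (skel_rows l))).
  exact: (@mseq_skel_rows R n (Phi n) (mPhi n) _ (R * R)%type snd measurable_snd).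
- by apply/measurable_EFinP; exact: (measurableT_comp (lipschitz01_measurable lf) mphi).
- apply: filterS2 Xa Xb => w wa wb _.
  apply/fine_cvgP; split; first exact: nearW.
  apply/cvgrPdist_le => e e0.
  have e1 : 0 < e / (L + 1) by rewrite divr_gt0// ltr_wpDl.
  have [N hN] := interp_skel_rows e1 FF wa wb (phiE w ^~ wb).
  near=> n; rewrite distrC /= PhiE.
  have Nn : (N <= n.+1)%N by apply: leqW; near: n; exact: nbhs_infty_ge.
  apply: (le_trans (lipschitz01_dist lf (ltW e1) (hN _ Nn))).
  rewrite mulrCA ler_piMr//; first exact: ltW.
  by rewrite ler_pdivrMr ?ltr_wpDl// mul1r lerDl.
- exact: finite_measure_integrable_cst.
- apply: aeW => w n _ /=; rewrite lee_fin PhiE.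
  by have /andP[? ?] := f01 (interp n.+1 (map F (skel_rows (grid_values n.+2 (X w)))));
    rewrite ger0_norm.
Unshelve. all: by end_near. Qed.

(** With [c = e ^+ 2 / t] the exponent is [2 * c * n.+3]. Since [expR (2 * y) >= (1 + y) ^+ 2] for
    [y >= 0], the product is at most [1 / (c ^+ 2 * n.+1)]. *)
Lemma skel_error_small (e : R) : 0 < e ->
  \forall n \near \oo, n.+1%:R * expR (- (2 * e ^+ 2 / mesh t n.+2)) <= e.
Proof.
move=> e0.
pose c := e ^+ 2 / t%:num.
have c0 : 0 < c by rewrite divr_gt0// exprn_gt0.
near=> n.
have n1 : 0 < n.+1%:R :> R by [].
have h : (e * c ^+ 2)^-1 <= n.+1%:R.
  apply: ltW; apply: lt_trans (_ : n%:R < _); last by rewrite ltr_nat.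
  by near: n; exact: nbhs_infty_gtr.
set E := expR _.
have hE : E * (c * n.+1%:R) ^+ 2 <= 1.
  rewrite /E expRN mulrC ler_pdivrMr ?expR_gt0// mul1r.
  have -> : 2 * e ^+ 2 / mesh t n.+2 = 2 * (c * n.+3%:R).
    by rewrite /c /mesh invf_div; field; rewrite gt_eqF.
  rewrite expRM_natl.
  rewrite ler_sqr ?nnegrE ?expR_ge0//; last by rewrite mulr_ge0// ltW.
  apply: (le_trans _ (expR_ge1Dx _)); apply: (@le_trans _ _ (c * n.+3%:R)); last by rewrite lerDr.
  by rewrite ler_pM2l// ler_nat ltnS ltnW.
rewrite -(ler_pM2r (_ : 0 < c ^+ 2 * n.+1%:R)); last by rewrite mulr_gt0// exprn_gt0.
have -> : n.+1%:R * E * (c ^+ 2 * n.+1%:R) = E * (c * n.+1%:R) ^+ 2 by ring.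
apply: (le_trans hE); rewrite mulrA.
by rewrite -ler_pdivrMl ?mulr_gt0 ?exprn_gt0// mulr1.
Unshelve. all: by end_near. Qed.

Lemma lipschitz_expectation_eq (a b L : R) X X' (phi phi' : T -> cpath t V3) f :
  0 <= a -> 0 <= b -> has_bridge_law P a b X -> has_bridge_law P b a X' ->
  lipschitz01 L f ->
  measurable_fun setT X -> measurable_fun setT phi ->
  {ae P, forall w, X w (time_start t) = a} -> {ae P, forall w, X w (time_end t) = b} ->
  (forall w s, X w (time_end t) = b -> phi w s = path_row a b (X w) s) ->
  measurable_fun setT X' -> measurable_fun setT phi' ->
  {ae P, forall w, X' w (time_start t) = b} -> {ae P, forall w, X' w (time_end t) = a} ->
  (forall w s, X' w (time_end t) = a -> phi' w s = swap3 (path_row b a (X' w) s)) ->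
  (\int[P]_w (f (phi w))%:E = \int[P]_w (f (phi' w))%:E)%E.
Proof.
move=> a0 b0 law law' lf mX mphi Xa Xb phiE mX' mphi' Xa' Xb' phiE'.
have [L0 f01 _] := lf.
have mf n : mseq n.+2 (fun _ : R => f \o @interp R t V3 n.+1).
  exact: (lip_seq_mseq n.+2 L0 (lipschitz01_lip_seq n.+1 lf)).
have mf' n := mseq_swap (mf n).
have cX := skel_expectation_cvg (F := id) (Phi := fun n => f \o @interp R t V3 n.+1)
  (fun _ _ => erefl) lf (fun n v => congr1 (fun l => f (interp n.+1 l)) (esym (map_id v)))
  mf mX mphi Xa Xb phiE.
have cX' := skel_expectation_cvg (@normB_swap3 R) lf (fun _ _ => erefl) mf' mX' mphi' Xa' Xb' phiE'.
have error (e : R) : 0 < e -> exists2 e', 0 < e' & \forall n \near \oo,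
    2 * (L * (4 * e') + n.+1%:R * expR (- (2 * e' ^+ 2 / mesh t n.+2))) <= e.
  (* The choice of [e'] solves [2 * (L * (4 * e') + e') = e], the exponential term being eventually
     at most [e']. *)
  move=> e0; have e'0 : 0 < e / (8 * L + 2) by rewrite divr_gt0// ltr_wpDl// mulr_ge0.
  exists (e / (8 * L + 2)) => //.
  apply: filterS (skel_error_small e'0) => n hn.
  set e' := e / _ in hn *; have : e' * (8 * L + 2) = e.
    by rewrite divfK// gt_eqF// ltr_wpDl// mulr_ge0.
  by lra.
have shift (u : nat -> \bar R) (l : \bar R) (e : R) : u n @[n --> \oo] --> l ->
    (u n + e%:E)%E @[n --> \oo] --> (l + e%:E)%E.
  by move=> ul; apply: cvgeD => //; [exact: fin_num_adde_defl|exact: cvg_cst].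
(* [skel_compare] is one-sided; the converse inequality exchanges the two bridges and uses that
   [swap3] is an involution. *)
apply/eqP; rewrite eq_le; apply/andP; split; apply/lee_addgt0Pr => e /error[e' e'0 he'].
- apply: (lee_cvg_to cX (shift _ _ e cX')).
  apply: filterS he' => n hn.
  apply: (le_trans (skel_compare a0 b0 law law' (mf n) _ _
    (lipschitz01_lip_seq n.+1 lf) L0 (ltW e'0) erefl)).
  + by move=> v; have /andP[] := f01 (interp n.+1 v).
  + by move=> v; have /andP[] := f01 (interp n.+1 v).
  + by apply: leeD2l; rewrite lee_fin.
- apply: (lee_cvg_to cX' (shift _ _ e cX)).
  apply: filterS he' => n hn.
  apply: (le_trans (skel_compare b0 a0 law' law (mf' n) _ _
    (lip_seq_swap (lipschitz01_lip_seq n.+1 lf)) L0 (ltW e'0) erefl)).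
  + by move=> v; have /andP[] := f01 (interp n.+1 (map (@swap3 R) v)).
  + by move=> v; have /andP[] := f01 (interp n.+1 (map (@swap3 R) v)).
  + rewrite (_ : _ \o map _ \o map _ = f \o @interp R t V3 n.+1); last first.
      by apply/funext => v /=; rewrite mapK//; exact: swap3K.
    by apply: leeD2l; rewrite lee_fin.
Qed.

End lipschitz_expectation.

(** * Equality of laws *)

Section lipschitz_law.
Context {R : realType} {t : {posnum R}} {d : measure_display}
  {T : measurableType d} (P : probability T R).
Notation V3 := (R * R * R)%type.
Notation path := (cpath t V3).

(* Its infimum is the uniform distance to [F] truncated at 1. *)
Definition near_set (F : set path) (x : path) : set R := [set e | e = 1 \/
  0 <= e /\ exists2 y, F y & forall s, `|x s - y s| <= e].

Definition trunc_dist (F : set path) (x : path) : R := inf (near_set F x).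

Lemma near_set_has_inf F x : has_inf (near_set F x).
Proof.
split; first by exists 1; left.
by exists 0 => e [->//|[]].
Qed.

Lemma trunc_dist_ge0 F x : 0 <= trunc_dist F x.
Proof.
apply: lb_le_inf; first by exists 1; left.
by move=> e [->//|[]].
Qed.

Lemma trunc_dist_le (F : set path) (x y : path) (e : R) : 0 <= e ->
  (forall s, `|x s - y s| <= e) -> trunc_dist F x <= trunc_dist F y + e.
Proof.
move=> e0 xy; rewrite -lerBlDr; apply: lb_le_inf; first by exists 1; left.
move=> e' [->|[e'0 [z Fz yz]]]; rewrite lerBlDr.
  apply: (@le_trans _ _ 1); last by rewrite lerDl.
  by apply: (ge_inf (near_set_has_inf F x).2); left.
apply: (ge_inf (near_set_has_inf F x).2); right; split; first exact: addr_ge0.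
exists z => // s; rewrite -(subrKA (y s)) [leRHS]addrC.
by rewrite (le_trans (ler_normD _ _))// lerD.
Qed.

Lemma trunc_dist_eq0 (F : set path) x : F x -> trunc_dist F x = 0.
Proof.
move=> Fx; apply/eqP; rewrite eq_le trunc_dist_ge0 andbT.
apply: (ge_inf (near_set_has_inf F x).2); right; split => //.
by exists x => // s; rewrite subrr normr0.
Qed.

Lemma trunc_dist_gt0 (U : set path) x : open U -> U x -> 0 < trunc_dist (~` U) x.
Proof.
move=> oU Ux; have /nbhs_ballP[r /= r0 rU] : nbhs x U by exact: open_nbhs_nbhs.
apply: (@lt_le_trans _ _ (Num.min 1 r)); first by rewrite lt_min ltr01.
apply: lb_le_inf; first by exists 1; left.
move=> e [->|[e0 [y Uy xy]]]; rewrite ge_min ?lexx//.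
apply/orP; right; rewrite leNgt; apply/negP => er.
by apply/Uy/rU/cpath_ballE => s; exact: le_lt_trans er.
Qed.

(** Lipschitz approximation from below of the indicator of an open set. The truncation of the
    distance at 1 covers an empty complement. *)
Definition ramp (U : set path) (j : nat) (x : path) : R :=
  Num.min 1 (j%:R * trunc_dist (~` U) x).

Lemma ramp_lipschitz U j : lipschitz01 j%:R (ramp U j).
Proof.
split => // [x|x y e e0 xy].
  by rewrite /ramp le_min ler01 mulr_ge0 ?trunc_dist_ge0//= ge_min lexx.
rewrite /ramp; have h := trunc_dist_le (~` U) e0 xy.
have je : 0 <= j%:R * e by rewrite mulr_ge0.
have : j%:R * trunc_dist (~` U) x <= j%:R * trunc_dist (~` U) y + j%:R * e.
  by rewrite -mulrDr ler_wpM2l.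
rewrite ge_min; have [h1|h1] := leP 1 (j%:R * trunc_dist (~` U) y) => h2.
  by rewrite lerDl je.
by rewrite h2 orbT.
Qed.

Lemma ramp_cvg U x : open U -> ramp U j x @[j --> \oo] --> (\1_U x : R).
Proof.
move=> oU; apply: cvg_near_cst; rewrite indicE.
have [xU|xU] := boolP (x \in U).
  have D0 := trunc_dist_gt0 oU (set_mem xU).
  near=> j; rewrite /ramp; apply/min_idPl.
  rewrite -ler_pdivrMr// mul1r ltW//; near: j; exact: nbhs_infty_gtr.
apply: nearW => j; rewrite /ramp trunc_dist_eq0 ?mulr0 ?min_r//.
by move=> Ux; move/negP: xU; apply; exact: mem_set.
Unshelve. all: by end_near. Qed.

Lemma open_probability_cvg (Y : T -> path) U : measurable_fun setT Y -> open U ->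
  (\int[P]_w (ramp U j (Y w))%:E @[j --> \oo] --> P (Y @^-1` U))%E.
Proof.
move=> mY oU.
have mU : measurable (Y @^-1` U).
  by rewrite -[X in measurable X]setTI; apply: mY => //; exact: sub_sigma_algebra.
have -> : P (Y @^-1` U) = (\int[P]_w (\1_U (Y w))%:E)%E.
  rewrite (_ : (fun w => (\1_U (Y w))%:E) = fun w => (\1_(Y @^-1` U) w)%:E).
    by rewrite integral_indic// setIT.
  by apply/funext => w; rewrite !indicE.
have [] := @dominated_convergence _ T R P setT measurableT
  (fun j w => (ramp U j (Y w))%:E) (fun w => (\1_U (Y w))%:E) (cst 1%E); last by [].
- move=> j; apply/measurable_EFinP.
  exact: (measurableT_comp (lipschitz01_measurable (ramp_lipschitz U j)) mY).
- apply/measurable_EFinP; rewrite (_ : (fun w => \1_U (Y w)) = \1_(Y @^-1` U)).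
    exact: measurable_indic.
  by apply/funext => w; rewrite !indicE.
- apply: aeW => w _; apply: cvg_EFin; first exact: nearW.
  exact: ramp_cvg.
- exact: finite_measure_integrable_cst.
- apply: aeW => w j _ /=; rewrite lee_fin.
  by have [_ /(_ (Y w))/andP[? ?] _] := ramp_lipschitz U j; rewrite ger0_norm.
Qed.

(** Ramps give equality on open sets, which are stable under intersection and generate the Borel
    sigma-algebra; finite measures that agree on such a class are equal. *)
Lemma same_law_lipschitz (Y Y' : T -> path) :
  measurable_fun setT Y -> measurable_fun setT Y' ->
  (forall L f, lipschitz01 L f ->
    (\int[P]_w (f (Y w))%:E = \int[P]_w (f (Y' w))%:E)%E) ->
  same_law P Y Y'.
Proof.
move=> mY mY' YY'; split => // A mA.
have oP U : open U -> P (Y @^-1` U) = P (Y' @^-1` U).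
  move=> oU; apply: (cvg_unique _ (open_probability_cvg mY oU)) => //.
  have h := open_probability_cvg mY' oU; apply: cvg_trans h.
  apply: near_eq_cvg; apply: nearW => j; apply/esym.
  exact: YY' (ramp_lipschitz U j).
pose m1 : {measure set path -> \bar R} :=
  measure_function_pushforward__canonical__measure_function_Measure P mY.
pose m2 : {measure set path -> \bar R} :=
  measure_function_pushforward__canonical__measure_function_Measure P mY'.
apply: (@measure_unique _ R path (@open path) (fun=> setT) _ _ _ _ m1 m2) => //.
- by move=> U V oU oV; exact: openI.
- by move=> _; exact: openT.
- by apply/seteqP; split => // x _; exists 0%N.
- by move=> _; rewrite /= /pushforward preimage_setT probability_setT ltry.
Qed.

End lipschitz_law.

Section bridge_paths.
Context {R : realType} {t : {posnum R}}.
Implicit Types x : cpath t R.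

Lemma measurable_bridge_path a b : measurable_fun setT (@bridge_path R t a b).
Proof.
apply: measurable_continuous_cpath_cpath; apply: (@lipschitz_continuous_cpath _ _ _ _ _ 7).
by move=> x y e _; exact: bridge_path_lip.
Qed.

Lemma measurable_trev : measurable_fun setT (@trev R t).
Proof.
apply: measurable_continuous_cpath_cpath; apply: (@lipschitz_continuous_cpath _ _ _ _ _ 1).
by move=> x y e _ xy s; rewrite mul1r; exact: xy.
Qed.

Definition swapped_path a b x : cpath t (R * R * R)%type :=
  cpath3 (addc (Mbar (a - b) (addc x (- a))) b) (addc (Pbar x) a) x.

Lemma swapped_pathE a b x s : swapped_path a b x s = swap3 (bridge_path a b x s).
Proof. by []. Qed.

Lemma measurable_swapped_path a b : measurable_fun setT (swapped_path a b).
Proof.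
apply: measurable_continuous_cpath_cpath; apply: (@lipschitz_continuous_cpath _ _ _ _ _ 7).
by move=> x y e _ xy s; rewrite !swapped_pathE normB_swap3; exact: bridge_path_lip.
Qed.

Lemma trev_start x : trev x (time_start t) = x (time_end t).
Proof. by congr (x _); apply/val_inj; rewrite /= subr0. Qed.

Lemma trev_end x : trev x (time_end t) = x (time_start t).
Proof. by congr (x _); apply/val_inj; rewrite /= subrr. Qed.

End bridge_paths.

Theorem theorem1p1 (R : realType) (t : {posnum R}) (a b : R)
    (ha : 0 <= a) (hb : 0 <= b)
    (d : measure_display) (T : measurableType d) (P : probability T R)
    (rho : {RV P >-> cpath t R}) :
  bessel3_bridge a b rho ->
  same_law P
    (fun w => cpath3 (addc (Mbar (b - a) (addc (trev (rho w)) (- b))) a)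
                     (addc (Pbar (trev (rho w))) b)
                     (trev (rho w)))
    (fun w => cpath3 (rho w)
                     (addc (Pbar (rho w)) a)
                     (addc (Mbar (a - b) (addc (rho w) (- a))) b)).
Proof.
move=> [rho_start rho_end _ fdd].
have mrho : measurable_fun setT rho by [].
have mtrev := measurableT_comp measurable_trev mrho.
have law := has_bridge_law_fdd ha hb mrho fdd.
have law' := has_bridge_law_trev ha hb law.
have mphi : measurable_fun setT (fun w => bridge_path a b (rho w)) :=
  measurableT_comp (measurable_bridge_path a b) mrho.
have mphi' : measurable_fun setT (fun w => swapped_path b a (trev (rho w))) :=
  measurableT_comp (measurable_swapped_path b a) mtrev.
(* The second bridge is the reversal of [rho], from [b] to [a]. Listing its three processes in
   swapped order puts [trev (rho w)] last, as in the statement. *)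
apply: same_law_lipschitz => // L f lf; apply/esym.
apply: (lipschitz_expectation_eq ha hb law law' lf mrho mphi _ _ _ mtrev mphi').
- exact: rho_start.
- exact: rho_end.
- by move=> w s; exact: bridge_pathE.
- by apply: filterS rho_end => w; rewrite trev_start.
- by apply: filterS rho_start => w; rewrite trev_end.
- by move=> w s wa; rewrite swapped_pathE bridge_pathE.
Qed.
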